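(* Let $A$, $B$ be $C^2$ convex bodies in $\mathbb{R}^n$, and let $a$, $b$, $a+b$ be boundary points of $A$, $B$, $A+B$, respectively. Let $0\le\alpha\le 1$ and let $k$ be a nonnegative integer, $\infty$ or $\omega$. If $A$ is $C^{k,\alpha}$ near $a$ and $G_{A}(a)\neq 0$, then (i) $A+B$ is $C^2$ near $a+b$; (ii) $G_{B}(b)\neq 0$ if and only if $G_{A+B}(a+b)\neq 0$; (iii) $B$ is $C^{k,\alpha}$ near $b$ if and only if $A+B$ is $C^{k,\alpha}$ near $a+b$.
   Context: A convex body in $\mathbb{R}^n$ is a compact convex set with non-empty interior. A convex body (or a neighborhood of a boundary point of it) is $C^{k,\alpha}$ if its boundary is (near that point) a $C^{k,\alpha}$ submanifold of $\mathbb{R}^n$; here $C^\omega$ means real analytic and $C^{k,\alpha}$ refers to functions whose $k$th partial derivatives are continuous if $\alpha=0$, Lipschitz if $\alpha=1$, and $\alpha$-Hölder if $0<\alpha<1$. $A+B=\{a+b: a\in A, b\in B\}$ is the Minkowski sum. For a $C^2$ convex body $C$, $G_C$ denotes the Gaussian curvature of $\partial C$, i.e. the product of the eigenvalues of the differential of the Gauss map $\nu_C\colon\partial C\to S^{n-1}$ given by the unit outer normal. *)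

(* Defs.v *)
From HB Require Import structures.
From mathcomp Require Import all_boot all_order all_algebra.
From mathcomp Require Import all_classical all_reals all_analysis.
Set Implicit Arguments. Unset Strict Implicit. Unset Printing Implicit Defensive.
Import Order.TTheory GRing.Theory Num.Theory.
Import numFieldNormedType.Exports.
Local Open Scope classical_set_scope.
Local Open Scope ring_scope.

(* Points of R^n are row vectors 'rV[R]_n (topology: the product/max norm,  *)
(* which induces the usual topology).                                         *)

Definition dotp (R : realType) (n : nat) (u v : 'rV[R]_n) : R := (u *m v^T) 0 0.
Definition enorm (R : realType) (n : nat) (u : 'rV[R]_n) : R := Num.sqrt (dotp u u).

Definition convex_body (R : realType) (n : nat) (C : set 'rV[R]_n) : Prop :=
  [/\ compact C, convex_set (C : set (convex_lmodType 'rV[R]_n)) & C° !=set0].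

Definition boundary (R : realType) (n : nat) (C : set 'rV[R]_n) : set 'rV[R]_n :=
  closure C `\` C°.

Definition minkowski_sum (R : realType) (n : nat) (A B : set 'rV[R]_n) : set 'rV[R]_n :=
  [set x | exists a, A a /\ exists b, B b /\ x = a + b].

Inductive regularity := Ck of nat | Cinf | Comega.

Fixpoint pderiv (R : realType) (m : nat) (s : seq 'I_m) (f : 'rV[R]_m -> R)
  : 'rV[R]_m -> R :=
  if s is i :: s' then 'D_(delta_mx 0 i) (pderiv s' f) else f.

Definition smooth_k (R : realType) (m : nat) (k : nat) (V : set 'rV[R]_m)
    (f : 'rV[R]_m -> R) : Prop :=
  forall s : seq 'I_m, (size s <= k)%N ->
    {within V, continuous (pderiv s f)} /\
    ((size s < k)%N -> forall (i : 'I_m) x, V x -> derivable (pderiv s f) x (delta_mx 0 i)).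

Definition holder (R : realType) (m : nat) (al : R) (V : set 'rV[R]_m)
    (g : 'rV[R]_m -> R) : Prop :=
  exists L : R, forall x y, V x -> V y -> `|g x - g y| <= L * (`|x - y| `^ al).

(* Real analytic on V: near every point of V, f is the sum of an absolutely *)
(* convergent power series (written with coefficients indexed by words of   *)
(* variables, i.e. sum_d sum_{t : d-tuple} c_d(t) prod_j (y - x)_{t_j}).    *)
Definition analytic_on (R : realType) (m : nat) (V : set 'rV[R]_m)
    (f : 'rV[R]_m -> R) : Prop :=
  forall x, V x -> exists2 r : R, 0 < r &
    exists c : forall d : nat, d.-tuple 'I_m -> R,
      forall y, V y -> `|y - x| < r ->
        cvgn (series (fun d => \sum_(t : d.-tuple 'I_m)
                 `|c d t| * \prod_(j < d) `|(y - x) 0 (tnth t j)|)) /\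
        (series (fun d => \sum_(t : d.-tuple 'I_m)
                 c d t * \prod_(j < d) (y - x) 0 (tnth t j)) @ \oo --> f y).

Definition graph_reg (R : realType) (m : nat) (r : regularity) (al : R)
    (V : set 'rV[R]_m) (f : 'rV[R]_m -> R) : Prop :=
  match r with
  | Ck k => smooth_k k V f /\
            (0 < al -> forall s : seq 'I_m, size s = k -> holder al V (pderiv s f))
  | Cinf => forall k, smooth_k k V f
  | Comega => analytic_on V f
  end.

(* C is C^{r,alpha} near p: near p, the boundary of C is the graph of a      *)
(* C^{r,alpha} function over an open subset of a hyperplane u^perp           *)
(* (the rows of Q form an orthonormal basis of u^perp).                      *)
Definition regular_near (R : realType) (n : nat) (r : regularity) (al : R)
    (C : set 'rV[R]_n) (p : 'rV[R]_n) : Prop :=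
  exists (u : 'rV[R]_n) (Q : 'M[R]_(n.-1, n)) (V : set 'rV[R]_(n.-1))
         (W : set 'rV[R]_n) (f : 'rV[R]_(n.-1) -> R),
    [/\ enorm u = 1, Q *m Q^T = 1%:M & Q *m u^T = 0] /\
    [/\ open V, open W, W p,
         boundary C `&` W = [set x *m Q + f x *: u | x in V] `&` W
       & graph_reg r al V f].

Definition C2_body (R : realType) (n : nat) (C : set 'rV[R]_n) : Prop :=
  convex_body C /\ forall p, boundary C p -> regular_near (Ck 2) 0 C p.

(* Gauss map: the unit outer normal (unique for a C^1 convex body). *)
Definition outer_unit_normals (R : realType) (n : nat) (C : set 'rV[R]_n)
    (p : 'rV[R]_n) : set 'rV[R]_n :=
  [set v | enorm v = 1 /\ forall y, C y -> dotp v (y - p) <= 0].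
Definition gauss_map (R : realType) (n : nat) (C : set 'rV[R]_n) (p : 'rV[R]_n)
  : 'rV[R]_n := xget 0 (outer_unit_normals C p).

(* L (acting on row vectors, v |-> v *m L) is the differential at p of the   *)
(* Gauss map restricted to the boundary, extended by 0 on the normal line.   *)
Definition gauss_differential (R : realType) (n : nat) (C : set 'rV[R]_n)
    (p : 'rV[R]_n) (L : 'M[R]_n) : Prop :=
  gauss_map C p *m L = 0 /\
  forall e : R, 0 < e -> exists2 d : R, 0 < d &
    forall q, boundary C q -> `|q - p| < d ->
      `|gauss_map C q - gauss_map C p - (q - p) *m L| <= e * `|q - p|.

(* g is the Gaussian curvature at p: the determinant (= product of the       *)
(* eigenvalues) of the differential of the Gauss map as an endomorphism of   *)
(* the tangent space nu(p)^perp, computed in an orthonormal basis (rows of Q).*)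
Definition gauss_curv_rel (R : realType) (n : nat) (C : set 'rV[R]_n)
    (p : 'rV[R]_n) (g : R) : Prop :=
  exists (L : 'M[R]_n) (Q : 'M[R]_(n.-1, n)),
    [/\ gauss_differential C p L, Q *m Q^T = 1%:M,
        Q *m (gauss_map C p)^T = 0 & g = \det (Q *m L *m Q^T)].

Definition gauss_curv (R : realType) (n : nat) (C : set 'rV[R]_n) (p : 'rV[R]_n) : R :=
  xget 0 [set g | gauss_curv_rel C p g].

(* Main.v *)
(* Let nu be the common outer unit normal of A at a, of B at b and of A+B at a+b. Over the hyperplane
   orthogonal to u = -nu the three boundaries are, near these points, graphs of convex functions F, G, h,
   and comparing supporting hyperplanes shows h (X + Y) = F X + G Y as soon as grad F X = grad G Y.
   In such graph coordinates the curvature is det (Hess F 0), so grad F is locally invertible, with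
   inverse phi as regular as grad F. Since Hess F 0 and Hess G 0 satisfy the cyclic monotonicity
   inequality, Hess F 0 + Hess G 0 is invertible, so Theta y = y + phi (grad G y) has a local inverse Y,
   and with X z = z - Y z one gets grad h = grad G o Y. Hence h is as regular as F and G, and
   Hess h 0 = DY 0 * Hess G 0. Conversely X = phi o grad h is as regular as F and h; then so are
   Y = id - X, its inverse Theta and G = h o Theta - F o X o Theta. The class is lowered by one in
   grad F, so C^0 and C^1 are covered by the C^2 hypothesis instead. Analytic inverses are obtained as
   limits of Picard iterations converging in the norm of absolutely convergent power series. *)

Require Import Defs.
From HB Require Import structures.
From mathcomp Require Import all_boot all_order all_algebra.
From mathcomp Require Import all_classical all_reals all_analysis.
From mathcomp Require Import ring lra.
Set Implicit Arguments. Unset Strict Implicit. Unset Printing Implicit Defensive.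
Import Order.TTheory GRing.Theory Num.Theory.
Import numFieldNormedType.Exports.
Local Open Scope classical_set_scope.
Local Open Scope ring_scope.

(** * Norms and differentiability *)

(** The maps X and Y are one class below F and G, so writing h as F o X + G o Y seems to lose a
    derivative. It comes back because the two gradients are matched and DX + DY is the identity: the
    derivatives of X and Y cancel in grad h, and at finite order regularity is read off grad h
    rather than h. The same happens with grad G when G is recovered from h.

    A graph given by [regular_near] may lie over any hyperplane, while the regularity of the sum is
    what has to be found. All three boundaries are therefore described by one infimum, [lower], over
    the common tangent hyperplane, and an inverse function argument moves a class from an arbitrary
    frame to this one and back.

    Invertibility of Hess F 0 + Hess G 0 is usually deduced from symmetric semidefinite forms. Here
    an inequality taken along a cycle of three points takes the place of symmetry.

    The curvature is a value chosen by [xget], so it becomes a determinant only after the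
    differential of the Gauss map is shown to be unique and the determinant to be independent of the
    orthonormal basis. *)

Ltac vring := apply/rowP => ?; rewrite !mxE; ring.

Section Norms.
Context {R : realType}.

Lemma rV_norm_le m (x : 'rV[R]_m) (e : R) :
  0 <= e -> (forall i, `|x 0 i| <= e) -> `|x| <= e.
Proof.
move=> e0 xe; rewrite /Num.Def.normr/= mx_normrE (bigmax_le _ e0)//= => -[i j] _ /=.
by rewrite ord1.
Qed.

Lemma rV_coord_le m (x : 'rV[R]_m) i : `|x 0 i| <= `|x|.
Proof.
rewrite [leRHS]/Num.Def.normr/= mx_normrE.
by apply: le_trans (le_bigmax _ _ (0, i)).
Qed.

Lemma mxBE m p (M N : 'M[R]_(m, p)) i j : (M - N) i j = M i j - N i j.
Proof. by rewrite !mxE. Qed.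

Lemma mulmx_bound m p (M : 'M[R]_(m, p)) :
  exists2 C : R, 0 < C & forall u : 'rV_m, `|u *m M| <= C * `|u|.
Proof.
pose C := \sum_i \sum_j `|M i j|.
have C0 : 0 <= C by apply: sumr_ge0 => i _; apply: sumr_ge0.
exists (1 + C) => [|u]; first by rewrite ltr_pwDl.
apply: rV_norm_le => [|j]; first by rewrite mulr_ge0// addr_ge0.
rewrite mxE; apply: (le_trans (ler_norm_sum _ _ _)).
apply: (@le_trans _ _ (C * `|u|)); last by rewrite mulrDl mul1r lerDr.
rewrite /C mulr_suml; apply: ler_sum => i _; rewrite normrM mulrC.
apply: ler_pM => //; last exact: rV_coord_le.
by rewrite (bigD1 j)//= lerDl sumr_ge0.
Qed.

(** The minimum of finitely many radii, taken along the enumeration of [I]. It turns estimates for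
    single coordinates into estimates for vectors. *)
Lemma common_radius (I : finType) (P : I -> R -> Prop) :
  (forall i, exists2 d, 0 < d & P i d) ->
  (forall i d d', 0 < d' -> d' <= d -> P i d -> P i d') ->
  exists2 d, 0 < d & forall i, P i d.
Proof.
move=> ex mono.
suff [d d0 H] : exists2 d : R, 0 < d & forall i, i \in enum I -> P i d.
  by exists d => // i; apply: H; rewrite mem_enum.
elim: (enum I) => [|i s [d d0 Hd]]; first by exists 1.
have [d' d'0 Pi] := ex i.
exists (Num.min d d') => [|j]; first by rewrite lt_min d0.
have m0 : 0 < Num.min d d' by rewrite lt_min d0.
rewrite inE => /predU1P[->|/Hd Pj].
  by apply: (mono _ _ _ m0 _ Pi); rewrite ge_min lexx orbT.
by apply: (mono _ _ _ m0 _ Pj); rewrite ge_min lexx.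
Qed.

Lemma open_ballP (V : normedModType R) (A : set V) x : open A -> A x ->
  exists2 d : R, 0 < d & forall y, `|y - x| < d -> A y.
Proof.
move=> oA Ax; have /nbhs_ballP[d /= d0 dA] := open_nbhs_nbhs (conj oA Ax).
by exists d => // y yx; apply: dA; rewrite -ball_normE /= distrC.
Qed.

Lemma near_ballP (V : normedModType R) (P : V -> Prop) x :
  (\near x, P x) <-> exists2 d : R, 0 < d & forall y, `|y - x| < d -> P y.
Proof.
split => [/nbhs_ballP[d /= d0 dA]|[d d0 dA]].
  by exists d => // y yx; apply: dA; rewrite -ball_normE /= distrC.
by apply/nbhs_ballP; exists d => //= y; rewrite -ball_normE /= distrC; apply: dA.
Qed.

Lemma cont_ballP (V W : normedModType R) (f : V -> W) x :
  {for x, continuous f} <-> (forall e, 0 < e -> exists2 d : R, 0 < d &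
    forall y, `|y - x| < d -> `|f y - f x| < e).
Proof.
split=> [/cvgrPdist_lt fx e e0|H].
  by have /near_ballP[d d0 dP] := fx e e0; exists d => // y /dP; rewrite distrC.
apply/cvgrPdist_lt => e e0; have [d d0 dP] := H e e0.
by apply/near_ballP; exists d => // y /dP; rewrite distrC.
Qed.

Lemma cont_rVP (V : normedModType R) m (g : V -> 'rV[R]_m) x :
  (forall j, {for x, continuous (fun y => g y 0 j)}) <-> {for x, continuous g}.
Proof.
split=> [H|H j]; last first.
  have /cont_ballP H' := H; apply/cont_ballP => e e0; have [d d0 dP] := H' _ e0.
  exists d => // y /dP; apply: le_lt_trans.
  by have := rV_coord_le (g y - g x) j; rewrite !mxE.
apply/cont_ballP => e e0.
have [|j d d' d'0 dd' + y yx|d d0 dP] := @common_radius _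
    (fun j d => forall y, `|y - x| < d -> `|g y 0 j - g x 0 j| < e / 2).
- by move=> j; have /cont_ballP := H j; apply; rewrite divr_gt0.
- by apply; apply: lt_le_trans dd'.
exists d => // y yx; apply: (@le_lt_trans _ _ (e / 2)); last by rewrite ltr_pdivrMr// ltr_pMr// ltr1n.
by apply: rV_norm_le => [|j]; [rewrite divr_ge0// ltW|rewrite !mxE ltW// dP].
Qed.

Lemma open_ball0 m (d : R) (x : 'rV[R]_m) : open [set y | `|y - x| < d].
Proof.
have -> : [set y : 'rV[R]_m | `|y - x| < d] = ball x d; last exact: ball_open.
by apply/seteqP; split=> y /=; rewrite -ball_normE /= distrC.
Qed.

End Norms.

Section Dotp.
Context {R : realType} {n : nat}.
Implicit Types (u v w : 'rV[R]_n).

Lemma dotpE u v : dotp u v = \sum_i u 0 i * v 0 i.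
Proof. by rewrite /dotp mxE; apply: eq_bigr => i _; rewrite mxE. Qed.

Lemma dotpC u v : dotp u v = dotp v u.
Proof. by rewrite !dotpE; apply: eq_bigr => i _; rewrite mulrC. Qed.

Lemma dotpDl u v w : dotp (u + v) w = dotp u w + dotp v w.
Proof. by rewrite /dotp mulmxDl mxE. Qed.

Lemma dotpZl a u v : dotp (a *: u) v = a * dotp u v.
Proof. by rewrite /dotp -scalemxAl mxE. Qed.

Lemma dotpNl u v : dotp (- u) v = - dotp u v.
Proof. by rewrite /dotp mulNmx mxE. Qed.

Lemma dotpBl u v w : dotp (u - v) w = dotp u w - dotp v w.
Proof. by rewrite dotpDl dotpNl. Qed.

Lemma dotp0l u : dotp 0 u = 0.
Proof. by rewrite /dotp mul0mx mxE. Qed.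

Lemma dotpDr u v w : dotp w (u + v) = dotp w u + dotp w v.
Proof. by rewrite dotpC dotpDl !(dotpC w). Qed.

Lemma dotpZr a u v : dotp v (a *: u) = a * dotp v u.
Proof. by rewrite dotpC dotpZl (dotpC v). Qed.

Lemma dotpNr u v : dotp v (- u) = - dotp v u.
Proof. by rewrite dotpC dotpNl (dotpC v). Qed.

Lemma dotpBr u v w : dotp w (u - v) = dotp w u - dotp w v.
Proof. by rewrite dotpDr dotpNr. Qed.

Lemma dotp0r u : dotp u 0 = 0.
Proof. by rewrite dotpC dotp0l. Qed.

Lemma dotp_ge0 u : 0 <= dotp u u.
Proof. by rewrite dotpE sumr_ge0// => i _; rewrite -expr2 sqr_ge0. Qed.

Lemma dotp_eq0 u : dotp u u = 0 -> u = 0.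
Proof.
rewrite dotpE => /eqP; rewrite psumr_eq0; last by move=> i _; rewrite -expr2 sqr_ge0.
move=> /allP H; apply/rowP => i; rewrite mxE; apply/eqP.
by have := H i (mem_index_enum _); rewrite /= -expr2 sqrf_eq0.
Qed.

Lemma dotp_mulr m (u : 'rV[R]_n) (M : 'M[R]_(m, n)) (z : 'rV[R]_m) :
  dotp (z *m M) u = dotp z (u *m M^T).
Proof. by rewrite /dotp trmx_mul trmxK mulmxA. Qed.

Lemma norm_dotp_le u v : `|dotp u v| <= n%:R * (`|u| * `|v|).
Proof.
rewrite dotpE; apply: (le_trans (ler_norm_sum _ _ _)).
apply: (@le_trans _ _ (\sum_(i < n) `|u| * `|v|)); last first.
  by rewrite sumr_const card_ord mulr_natl.
by apply: ler_sum => i _; rewrite normrM ler_pM// rV_coord_le.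
Qed.

Lemma enormE u : enorm u = 1 -> dotp u u = 1.
Proof. by move=> /(congr1 (fun x => x ^+ 2)); rewrite /enorm sqr_sqrtr ?dotp_ge0// expr1n. Qed.

Lemma enorm1 u : dotp u u = 1 -> enorm u = 1.
Proof. by rewrite /enorm => ->; rewrite sqrtr1. Qed.

End Dotp.

(** * Fréchet and strict differentiability *)

Section Differentiability.
Context {R : realType}.
Implicit Types (m : nat).

(** Linearity or boundedness of [L] is asked for only in the lemmas that use it. The companion
    [sdiff] is strict differentiability: both points move, so the error term is Lipschitz with a
    small constant, which is what a contraction argument requires. *)
Definition fdiff (U W : normedModType R) (f : U -> W) x (L : U -> W) :=
  forall e : R, 0 < e -> exists2 d : R, 0 < d &
    forall y, `|y - x| < d -> `|f y - f x - L (y - x)| <= e * `|y - x|.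

Definition sdiff (U W : normedModType R) (f : U -> W) x (L : U -> W) :=
  forall e : R, 0 < e -> exists2 d : R, 0 < d &
    forall y z, `|y - x| < d -> `|z - x| < d ->
      `|f y - f z - L (y - z)| <= e * `|y - z|.

Definition grad m (f : 'rV[R]_m -> R) (x : 'rV[R]_m) : 'rV[R]_m :=
  \row_i 'D_(delta_mx 0 i) f x.

Lemma sdiff_fdiff (U W : normedModType R) (f : U -> W) x L :
  sdiff f x L -> fdiff f x L.
Proof.
move=> H e e0; have [d d0 dP] := H e e0; exists d => // y yx; apply: dP => //.
by rewrite subrr normr0.
Qed.

Lemma dir_derive (U W : normedModType R) (f : U -> W) x v l :
  (forall e, 0 < e -> exists2 d : R, 0 < d & forall t : R, `|t| < d ->
     `|f (t *: v + x) - f x - t *: l| <= e * `|t|) ->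
  is_derive x v f l.
Proof.
move=> fl.
have H : h^-1 *: (f (h *: v + x) - f x) @[h --> 0^'] --> l.
  apply/cvgrPdist_le => e e0; rewrite near_withinE.
  have [d d0 dP] := fl _ e0.
  apply/nbhs_ballP; exists d => //= h; rewrite -ball_normE /= sub0r normrN => hd h0.
  rewrite -[l](scalerK h0) -scalerBr normrZ normfV.
  by rewrite ler_pdivrMl ?normr_gt0// distrC mulrC dP.
apply: DeriveDef; first by apply/cvg_ex; exists l.
exact: cvg_lim H.
Qed.

Lemma fdiff_derive (U W : normedModType R) (f : U -> W) x L v :
  (forall (t : R) v, L (t *: v) = t *: L v) -> fdiff f x L ->
  is_derive x v f (L v).
Proof.
move=> Llin fL; apply: dir_derive => e e0.
have v1 : 0 < 1 + `|v| by rewrite ltr_pwDl.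
have [d d0 dP] := fL _ (divr_gt0 e0 v1).
exists (d / (1 + `|v|)) => [|h hd]; first by rewrite divr_gt0.
have := dP (h *: v + x); rewrite addrK normrZ Llin => /(_ _)/wrap[].
  rewrite ltr_pdivlMr// in hd; apply: le_lt_trans hd.
  by rewrite ler_wpM2l// lerDr.
move=> /le_trans; apply.
have -> : e / (1 + `|v|) * (`|h| * `|v|) = (e * `|h|) * (`|v| / (1 + `|v|)) by ring.
by rewrite ler_piMr ?mulr_ge0 ?(ltW e0)// ler_pdivrMr// mul1r lerDr.
Qed.

Lemma fdiff_cont m (W : normedModType R) (f : 'rV[R]_m -> W) x L (C : R) :
  (forall v, `|L v| <= C * `|v|) -> fdiff f x L -> {for x, continuous f}.
Proof.
move=> LC fL; apply/cont_ballP => e e0.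
have [d d0 dP] := fL 1 ltr01.
have C0 : 0 < 1 + `|C| by rewrite ltr_pwDl.
exists (Num.min d (e / (1 + `|C|))) => [|y]; first by rewrite lt_min d0 divr_gt0.
rewrite lt_min => /andP[yd ye].
rewrite -(subrK (L (y - x)) (f y - f x)) (le_lt_trans (ler_normD _ _))//.
rewrite ltr_pdivlMr// mulrC mulrDl in ye; apply: le_lt_trans ye.
apply: lerD; first exact: dP.
by rewrite (le_trans (LC _))// ler_wpM2r// ler_norm.
Qed.

Lemma sdiff_lipschitz (U W : normedModType R) (f : U -> W) x L (C : R) :
  (forall v, `|L v| <= C * `|v|) -> sdiff f x L ->
  exists2 d : R, 0 < d & forall y z, `|y - x| < d -> `|z - x| < d ->
    `|f y - f z| <= (1 + C) * `|y - z|.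
Proof.
move=> LC fL; have [d d0 dP] := fL 1 ltr01; exists d => // y z yd zd.
rewrite -(subrK (L (y - z)) (f y - f z)) (le_trans (ler_normD _ _))//.
by rewrite mulrDl lerD// dP.
Qed.

(** The increment [t] may have either sign, hence the symmetric range for [s] and the two
    applications of the one-dimensional mean value theorem. *)
Lemma MVT_dir (V : normedModType R) (f : V -> R) (q v : V) (t : R) :
  (forall s, `|s| <= `|t| -> derivable f (q + s *: v) v) ->
  exists2 s, `|s| <= `|t| & f (q + t *: v) - f q = t * 'D_v f (q + s *: v).
Proof.
move=> df; pose g (s : R) := f (q + s *: v).
have E (s : R) : (fun h : R => h^-1 *: (g (h *: (1 : R) + s) - g s)) =
    (fun h : R => h^-1 *: (f (h *: v + (q + s *: v)) - f (q + s *: v))).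
  apply/funext => h; congr (_ *: (_ - _)); rewrite /g; congr f.
  by rewrite [h *: (1 : R)]mulr1 scalerDl addrCA.
have dg (s : R) : `|s| <= `|t| -> is_derive s (1 : R) g ('D_v f (q + s *: v)).
  move=> /df; rewrite /derivable -E => dfs.
  by apply: DeriveDef => //; rewrite /derive -E.
case: (leP 0 t) => t0.
  have [||s] := MVT_segment t0 (f := g) (df := fun s => 'D_v f (q + s *: v)).
  - move=> s; rewrite in_itv/= => /andP[s0 st]; apply: dg.
    by rewrite !ger0_norm// ltW.
  - apply: derivable_within_continuous => s; rewrite in_itv/= => /andP[s0 st].
    by have [] := dg s; rewrite // !ger0_norm.
  - rewrite in_itv/= => /andP[s0 st] H; exists s; first by rewrite !ger0_norm.
    by move: H; rewrite /g scale0r addr0 subr0 mulrC.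
have [||s] := MVT_segment (ltW t0) (f := g) (df := fun s => 'D_v f (q + s *: v)).
- move=> s; rewrite in_itv/= => /andP[s0 st]; apply: dg.
  by rewrite !ler0_norm ?lerN2// ltW.
- apply: derivable_within_continuous => s; rewrite in_itv/= => /andP[s0 st].
  have ls : `|s| <= `|t| by rewrite !ler0_norm ?lerN2 ?(ltW t0).
  by have [] := dg s ls.
- rewrite in_itv/= => /andP[s0 st] H; exists s.
    by rewrite !ler0_norm ?lerN2 ?(ltW t0).
  move: H; rewrite /g scale0r addr0 sub0r mulrN mulrC => H.
  by rewrite -[LHS]opprB H opprK.
Qed.

(** The path from [z] to [y] changes one coordinate at a time; on each leg the mean value theorem
    produces a partial derivative at a point near [x], and continuity compares it with the one at
    [x]. *)
Lemma C1_sdiff m (V : set 'rV[R]_m) (f : 'rV[R]_m -> R) x : open V -> V x ->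
  (forall i y, V y -> derivable f y (delta_mx 0 i)) ->
  (forall i, {for x, continuous ('D_(delta_mx 0 i) f)}) ->
  sdiff f x (fun h => dotp h (grad f x)).
Proof.
move=> oV Vx df cf e e0.
(* The error is shared among the [m] legs of the path; [m.+1] keeps the denominator positive when
   [m] is 0. *)
have e'0 : 0 < e / m.+1%:R by rewrite divr_gt0.
have [|i d d' d'0 dd' + y yx|d d0 dP] := @common_radius R _
    (fun i d => forall y, `|y - x| < d -> V y /\
       `|'D_(delta_mx 0 i) f y - 'D_(delta_mx 0 i) f x| <= e / m.+1%:R).
- move=> i; have /cont_ballP := cf i => /(_ _ e'0)[d d0 dP].
  have [d' d'0 dV] := open_ballP oV Vx.
  exists (Num.min d d') => [|y]; first by rewrite lt_min d0.
  by rewrite lt_min => /andP[yd yd']; split; [exact: dV|exact/ltW/dP].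
- by apply; apply: lt_le_trans dd'.
(* Every point of a leg differs from [x] by at most |y - x| + 2 |z - x| in each coordinate, hence
   the factor 3. *)
exists (d / 3) => [|y z yd zd]; first by rewrite divr_gt0.
pose p (k : nat) : 'rV[R]_m := \row_i (if (i < k)%N then y 0 i else z 0 i).
have p0 : p 0%N = z by apply/rowP => i; rewrite mxE.
have pm : p m = y by apply/rowP => i; rewrite mxE ltn_ord.
have pS (k : 'I_m) : p k.+1 = p k + (y 0 k - z 0 k) *: delta_mx 0 k.
  apply/rowP => i; rewrite !mxE eqxx /= ltnS leq_eqVlt.
  have [->|ik] := eqVneq i k; first by rewrite eqxx ltnn /= mulr1 addrC subrK.
  by rewrite -val_eqE in ik; rewrite (negPf ik) /= mulr0 addr0.
have -> : f y - f z = \sum_(k < m) (f (p k.+1) - f (p k)).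
  rewrite -(big_mkord xpredT (fun k => f (p k.+1) - f (p k))) telescope_sumr//.
  by rewrite pm p0.
rewrite dotpE -sumrB.
apply: (le_trans (ler_norm_sum _ _ _)).
apply: (@le_trans _ _ (\sum_(i < m) e / m.+1%:R * `|y - z|)); last first.
  rewrite sumr_const card_ord -[leLHS]mulr_natl mulrA ler_wpM2r//.
  by rewrite mulrCA ler_piMr ?(ltW e0)// ltW// ltr_pdivrMr// mul1r ltr_nat.
apply: ler_sum => i _; rewrite pS.
have pin s : `|s| <= `|y 0 i - z 0 i| -> `|p i + s *: delta_mx 0 i - x| < d.
  move=> hs; pose q := (`|y - x| + `|z - x| + `|z - x|).
  apply: (@le_lt_trans _ _ q); last first.
    by rewrite /q; rewrite !ltr_pdivlMr// in yd zd; lra.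
  apply: rV_norm_le => [|j]; first by rewrite /q !addr_ge0.
  have yj := rV_coord_le (y - x) j; have zj := rV_coord_le (z - x) j.
  rewrite !mxE in yj zj; rewrite !mxE eqxx /=.
  have [ji|ij] := eqVneq j i.
    subst j; rewrite ltnn mulr1.
    have E : z 0 i + s - x 0 i = (z 0 i - x 0 i) + s by ring.
    rewrite E (le_trans (ler_normD _ _))// /q.
    have : `|y 0 i - z 0 i| <= `|y 0 i - x 0 i| + `|z 0 i - x 0 i|.
      have -> : y 0 i - z 0 i = (y 0 i - x 0 i) - (z 0 i - x 0 i) by ring.
      exact: ler_normB.
    by move=> ?; lra.
  rewrite mulr0 addr0 /q; case: ifP => _.
    by rewrite (le_trans yj)// -addrA lerDl addr_ge0.
  by rewrite (le_trans zj)// lerDr addr_ge0.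
have [s hs|s hs ->] := MVT_dir (f := f) (q := p i) (v := delta_mx 0 i) (t := y 0 i - z 0 i).
  by apply: df; have [] := dP i _ (pin _ hs).
rewrite [(y - z) 0 i]mxE [(- z) 0 i]mxE [grad f x 0 i]mxE -mulrBr normrM mulrC.
apply: ler_pM => //; first by have [] := dP i _ (pin _ hs).
by have := rV_coord_le (y - z) i; rewrite !mxE.
Qed.

Lemma fdiff_cont_rV m (f : 'rV[R]_m -> R) x g :
  fdiff f x (fun h => dotp h g) -> {for x, continuous f}.
Proof.
apply: (@fdiff_cont _ _ _ _ _ (m%:R * `|g|)) => v.
by rewrite (le_trans (norm_dotp_le _ _))// -mulrA (mulrC `|g|).
Qed.

Lemma fdiff_grad m (f : 'rV[R]_m -> R) x g :
  fdiff f x (fun h => dotp h g) ->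
  (forall i, derivable f x (delta_mx 0 i)) /\ grad f x = g.
Proof.
move=> H.
have D i : is_derive x (delta_mx 0 i) f (dotp (delta_mx 0 i) g).
  by apply: (fdiff_derive _ _ H) => t v; rewrite dotpZl.
split=> [i|]; first by have [] := D i.
apply/rowP => i; rewrite mxE; have [_ ->] := D i.
rewrite dotpE (bigD1 i)//= !mxE !eqxx mul1r big1 ?addr0// => j ji.
by rewrite !mxE (negPf ji) andbF mul0r.
Qed.

End Differentiability.

(** * Jacobian matrices, chain rule, derivative of an inverse *)

Section Jacobian.
Context {R : realType}.
Implicit Types m p : nat.

(** Vectors are rows, so the differential is [h *m jac g x]: the matrix is the transpose of the
    usual Jacobian, and products appear in the order of composition. *)
Definition jac m p (g : 'rV[R]_m -> 'rV[R]_p) (x : 'rV[R]_m) : 'M[R]_(m, p) :=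
  \matrix_(i, j) 'D_(delta_mx 0 i) (fun y => g y 0 j) x.

Lemma dotp_grad_jac m p (g : 'rV[R]_m -> 'rV[R]_p) x h j :
  dotp h (grad (fun y => g y 0 j) x) = (h *m jac g x) 0 j.
Proof. by rewrite dotpE mxE; apply: eq_bigr => i _; rewrite !mxE. Qed.

Lemma sdiff_rV m p (g : 'rV[R]_m -> 'rV[R]_p) x J :
  (forall j, sdiff (fun y => g y 0 j) x (fun h => (h *m J) 0 j)) ->
  sdiff g x (fun h => h *m J).
Proof.
move=> H e e0.
have [j|j d d' d'0 dd' + y z yx zx|d d0 dP] := @common_radius R _
    (fun j d => forall y z, `|y - x| < d -> `|z - x| < d ->
       `|g y 0 j - g z 0 j - ((y - z) *m J) 0 j| <= e * `|y - z|).
- exact: H.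
- by apply; apply: lt_le_trans dd'.
exists d => // y z yx zx; apply: rV_norm_le => [|j]; first by rewrite mulr_ge0// ltW.
by have := dP j _ _ yx zx; rewrite !mxE.
Qed.

Lemma fdiff_rV m p (g : 'rV[R]_m -> 'rV[R]_p) x J :
  (forall j, fdiff (fun y => g y 0 j) x (fun h => (h *m J) 0 j)) <->
  fdiff g x (fun h => h *m J).
Proof.
split=> H; last first.
  move=> j e e0; have [d d0 dP] := H e e0; exists d => // y /dP; apply: le_trans.
  have := rV_coord_le (g y - g x - (y - x) *m J) j.
  by rewrite !mxBE.
move=> e e0.
have [j|j d d' d'0 dd' + y yx|d d0 dP] := @common_radius R _
    (fun j d => forall y, `|y - x| < d ->
       `|g y 0 j - g x 0 j - ((y - x) *m J) 0 j| <= e * `|y - x|).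
- exact: H.
- by apply; apply: lt_le_trans dd'.
exists d => // y yx; apply: rV_norm_le => [|j]; first by rewrite mulr_ge0// ltW.
by have := dP j _ yx; rewrite !mxE.
Qed.

Lemma fdiff_jac m p (g : 'rV[R]_m -> 'rV[R]_p) x J :
  fdiff g x (fun h => h *m J) ->
  (forall i j, derivable (fun y => g y 0 j) x (delta_mx 0 i)) /\ jac g x = J.
Proof.
move=> /fdiff_rV H.
have D j : fdiff (fun y => g y 0 j) x (fun h => dotp h (\row_i J i j)).
  have := H j; congr fdiff; apply/funext => h; rewrite mxE dotpE.
  by apply: eq_bigr => i _; rewrite mxE.
split=> [i j|]; first by have [] := fdiff_grad (D j).
apply/matrixP => i j; rewrite mxE; have [_ /rowP/(_ i)] := fdiff_grad (D j).
by rewrite !mxE.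
Qed.

Lemma fdiff_eq (U W : normedModType R) (f g : U -> W) x L :
  (\near x, f x = g x) -> fdiff f x L -> fdiff g x L.
Proof.
move=> /near_ballP[d' d'0 fg] H e e0; have [d d0 dP] := H e e0.
exists (Num.min d d') => [|y]; first by rewrite lt_min d0.
rewrite lt_min => /andP[yd yd']; rewrite -!fg//; first exact: dP.
by rewrite subrr normr0.
Qed.

Lemma fdiff_comp (U V W : normedModType R) (g : U -> V) (f : V -> W) x M L
    (C K : R) :
  (forall v, `|M v| <= C * `|v|) ->
  (forall v, `|L v| <= K * `|v|) -> (forall u v, L (u - v) = L u - L v) ->
  fdiff g x M -> fdiff f (g x) L -> fdiff (fun y => f (g y)) x (fun v => L (M v)).
Proof.
move=> MC LK LB gM fL e e0.
have C1 : 0 < 1 + `|C| by rewrite ltr_pwDl.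
have K1 : 0 < 1 + `|K| by rewrite ltr_pwDl.
have [d d0 dP] := fL _ (divr_gt0 (divr_gt0 e0 (ltr0n R 2)) C1).
have [d1 d10 d1P] := gM 1 ltr01.
have [d2 d20 d2P] := gM _ (divr_gt0 (divr_gt0 e0 (ltr0n R 2)) K1).
exists (Num.min (Num.min d1 d2) (d / (1 + `|C|))) => [|y].
  by rewrite !lt_min d10 d20 divr_gt0.
rewrite !lt_min => /andP[/andP[y1 y2] yd].
have gy : `|g y - g x| <= (1 + `|C|) * `|y - x|.
  rewrite -(subrK (M (y - x)) (g y - g x)) (le_trans (ler_normD _ _))//.
  rewrite mulrDl lerD// ?d1P//.
  by rewrite (le_trans (MC _))// ler_wpM2r// ler_norm.
(* The error of [f] at the point [g y] and the image under [L] of the error of [g]; each gets half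
   of [e]. *)
have -> : f (g y) - f (g x) - L (M (y - x)) =
    (f (g y) - f (g x) - L (g y - g x)) + L (g y - g x - M (y - x)).
  by rewrite (LB (g y - g x)) addrA subrK.
rewrite (le_trans (ler_normD _ _))//.
have -> : e * `|y - x| = e / 2 / (1 + `|C|) * ((1 + `|C|) * `|y - x|) +
   (1 + `|K|) * (e / 2 / (1 + `|K|) * `|y - x|).
  by field; rewrite !gt_eqF.
apply: lerD.
  apply: (le_trans (dP _ _)).
    by rewrite (le_lt_trans gy)// mulrC -ltr_pdivlMr.
  by rewrite ler_wpM2l// ltW// divr_gt0// divr_gt0.
have LK' v : `|L v| <= (1 + `|K|) * `|v|.
  rewrite (le_trans (LK v))// ler_wpM2r// (le_trans (ler_norm K))//.
  by rewrite lerDr.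
by rewrite (le_trans (LK' _))// ler_wpM2l ?(ltW K1)// d2P.
Qed.

Lemma fdiff_mx_comp m p (W : normedModType R) (g : 'rV[R]_m -> 'rV[R]_p)
    (f : 'rV[R]_p -> W) x J L K :
  (forall v, `|L v| <= K * `|v|) -> (forall u v, L (u - v) = L u - L v) ->
  fdiff g x (fun h => h *m J) -> fdiff f (g x) L ->
  fdiff (fun y => f (g y)) x (fun v => L (v *m J)).
Proof.
have [C C0 JC] := mulmx_bound J.
by move=> LK LB; apply: (fdiff_comp JC LK LB).
Qed.

Lemma fdiff_comp_scalar m p (g : 'rV[R]_m -> 'rV[R]_p) (f : 'rV[R]_p -> R) x J a :
  fdiff g x (fun h => h *m J) -> fdiff f (g x) (fun h => dotp h a) ->
  fdiff (fun y => f (g y)) x (fun v => dotp v (a *m J^T)).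
Proof.
move=> gJ fa.
have := @fdiff_mx_comp _ _ _ g f x J (fun h => dotp h a) (p%:R * `|a|) _ _ gJ fa.
move=> /(_ _ _)/wrap[v|u v|].
- by rewrite (le_trans (norm_dotp_le _ _))// -mulrA (mulrC `|a|).
- by rewrite dotpBl.
by congr fdiff; apply/funext => v; rewrite dotp_mulr.
Qed.

(** Differentiability of [psi] at the single point [g z0] is enough once [g] is a continuous right
    inverse near [z0]. *)
Lemma fdiff_inv m (psi g : 'rV[R]_m -> 'rV[R]_m) z0 J :
  J \in unitmx -> fdiff psi (g z0) (fun h => h *m J) ->
  {for z0, continuous g} -> (\forall z \near z0, psi (g z) = z) ->
  fdiff g z0 (fun h => h *m invmx J).
Proof.
move=> uJ dpsi /cont_ballP cg /near_ballP[d0 d00 psig] e e0.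
have [C C0 JC] := mulmx_bound (invmx J).
(* The first bound lets the error be absorbed, so that |w| <= 2 C |z - z0|; with this, the second
   bound makes the final error exactly [e]. *)
pose e1 := Num.min (1 / (2 * C)) (e / (2 * C ^+ 2)).
have e10 : 0 < e1 by rewrite lt_min !divr_gt0 ?mulr_gt0 ?exprn_gt0.
have [d1 d10 d1P] := dpsi _ e10.
have [d2 d20 d2P] := cg _ d10.
exists (Num.min d0 d2) => [|z]; first by rewrite lt_min d00.
rewrite lt_min => /andP[zd0 zd2].
have := d1P _ (d2P _ zd2).
rewrite !psig ?subrr ?normr0// => H.
set w := g z - g z0 in H *.
have E : w - (z - z0) *m invmx J = - ((z - z0 - w *m J) *m invmx J).
  by rewrite [(_ - w *m J) *m _]mulmxBl mulmxK// opprB.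
have wle : `|w| <= 2 * C * `|z - z0|.
  have : `|w| <= C * `|z - z0| + C * (e1 * `|w|).
    rewrite -[w in leLHS](subrK ((z - z0) *m invmx J)) addrC.
    rewrite (le_trans (ler_normD _ _))// lerD// E normrN (le_trans (JC _))//.
    by rewrite ler_wpM2l// ltW.
  have : C * (e1 * `|w|) <= 1 / 2 * `|w|.
    rewrite mulrA ler_wpM2r//.
    apply: (@le_trans _ _ (C * (1 / (2 * C)))).
      by rewrite ler_wpM2l ?(ltW C0)// ge_min lexx.
    by rewrite !mul1r invfM mulrCA mulfV ?gt_eqF// mulr1.
  move: (`|w|) (C * (e1 * _)) => a b; rewrite -mulrA; lra.
rewrite E normrN (le_trans (JC _))//.
apply: (@le_trans _ _ (C * (e / (2 * C ^+ 2) * (2 * C * `|z - z0|)))).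
  rewrite ler_wpM2l ?(ltW C0)// (le_trans H)// ler_pM// ?(ltW e10)//.
  by rewrite ge_min lexx orbT.
rewrite le_eqVlt; apply/orP; left; apply/eqP; field.
by rewrite gt_eqF.
Qed.

End Jacobian.

(** * Functions of class C^(k,alpha) *)

Section LocalHolder.
Context {R : realType} {m : nat} (al : R).
Context (al1 : 0 < al <= 1).
Implicit Types (f g : 'rV[R]_m -> R).

Definition lholder f x := exists L d : R, 0 < d /\
  forall y z, `|y - x| < d -> `|z - x| < d -> `|f y - f z| <= L * (`|y - z| `^ al).

Lemma lholder_near f g x : (\near x, f x = g x) -> lholder f x -> lholder g x.
Proof.
move=> /near_ballP[d' d'0 fg] [L [d [d0 H]]].
exists L, (Num.min d d'); split=> [|y z]; first by rewrite lt_min d0.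
by rewrite !lt_min => /andP[? ?] /andP[? ?]; rewrite -!fg//; apply: H.
Qed.

Lemma lipschitz_lholder f x (K d : R) : 0 < d ->
  (forall y z, `|y - x| < d -> `|z - x| < d -> `|f y - f z| <= K * `|y - z|) ->
  lholder f x.
Proof.
move=> d0 H; exists `|K|, (Num.min d 2^-1); split=> [|y z].
  by rewrite lt_min d0/= invr_gt0 ltr0n.
rewrite !lt_min => /andP[yd y2] /andP[zd z2]; apply: (le_trans (H _ _ yd zd)).
apply: (@le_trans _ _ (`|K| * `|y - z|)); first by rewrite ler_wpM2r// ler_norm.
rewrite ler_wpM2l//.
have [->|] := eqVneq `|y - z| 0; first exact: powR_ge0.
move=> yz0; apply: ger1_powR; last by case/andP: al1.
rewrite lt_neqAle eq_sym yz0 normr_ge0/=.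
have -> : y - z = (y - x) - (z - x) by rewrite opprB addrA subrK.
rewrite (le_trans (ler_normB _ _))//.
by move: (`|y - x|) (`|z - x|) y2 z2 => a b; lra.
Qed.

Lemma lholderD f g x : lholder f x -> lholder g x -> lholder (fun y => f y + g y) x.
Proof.
move=> [L [d [d0 H]]] [L' [d' [d'0 H']]].
exists (L + L'), (Num.min d d'); split=> [|y z]; first by rewrite lt_min d0.
rewrite !lt_min => /andP[yd yd'] /andP[zd zd'].
rewrite opprD addrACA (le_trans (ler_normD _ _))// mulrDl lerD//; first exact: H.
exact: H'.
Qed.

Lemma cont_bound f x : {for x, continuous f} ->
  exists2 d : R, 0 < d & forall y, `|y - x| < d -> `|f y| <= `|f x| + 1.
Proof.
move=> /cont_ballP/(_ 1 ltr01)[d d0 dP]; exists d => // y /dP/ltW fy.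
by rewrite -lerBlDl (le_trans _ fy)// lerB_dist.
Qed.

Lemma lholderM f g x : {for x, continuous f} -> {for x, continuous g} ->
  lholder f x -> lholder g x -> lholder (fun y => f y * g y) x.
Proof.
move=> /cont_bound[d1 d10 fb] /cont_bound[d2 d20 gb].
move=> [L [d [d0 H]]] [L' [d' [d'0 H']]].
exists ((`|g x| + 1) * L + (`|f x| + 1) * L'), (Num.min (Num.min d1 d2) (Num.min d d')).
split=> [|y z]; first by rewrite !lt_min d0 d10 d20.
rewrite !lt_min => /andP[/andP[y1 y2] /andP[yd yd']] /andP[/andP[z1 z2] /andP[zd zd']].
have -> : f y * g y - f z * g z = g y * (f y - f z) + f z * (g y - g z) by ring.
rewrite (le_trans (ler_normD _ _))// mulrDl !normrM -!mulrA.
by apply: lerD; apply: ler_pM => //; [exact: gb|exact: H|exact: fb|exact: H'].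
Qed.

Lemma lholderV f x : {for x, continuous f} -> f x != 0 ->
  lholder f x -> lholder (fun y => (f y)^-1) x.
Proof.
move=> /cont_ballP cf fx0 [L [d [d0 H]]].
have fx2 : 0 < `|f x| / 2 by rewrite divr_gt0// normr_gt0.
have [d1 d10 fb] := cf _ fx2.
have fl y : `|y - x| < d1 -> `|f x| / 2 <= `|f y|.
  move=> /fb/ltW fy; have := lerB_dist (f x) (f y).
  by rewrite distrC => h; move: (le_trans h fy) => {fb cf H}; move: `|f x| `|f y| => a b; lra.
exists ((`|f x| / 2) ^- 2 * L), (Num.min d d1); split=> [|y z]; first by rewrite lt_min d0.
rewrite !lt_min => /andP[yd yd1] /andP[zd zd1].
have y0 : f y != 0 by rewrite -normr_gt0 (lt_le_trans fx2)// fl.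
have z0 : f z != 0 by rewrite -normr_gt0 (lt_le_trans fx2)// fl.
have -> : (f y)^-1 - (f z)^-1 = (f y)^-1 * (f z)^-1 * (f z - f y).
  by field; rewrite y0 z0.
rewrite normrM -mulrA; apply: ler_pM => //; last by rewrite distrC H.
rewrite normrM !normfV expr2 invfM.
by apply: ler_pM; rewrite ?invr_ge0// lef_pV2 ?posrE ?normr_gt0// fl.
Qed.

End LocalHolder.

Lemma lholder_comp (R : realType) m p (al : R) (f : 'rV[R]_p -> R) (g : 'rV[R]_m -> 'rV[R]_p) x (K d : R) :
  0 < al -> 0 < d ->
  (forall y z, `|y - x| < d -> `|z - x| < d -> `|g y - g z| <= K * `|y - z|) ->
  lholder al f (g x) -> lholder al (fun y => f (g y)) x.
Proof.
move=> al0 d0 gK [L [d1 [d10 H]]].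
have K1 : 0 < 1 + `|K| by rewrite ltr_pwDl.
have gK' y z : `|y - x| < d -> `|z - x| < d -> `|g y - g z| <= (1 + `|K|) * `|y - z|.
  move=> yd zd; apply: (le_trans (gK _ _ yd zd)).
  by rewrite ler_wpM2r// (le_trans (ler_norm _))// lerDr.
exists (`|L| * (1 + `|K|) `^ al), (Num.min d (d1 / (1 + `|K|))); split=> [|y z].
  by rewrite lt_min d0 divr_gt0.
rewrite !lt_min => /andP[yd yd1] /andP[zd zd1].
have gin u : `|u - x| < d -> `|u - x| < d1 / (1 + `|K|) -> `|g u - g x| < d1.
  move=> ud ud1; apply: (le_lt_trans (gK' _ _ ud _)); first by rewrite subrr normr0.
  by rewrite mulrC -ltr_pdivlMr.
apply: (le_trans (H _ _ (gin _ yd yd1) (gin _ zd zd1))).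
apply: (@le_trans _ _ (`|L| * `|g y - g z| `^ al)).
  by rewrite ler_wpM2r ?powR_ge0// ler_norm.
rewrite -mulrA ler_wpM2l// -powRM// ?(ltW K1)//.
by rewrite ge0_ler_powR ?(ltW al0)// ?nnegrE ?mulr_ge0 ?(ltW K1)// gK'.
Qed.

Section Creg.
Context {R : realType}.
Implicit Types (m k : nat).

(* The Hoelder condition is local: a graph representation may be shrunk, so nothing is lost. *)
Fixpoint Creg m k (al : R) (V : set 'rV[R]_m) (f : 'rV[R]_m -> R) : Prop :=
  match k with
  | 0 => forall x, V x -> {for x, continuous f} /\ (0 < al -> lholder al f x)
  | k'.+1 => (forall x, V x -> {for x, continuous f}) /\
     forall i, (forall x, V x -> derivable f x (delta_mx 0 i)) /\
               Creg k' al V ('D_(delta_mx 0 i) f)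
  end.

Lemma open_near (T : topologicalType) (V : set T) (P : T -> Prop) x : open V ->
  V x -> (forall y, V y -> P y) -> \near x, P x.
Proof. by move=> oV Vx H; apply: (filterS H); exact: open_nbhs_nbhs. Qed.

Lemma cont_near (U W : normedModType R) (f g : U -> W) x :
  (\near x, f x = g x) -> {for x, continuous f} -> {for x, continuous g}.
Proof.
move=> fg cf; rewrite /prop_for /continuous_at -(nbhs_singleton fg).
exact: cvg_trans (near_eq_cvg fg) cf.
Qed.

Lemma Creg_ext m k al (V : set 'rV[R]_m) f g : open V ->
  (forall x, V x -> f x = g x) -> Creg k al V f -> Creg k al V g.
Proof.
move=> oV; elim: k f g => [|k IH] f g fg /= => [H x Vx|[cf H]].
  have [cf hf] := H x Vx; have nfg : \near x, f x = g x by apply: open_near fg.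
  split; first exact: cont_near cf.
  by move=> /hf; apply: lholder_near.
split=> [x Vx|i].
  have nfg : \near x, f x = g x by apply: open_near fg.
  exact: cont_near (cf x Vx).
have [df cdf] := H i; split=> [x Vx|].
  have nfg : \near x, f x = g x by apply: open_near fg.
  by apply: (near_eq_derivable nfg); apply: df.
apply: IH cdf => x Vx; apply: near_eq_derive; exact: open_near fg.
Qed.

Lemma Creg_sub m k al (V W : set 'rV[R]_m) f : W `<=` V -> Creg k al V f -> Creg k al W f.
Proof.
move=> WV; elim: k f => [|k IH] f /= => [H x /WV/H//|[cf H]].
split=> [x /WV/cf//|i]; have [df cdf] := H i; split=> [x /WV/df//|].
exact: IH.
Qed.

Lemma Creg_cont m k al (V : set 'rV[R]_m) f x : Creg k al V f -> V x -> {for x, continuous f}.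
Proof. by case: k => [|k] /= => [H /H[]//|[H _] /H]. Qed.

Lemma Creg_al0 m k al (V : set 'rV[R]_m) f : Creg k al V f -> Creg k 0 V f.
Proof.
elim: k f => [|k IH] f /= => [H x /H[? _]|[cf H]]; first by split=> //; rewrite ltxx.
by split=> // i; have [? /IH] := H i.
Qed.

(** Any formula that computes the partial derivatives on [V] may be used in place of the derivatives
    themselves; the algebraic closure lemmas rest on this. *)
Lemma CregS_intro m k al (V : set 'rV[R]_m) f (df : 'I_m -> 'rV[R]_m -> R) : open V ->
  (forall x, V x -> {for x, continuous f}) ->
  (forall i x, V x -> is_derive x (delta_mx 0 i) f (df i x)) ->
  (forall i, Creg k al V (df i)) -> Creg k.+1 al V f.
Proof.
move=> oV cf dfP H; split=> // i; split=> [x /(dfP i)[]//|].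
by apply: Creg_ext (H i) => // x /(dfP i)[].
Qed.

Lemma Creg_sdiff m al (V : set 'rV[R]_m) f x : open V -> V x -> Creg 1 al V f ->
  sdiff f x (fun h => dotp h (grad f x)).
Proof.
move=> oV Vx [cf H]; apply: (C1_sdiff oV Vx) => [i y Vy|i].
  by have [df _] := H i; exact: df.
by have [_ cdf] := H i; have [] := cdf _ Vx.
Qed.

Lemma Creg1_lipschitz m al (V : set 'rV[R]_m) f x : open V -> V x -> Creg 1 al V f ->
  exists d K : R, 0 < d /\ forall y z, `|y - x| < d -> `|z - x| < d ->
    `|f y - f z| <= K * `|y - z|.
Proof.
move=> oV Vx /(Creg_sdiff oV Vx) sf.
have [v|d d0 H] := sdiff_lipschitz (C := m%:R * `|grad f x|) _ sf.
  by rewrite (le_trans (norm_dotp_le _ _))// -mulrA (mulrC `|v|).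
by exists d, (1 + m%:R * `|grad f x|).
Qed.

(** A C^1 function is locally Lipschitz, hence locally Hölder of every exponent up to 1. This is the
    base case that makes the classes decrease with [k]. *)
Lemma Creg1_0 m al al' (V : set 'rV[R]_m) f : open V -> al <= 1 -> Creg 1 al' V f ->
  Creg 0 al V f.
Proof.
move=> oV al1 Cf x Vx; split; first exact: Creg_cont Cf Vx.
move=> al0; have [d [K [d0 H]]] := Creg1_lipschitz oV Vx Cf.
by apply: lipschitz_lholder H => //; rewrite al0.
Qed.

Lemma Creg_down m k al (V : set 'rV[R]_m) f : open V -> al <= 1 -> Creg k.+1 al V f ->
  Creg k al V f.
Proof.
move=> oV al1; elim: k f => [|k IH] f; first exact: Creg1_0.
move=> [cf H]; split=> // i; have [df cdf] := H i; split=> //.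
exact: IH.
Qed.

Lemma Creg_le m k l al (V : set 'rV[R]_m) f : open V -> al <= 1 -> (l <= k)%N -> Creg k al V f ->
  Creg l al V f.
Proof.
move=> oV al1; elim: k => [|k IH]; first by rewrite leqn0 => /eqP->.
by rewrite leq_eqVlt => /predU1P[->//|/IH H] /Creg_down -/(_ oV al1).
Qed.

(** A strict loss of order buys any exponent. Later it settles orders 0 and 1 from the C^2
    hypothesis alone. *)
Lemma Creg_lt m k l al al' (V : set 'rV[R]_m) f : open V -> al <= 1 -> (l < k)%N ->
  Creg k al' V f -> Creg l al V f.
Proof.
move=> oV al1 lk /Creg_al0 /(Creg_le oV ler01 lk).
elim: l f {lk} => [|l IH] f; first exact: Creg1_0.
by move=> [cf H]; split=> // i; have [df cdf] := H i; split=> //; apply: IH.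
Qed.

Lemma Creg_cst m k al (V : set 'rV[R]_m) (c : R) : open V -> Creg k al V (fun=> c).
Proof.
move=> oV; elim: k c => [|k IH] c.
  move=> /= x Vx; split; first exact: cst_continuous.
  by move=> al0; exists 0, 1; split=> // y z _ _; rewrite subrr normr0 mul0r.
apply: (@CregS_intro _ _ _ _ _ (fun _ _ => 0)) => // x _.
exact: cst_continuous.
Qed.

Lemma CregD m k al (V : set 'rV[R]_m) f g : open V -> Creg k al V f -> Creg k al V g ->
  Creg k al V (fun x => f x + g x).
Proof.
move=> oV; elim: k f g => [|k IH] f g.
  move=> /= Hf Hg x Vx; have [cf hf] := Hf x Vx; have [cg hg] := Hg x Vx.
  split; first exact: continuousD.
  by move=> a0; apply: lholderD; [exact: hf|exact: hg].
move=> [cf Hf] [cg Hg].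
apply: (@CregS_intro _ _ _ _ _ (fun i x => 'D_(delta_mx 0 i) f x + 'D_(delta_mx 0 i) g x)) => //.
- by move=> x Vx; apply: continuousD; [exact: cf|exact: cg].
- move=> i x Vx; apply: is_deriveD; apply: derivableP.
    by have [+ _] := Hf i; apply.
  by have [+ _] := Hg i; apply.
- by move=> i; apply: IH; [have [_ ] := Hf i|have [_ ] := Hg i].
Qed.

Lemma CregM m k al (V : set 'rV[R]_m) f g : open V -> al <= 1 ->
  Creg k al V f -> Creg k al V g -> Creg k al V (fun x => f x * g x).
Proof.
move=> oV al1; elim: k f g => [|k IH] f g.
  move=> /= Hf Hg x Vx; have [cf hf] := Hf x Vx; have [cg hg] := Hg x Vx.
  split; first exact: continuousM.
  by move=> a0; apply: lholderM => //; [exact: hf|exact: hg].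
move=> fC gC; have [cf Hf] := fC; have [cg Hg] := gC.
apply: (@CregS_intro _ _ _ _ _ (fun i x => f x * 'D_(delta_mx 0 i) g x + g x * 'D_(delta_mx 0 i) f x)) => //.
- by move=> x Vx; apply: continuousM; [exact: cf|exact: cg].
- move=> i x Vx; apply: is_deriveM; apply: derivableP.
    by have [+ _] := Hf i; apply.
  by have [+ _] := Hg i; apply.
- move=> i; apply: CregD => //; apply: IH.
  + exact: Creg_down.
  + by have [_ ] := Hg i.
  + exact: Creg_down.
  + by have [_ ] := Hf i.
Qed.

Lemma CregN m k al (V : set 'rV[R]_m) f : open V -> al <= 1 ->
  Creg k al V f -> Creg k al V (fun x => - f x).
Proof.
move=> oV al1 Cf; apply: (@Creg_ext _ _ _ _ (fun x => (-1) * f x)) => //.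
  by move=> x _; rewrite mulN1r.
by apply: CregM => //; exact: Creg_cst.
Qed.

Lemma CregB m k al (V : set 'rV[R]_m) f g : open V -> al <= 1 ->
  Creg k al V f -> Creg k al V g -> Creg k al V (fun x => f x - g x).
Proof. by move=> oV al1 Cf Cg; apply: CregD => //; exact: CregN. Qed.

Lemma CregV m k al (V : set 'rV[R]_m) f : open V -> al <= 1 ->
  (forall x, V x -> f x != 0) ->
  Creg k al V f -> Creg k al V (fun x => (f x)^-1).
Proof.
move=> oV al1 f0; elim: k => [|k IH].
  move=> /= Hf x Vx; have [cf hf] := Hf x Vx.
  split; first by apply: continuousV => //; exact: f0.
  by move=> a0; apply: lholderV => //; [exact: f0|exact: hf].
move=> fC; have [cf Hf] := fC; have C1 := IH (Creg_down oV al1 fC).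
apply: (@CregS_intro _ _ _ _ _ (fun i x => (- ((f x)^-1 * (f x)^-1)) * 'D_(delta_mx 0 i) f x)) => //.
- by move=> x Vx; apply: continuousV; [exact: f0|exact: cf].
- move=> i x Vx; have df : derivable f x (delta_mx 0 i) by have [+ _] := Hf i; apply.
  apply: DeriveDef; first by apply: derivableV => //; exact: f0.
  by rewrite deriveV ?f0// expr2 invfM.
- move=> i; apply: CregM => //; last by have [_ ] := Hf i.
  by apply: CregN => //; apply: CregM.
Qed.

Lemma Creg_coord m k al (V : set 'rV[R]_m) j : open V -> al <= 1 ->
  Creg k al V (fun x => x 0 j).
Proof.
move=> oV al1.
have H : Creg k.+1 al V (fun x => x 0 j).
  apply: (@CregS_intro _ _ _ _ _ (fun i _ => (delta_mx 0 i : 'rV[R]_m) 0 j)) => //.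
  - by move=> x _; exact: coord_continuous.
  - move=> i x _.
    apply: (@fdiff_derive _ _ _ (fun y : 'rV[R]_m => y 0 j) x (fun h => h 0 j)).
      by move=> t v; rewrite mxE.
    move=> e e0; exists 1 => // y _; rewrite !mxE subrr normr0 mulr_ge0//.
    exact: ltW.
  - by move=> i; exact: Creg_cst.
exact: Creg_down H.
Qed.

Lemma Creg_sum m k al (V : set 'rV[R]_m) (I : Type) (r : seq I) (P : pred I) (F : I -> 'rV[R]_m -> R) :
  open V -> (forall i, Creg k al V (F i)) ->
  Creg k al V (fun x => \sum_(i <- r | P i) F i x).
Proof.
move=> oV H; elim: r => [|i r IH].
  by apply: Creg_ext (Creg_cst _ _ 0 oV) => // x _; rewrite big_nil.
case Pi: (P i).
  apply: Creg_ext (CregD oV (H i) IH) => // x _; by rewrite big_cons Pi.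
by apply: Creg_ext IH => // x _; rewrite big_cons Pi.
Qed.

Lemma Creg_prod m k al (V : set 'rV[R]_m) (I : Type) (r : seq I) (F : I -> 'rV[R]_m -> R) :
  open V -> al <= 1 -> (forall i, Creg k al V (F i)) ->
  Creg k al V (fun x => \prod_(i <- r) F i x).
Proof.
move=> oV al1 H; elim: r => [|i r IH].
  by apply: Creg_ext (Creg_cst _ _ 1 oV) => // x _; rewrite big_nil.
by apply: Creg_ext (CregM oV al1 (H i) IH) => // x _; rewrite big_cons.
Qed.

Lemma Creg_det m k al (V : set 'rV[R]_m) q (M : 'rV[R]_m -> 'M[R]_q) :
  open V -> al <= 1 -> (forall i j, Creg k al V (fun x => M x i j)) ->
  Creg k al V (fun x => \det (M x)).
Proof.
move=> oV al1 H; apply: Creg_sum => // s.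
by apply: CregM => //; [exact: Creg_cst|exact: Creg_prod].
Qed.

Lemma Creg_invmx m k al (V : set 'rV[R]_m) q (M : 'rV[R]_m -> 'M[R]_q) i j :
  open V -> al <= 1 -> (forall x, V x -> M x \in unitmx) ->
  (forall i j, Creg k al V (fun x => M x i j)) ->
  Creg k al V (fun x => invmx (M x) i j).
Proof.
move=> oV al1 uM H.
apply: (@Creg_ext _ _ _ _ (fun x => (\det (M x))^-1 * cofactor (M x) j i)) => //.
  by move=> x Vx; rewrite /invmx uM// !mxE.
apply: CregM => //.
  apply: CregV => //; last exact: Creg_det.
  by move=> x /uM; rewrite unitmxE unitfE.
rewrite /cofactor; apply: CregM => //; first exact: Creg_cst.
by apply: Creg_det => // a b; apply: Creg_ext (H (lift j a) (lift i b)) => // x _; rewrite !mxE.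
Qed.

Lemma Creg_sdiff_rV m p al (V : set 'rV[R]_m) (g : 'rV[R]_m -> 'rV[R]_p) x : open V -> V x ->
  (forall j, Creg 1 al V (fun y => g y 0 j)) -> sdiff g x (fun h => h *m jac g x).
Proof.
move=> oV Vx H; apply: sdiff_rV => j.
have := Creg_sdiff oV Vx (H j); congr sdiff; apply/funext => h.
exact: dotp_grad_jac.
Qed.

(** The separate C^1 assumption on [g] matters at order 0: composing two merely Hölder maps
    multiplies their exponents, while a Lipschitz inner map keeps [al]. *)
Lemma Creg_comp m p k al (V : set 'rV[R]_m) (W : set 'rV[R]_p) f (g : 'rV[R]_m -> 'rV[R]_p) :
  open V -> open W -> al <= 1 -> (forall x, V x -> W (g x)) -> Creg k al W f ->
  (forall j, Creg 1 0 V (fun x => g x 0 j)) ->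
  (forall j, Creg k al V (fun x => g x 0 j)) ->
  Creg k al V (fun x => f (g x)).
Proof.
move=> oV oW al1 VW + g1.
have cg x : V x -> {for x, continuous g}.
  by move=> Vx; apply/cont_rVP => j; exact: Creg_cont (g1 j) Vx.
elim: k f => [|k IH] f fC gC.
  move=> x Vx; have [cf hf] := fC _ (VW _ Vx); split.
    by apply: continuous_comp; [exact: cg|].
  move=> a0; have sg := Creg_sdiff_rV oV Vx g1; have [C C0 JC] := mulmx_bound (jac g x).
  have [d d0 H] := sdiff_lipschitz JC sg.
  by apply: lholder_comp H _ => //; exact: hf.
have [cf df] := fC.
apply: (@CregS_intro _ _ _ _ _ (fun i x => \sum_j 'D_(delta_mx 0 j) f (g x) *
   'D_(delta_mx 0 i) (fun y => g y 0 j) x)) => //.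
- by move=> x Vx; apply: continuous_comp; [exact: cg|apply: cf; exact: VW].
- move=> i x Vx.
  have f1 : Creg 1 al W f by apply: Creg_le fC.
  have D := fdiff_comp_scalar (sdiff_fdiff (Creg_sdiff_rV oV Vx g1))
     (sdiff_fdiff (Creg_sdiff oW (VW _ Vx) f1)).
  have [dd /rowP/(_ i)] := fdiff_grad D.
  rewrite mxE => E; apply: DeriveDef => //; rewrite E mxE.
  by apply: eq_bigr => j _; rewrite !mxE.
- move=> i; apply: Creg_sum => // j; apply: CregM => //.
    have /= [_ C] := df j; apply: (IH _ C).
    by move=> j'; exact: Creg_down.
  by have [_ /(_ i)[]] := gC j.
Qed.

(** Bootstrap on the formula Dg = (D psi o g)^-1, whose entries are cofactors divided by a
    determinant: regularity of [g] at one order gives regularity of Dg at that order, hence of [g]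
    at the next. *)
Lemma Creg_inverse m k al (V W : set 'rV[R]_m) (psi g : 'rV[R]_m -> 'rV[R]_m) :
  open V -> open W -> al <= 1 -> (forall x, V x -> W (g x)) ->
  (forall x, V x -> {for x, continuous g}) -> (forall x, V x -> psi (g x) = x) ->
  (forall x, V x -> jac psi (g x) \in unitmx) ->
  (forall j, Creg k.+1 al W (fun x => psi x 0 j)) ->
  forall j, Creg k.+1 al V (fun x => g x 0 j).
Proof.
move=> oV oW al1 VW cg psig uJ psiC.
have psi1 : forall j, Creg 1 al W (fun x => psi x 0 j) by move=> j; apply: Creg_le (psiC j).
have D x : V x -> fdiff g x (fun h => h *m invmx (jac psi (g x))).
  move=> Vx; apply: (@fdiff_inv _ _ psi) => //; [exact: uJ| |exact: cg|exact: open_near psig].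
  by apply: sdiff_fdiff; apply: (@Creg_sdiff_rV _ _ al W) => //; exact: VW.
have D' i j x : V x -> is_derive x (delta_mx 0 i) (fun y => g y 0 j) (invmx (jac psi (g x)) i j).
  move=> Vx; have [dg jE] := fdiff_jac (D x Vx).
  by apply: DeriveDef => //; rewrite -jE mxE.
have dpsi l i j : (l <= k)%N -> Creg l al W (fun x => jac psi x i j).
  move=> lk; have [_ /(_ i)[_ H]] := psiC j.
  apply: Creg_le lk _ => //; apply: Creg_ext H => // x _; by rewrite mxE.
have cgj j x : V x -> {for x, continuous (fun y => g y 0 j)}.
  by move=> /cg/cont_rVP; apply.
have g10 j : Creg 1 0 V (fun x => g x 0 j).
  apply: CregS_intro (D' ^~ j) _ => // [x Vx|i]; first exact: cgj.
  apply: Creg_invmx => // a b x Vx; split; last by rewrite ltxx.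
  apply: (@continuous_comp _ _ _ g (fun y => jac psi y a b)); first exact: cg.
  exact: Creg_cont (dpsi 0%N a b (leq0n _)) (VW _ Vx).
(* The induction starts from C^1 with exponent 0, which used only the continuity of [g]; the first
   round already upgrades the exponent to [al]. *)
suff H l : (l <= k)%N -> forall j, Creg l.+1 al V (fun x => g x 0 j) by exact: H.
elim: l => [|l IH] lk j.
  apply: CregS_intro (D' ^~ j) _ => // [x Vx|i]; first exact: cgj.
  apply: Creg_invmx => // a b; apply: (Creg_comp (f := fun y => jac psi y a b) (g := g) oV oW) => //; first exact: dpsi.
  by move=> ?; apply: Creg1_0 (g10 _).
apply: CregS_intro (D' ^~ j) _ => // [x Vx|i]; first exact: cgj.
apply: Creg_invmx => // a b; apply: (Creg_comp (f := fun y => jac psi y a b) (g := g) oV oW) => //; first exact: dpsi.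
by move=> ?; apply: IH; exact: ltnW.
Qed.

End Creg.

(** * Existence of local inverses *)

HB.instance Definition _ (R : realType) (m n : nat) := Complete.on 'M[R]_(m, n).

Section InverseFunction.
Context {R : realType} {m : nat}.

Lemma contraction_fixed_point (T : 'rV[R]_m -> 'rV[R]_m) (x0 : 'rV[R]_m) (r : R) :
  0 < r -> (forall x, `|x - x0| <= r -> `|T x - x0| <= r) ->
  (forall x y, `|x - x0| <= r -> `|y - x0| <= r -> `|T x - T y| <= 2^-1 * `|x - y|) ->
  exists2 x, `|x - x0| <= r & x = T x.
Proof.
move=> r0 Tin Tlip; pose U := [set x : 'rV[R]_m | `|x - x0| <= r].
pose F : {fun U >-> U} := [fun of @mkfun _ _ U U T Tin].
have [|||x Ux Fx] := @banach_fixed_point R _ U F.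
- exists 2^-1%:nng; split; first by rewrite /= invf_lt1// ltr1n.
  by move=> [x y] [] /=; apply: Tlip.
- have -> : U = closed_ball_ Num.norm x0 r.
    by apply/seteqP; split=> x; rewrite /U /closed_ball_ /= distrC.
  by rewrite -closed_ballE//; exact: closed_ball_closed.
- by exists x0; rewrite /U /= subrr normr0 ltW.
by exists x.
Qed.

(** Fixed points of [T w], a Newton step with frozen derivative [J], are the preimages of [w], and
    strict differentiability makes [T w] a contraction by 1/2. The parameter [eta] lets the caller
    confine the inverse to a prescribed ball. *)
Lemma inverse_function (psi : 'rV[R]_m -> 'rV[R]_m) x0 J (eta : R) :
  J \in unitmx -> sdiff psi x0 (fun h => h *m J) -> 0 < eta ->
  exists r d : R, exists g : 'rV[R]_m -> 'rV[R]_m,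
  [/\ 0 < r, r <= eta & 0 < d] /\
  [/\ forall w, `|w - psi x0| < d -> `|g w - x0| < r /\ psi (g w) = w,
      forall x, `|x - x0| < r -> `|psi x - psi x0| < d -> g (psi x) = x &
      forall w, `|w - psi x0| < d -> {for w, continuous g}].
Proof.
move=> uJ dpsi eta0.
have [C C0 JC] := mulmx_bound (invmx J).
(* Error 1 / (2 C), because multiplication by [invmx J] costs a factor [C]. *)
have [d' d'0 H] := dpsi _ (divr_gt0 ltr01 (mulr_gt0 (ltr0n R 2) C0)).
pose T w x := x - (psi x - w) *m invmx J.
pose r := Num.min (d' / 2) eta.
have r0 : 0 < r by rewrite lt_min eta0 divr_gt0.
have rd' : r < d' by rewrite gt_min ltr_pdivrMr// ltr_pMr// ltr1n.
(* For such [w] the centre moves by less than r / 2, and the contraction accounts for the other half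
   of the radius. *)
pose d := r / (2 * C).
have d0 : 0 < d by rewrite divr_gt0 ?mulr_gt0.
have Tlip w x y : `|x - x0| <= r -> `|y - x0| <= r -> `|T w x - T w y| <= 2^-1 * `|x - y|.
  move=> xr yr.
  have -> : T w x - T w y = - ((psi x - psi y - (x - y) *m J) *m invmx J).
    rewrite [in RHS]mulmxBl mulmxK// /T.
    have -> : psi x - psi y = (psi x - w) - (psi y - w) by vring.
    rewrite (mulmxBl (psi x - w) (psi y - w)).
    by move: ((psi x - w) *m _) ((psi y - w) *m _) => a b; vring.
  rewrite normrN (le_trans (JC _))//.
  have := H x y (le_lt_trans xr rd') (le_lt_trans yr rd').
  rewrite -(ler_pM2l C0) => /le_trans; apply.
  by rewrite mulrA ler_wpM2r// mul1r invfM mulrCA mulfV ?gt_eqF// mulr1.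
have T0 w : `|w - psi x0| < d -> `|T w x0 - x0| < r / 2.
  move=> wd; rewrite /T addrAC subrr add0r normrN.
  apply: (le_lt_trans (JC _)); rewrite distrC mulrC -ltr_pdivlMr//.
  by apply: (lt_le_trans wd); rewrite /d invfM mulrA.
have Tin w x : `|w - psi x0| < d -> `|x - x0| <= r -> `|T w x - x0| < r.
  move=> wd xr; have -> : T w x - x0 = (T w x - T w x0) + (T w x0 - x0) by rewrite addrA subrK.
  rewrite (le_lt_trans (ler_normD _ _))// [ltRHS]splitr ler_ltD ?T0//.
  have := Tlip w x x0 xr; rewrite subrr normr0 => /(_ (ltW r0))/le_trans; apply.
  by rewrite mulrC ler_wpM2r// invr_ge0.
have Tfix w x : x = T w x <-> psi x = w.
  split=> [|<-]; last by rewrite /T subrr mul0mx subr0.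
  move/eqP; rewrite eq_sym -subr_eq0 /T addrAC subrr add0r oppr_eq0 => /eqP E.
  by apply/eqP; rewrite -subr_eq0 -[_ - w](mulmxKV uJ) E mul0mx.
have uniq w x y : `|x - x0| <= r -> `|y - x0| <= r -> psi x = w -> psi y = w -> x = y.
  move=> xr yr /Tfix Ex /Tfix Ey; have := Tlip w x y xr yr; rewrite -Ex -Ey.
  move=> h; have : `|x - y| <= 0 by move: h; move: (`|x - y|) => a; lra.
  by rewrite normr_le0 subr_eq0 => /eqP.
have ex w : exists x, `|w - psi x0| < d -> `|x - x0| < r /\ psi x = w.
  case: (ltP (`|w - psi x0|) d) => wd; last by exists 0.
  have [|x y|x xr Tx] := @contraction_fixed_point (T w) x0 r r0.
  - by move=> x xr; apply: ltW; apply: Tin.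
  - exact: Tlip.
  - exists x => _; split; last exact/Tfix.
    by rewrite Tx Tin.
have [g gP] := choice ex.
exists r, d, g; split; first by split=> //; rewrite ge_min lexx orbT.
split=> // [x xr xd|w wd].
  have [gr gE] := gP _ xd; exact: uniq (ltW gr) (ltW xr) gE _.
apply/cont_ballP => e e0; pose d1 := d - `|w - psi x0|.
have d10 : 0 < d1 by rewrite subr_gt0.
exists (Num.min d1 (e / (2 * C))) => [|y]; first by rewrite lt_min d10 divr_gt0// mulr_gt0.
rewrite lt_min => /andP[yd1 ye].
have yd : `|y - psi x0| < d.
  have -> : y - psi x0 = (y - w) + (w - psi x0) by rewrite addrA subrK.
  by rewrite (le_lt_trans (ler_normD _ _))// -ltrBrDr.
have [gw gwE] := gP _ wd; have [gy gyE] := gP _ yd.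
(* Comparing the fixed points of [T y] and [T w] shows that [g] is Lipschitz with constant 2 C,
   hence continuous. *)
have : `|g y - g w| <= 2^-1 * `|g y - g w| + C * `|y - w|.
  have {1}-> : g y - g w = (T y (g y) - T y (g w)) + (y - w) *m invmx J.
    rewrite /T gyE gwE subrr mul0mx subr0 -(opprB y w) mulNmx.
    by move: ((y - w) *m _) => a; vring.
  by rewrite (le_trans (ler_normD _ _))// lerD// Tlip// ltW.
rewrite ltr_pdivlMr ?mulr_gt0// in ye.
move: (`|g y - g w|) (`|y - w|) ye => a b; nra.
Qed.

End InverseFunction.

(** * Analytic functions *)

Section WordSums.
Context {R : realType} {m : nat}.
Implicit Types (F G c : seq 'I_m -> R) (s : seq 'I_m) (h : 'rV[R]_m) (d : nat).

(** Sum over all words of length [d], by recursion on the first letter so that inductions on the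
    degree are structural; [wsum_tuple] links it to the tuples of [analytic_on]. *)
Fixpoint wsum d F : R :=
  if d is d'.+1 then \sum_i wsum d' (fun s => F (i :: s)) else F [::].

Lemma wsum_tuple d F : \sum_(t : d.-tuple 'I_m) F t = wsum d F.
Proof.
elim: d F => [|d IH] F /=.
  rewrite (big_pred1 [tuple]) // => t; apply/esym/eqP; exact: tuple0.
under [RHS]eq_bigr => i _ do rewrite -IH.
rewrite pair_big /=.
rewrite (reindex (fun p : 'I_m * d.-tuple 'I_m => cons_tuple p.1 p.2)) //=.
exists (fun t => (thead t, behead_tuple t)) => [[i t] _|t _] /=.
  by congr (_, _); apply: val_inj.
by case/tupleP: t => i t; apply: val_inj; rewrite /= theadE.
Qed.

Lemma eq_wsum d F G : (forall s, size s = d -> F s = G s) -> wsum d F = wsum d G.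
Proof.
elim: d F G => [|d IH] F G H /=; first exact: H.
by apply: eq_bigr => i _; apply: IH => s ss; apply: H; rewrite /= ss.
Qed.

Lemma wsumD d F G : wsum d (fun s => F s + G s) = wsum d F + wsum d G.
Proof.
elim: d F G => [|d IH] F G //=; rewrite -big_split.
by apply: eq_bigr => i _; exact: IH.
Qed.

Lemma wsumZ d (a : R) F : wsum d (fun s => a * F s) = a * wsum d F.
Proof.
elim: d F => [|d IH] F //=; rewrite mulr_sumr.
by apply: eq_bigr => i _; exact: IH.
Qed.

Lemma wsumZr d (a : R) F : wsum d (fun s => F s * a) = wsum d F * a.
Proof. by rewrite mulrC -wsumZ; apply: eq_wsum => s _; rewrite mulrC. Qed.

Lemma ler_wsum d F G : (forall s, size s = d -> F s <= G s) -> wsum d F <= wsum d G.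
Proof.
elim: d F G => [|d IH] F G H /=; first exact: H.
by apply: ler_sum => i _; apply: IH => s ss; apply: H; rewrite /= ss.
Qed.

Lemma wsum0 d : wsum d (fun=> 0) = 0.
Proof. by elim: d => //= d IH; rewrite big1. Qed.

Lemma wsum_ge0 d F : (forall s, 0 <= F s) -> 0 <= wsum d F.
Proof. by move=> H; rewrite -(wsum0 d); apply: ler_wsum. Qed.

Lemma norm_wsum_le d F : `|wsum d F| <= wsum d (fun s => `|F s|).
Proof.
elim: d F => [|d IH] F //=; apply: (le_trans (ler_norm_sum _ _ _)).
by apply: ler_sum => i _; exact: IH.
Qed.

Lemma wsum_term_le s F : (forall s, 0 <= F s) -> F s <= wsum (size s) F.
Proof.
elim: s F => [|i s IH] F F0 //=; rewrite (bigD1 i)//=.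
apply: (@le_trans _ _ (wsum (size s) (fun s0 => F (i :: s0)))).
  exact: (IH (fun s => F (i :: s))).
by rewrite lerDl sumr_ge0// => j _; apply: wsum_ge0.
Qed.

Lemma cvg_bigsum (I : Type) (r : seq I) (u : I -> nat -> R) (l : I -> R) :
  (forall i, u i @ \oo --> l i) ->
  (fun n => \sum_(i <- r) u i n) @ \oo --> \sum_(i <- r) l i.
Proof.
move=> H; elim: r => [|i r IH].
  by rewrite big_nil (_ : (fun _ => _) = cst 0); [exact: cvg_cst|apply/funext => n; rewrite big_nil].
rewrite big_cons (_ : (fun _ => _) = (fun n => u i n + \sum_(j <- r) u j n)).
  exact: cvgD.
by apply/funext => n; rewrite big_cons.
Qed.

Lemma cvg_wsum d (F : nat -> seq 'I_m -> R) G :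
  (forall s, (fun k => F k s) @ \oo --> G s) ->
  (fun k => wsum d (F k)) @ \oo --> wsum d G.
Proof.
elim: d F G => [|d IH] F G H /=; first exact: H.
by apply: cvg_bigsum => i; apply: IH => s; exact: H.
Qed.

Definition mono h s : R := \prod_(i <- s) h 0 i.

Lemma mono_cons h i s : mono h (i :: s) = h 0 i * mono h s.
Proof. by rewrite /mono big_cons. Qed.

Lemma norm_mono_le h s (r : R) : `|h| <= r -> `|mono h s| <= r ^+ size s.
Proof.
move=> hr; elim: s => [|i s IH]; first by rewrite /mono big_nil normr1.
rewrite mono_cons normrM exprS ler_pM//.
exact: le_trans (rV_coord_le h i) hr.
Qed.

Definition cnorm c d : R := wsum d (fun s => `|c s|).

(** Truncation of a weighted l^1 norm of the coefficients. Bounds uniform in [D] behave like a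
    complete submultiplicative norm, in which products, substitutions and iterations are
    controlled. *)
Definition pnorm (r : R) c (D : nat) : R := \sum_(d < D) cnorm c d * r ^+ d.

Definition psum c (D : nat) h : R := \sum_(d < D) wsum d (fun s => c s * mono h s).

Lemma cnorm_ge0 c d : 0 <= cnorm c d.
Proof. by apply: wsum_ge0 => s. Qed.

Lemma wsum_mono_le d c h r : `|h| <= r ->
  `|wsum d (fun s => c s * mono h s)| <= cnorm c d * r ^+ d.
Proof.
move=> hr; apply: (le_trans (norm_wsum_le _ _)).
rewrite /cnorm -wsumZr; apply: ler_wsum => s ss.
by rewrite normrM ler_wpM2l// -ss norm_mono_le.
Qed.

Lemma psum_le c D h r : `|h| <= r -> `|psum c D h| <= pnorm r c D.
Proof.
move=> hr; apply: (le_trans (ler_norm_sum _ _ _)); apply: ler_sum => d _.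
exact: wsum_mono_le.
Qed.

Lemma psumD c1 c2 D h : psum (fun s => c1 s + c2 s) D h = psum c1 D h + psum c2 D h.
Proof.
rewrite /psum -big_split; apply: eq_bigr => d _ /=; rewrite -wsumD.
by apply: eq_wsum => s _; rewrite mulrDl.
Qed.

Lemma psumZ a c D h : psum (fun s => a * c s) D h = a * psum c D h.
Proof.
rewrite /psum mulr_sumr; apply: eq_bigr => d _ /=; rewrite -wsumZ.
by apply: eq_wsum => s _; rewrite mulrA.
Qed.

Lemma pnormD r c1 c2 D : 0 <= r ->
  pnorm r (fun s => c1 s + c2 s) D <= pnorm r c1 D + pnorm r c2 D.
Proof.
move=> r0; rewrite /pnorm -big_split; apply: ler_sum => d _ /=.
rewrite -mulrDl ler_wpM2r ?exprn_ge0// /cnorm -wsumD; apply: ler_wsum => s _.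
exact: ler_normD.
Qed.

Lemma pnormZ r a c D : pnorm r (fun s => a * c s) D = `|a| * pnorm r c D.
Proof.
rewrite /pnorm mulr_sumr; apply: eq_bigr => d _ /=.
rewrite mulrA /cnorm -wsumZ; congr (_ * _); apply: eq_wsum => s _.
by rewrite normrM.
Qed.

Lemma pnorm_le_rad r r' c D : 0 <= r -> r <= r' -> pnorm r c D <= pnorm r' c D.
Proof.
move=> r0 rr; apply: ler_sum => d _; rewrite ler_wpM2l ?cnorm_ge0//.
by rewrite lerXn2r// nnegrE (le_trans r0).
Qed.

Lemma ler_pnorm r c1 c2 D : 0 <= r -> (forall s, `|c1 s| <= `|c2 s|) ->
  pnorm r c1 D <= pnorm r c2 D.
Proof.
move=> r0 H; apply: ler_sum => d _; rewrite ler_wpM2r ?exprn_ge0//.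
by apply: ler_wsum => s _; exact: H.
Qed.

Lemma coef_le_pnorm r c s : 0 <= r -> `|c s| * r ^+ size s <= pnorm r c (size s).+1.
Proof.
move=> r0; rewrite /pnorm big_ord_recr /=; apply: ler_wpDl.
  by apply: sumr_ge0 => d _; rewrite mulr_ge0 ?cnorm_ge0 ?exprn_ge0.
by rewrite ler_wpM2r ?exprn_ge0// (wsum_term_le _ (F := fun s => `|c s|)).
Qed.

End WordSums.

Lemma cvg_upper_bound (R : realType) (u : nat -> R) (l B : R) K :
  u @ \oo --> l -> (forall n, (K <= n)%N -> u n <= B) -> l <= B.
Proof.
move=> ul H; rewrite -(cvg_lim _ ul)//; apply: limr_le; first by apply/cvg_ex; exists l.
by exists K => // n /= Kn; exact: H.
Qed.

Section Representation.
Context {R : realType} {m : nat}.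
Implicit Types (c : seq 'I_m -> R) (s : seq 'I_m) (h : 'rV[R]_m) (d : nat) (phi psi : 'rV[R]_m -> R).

(* On the ball of radius [r], [phi] is the sum of the power series with coefficients [c], whose norm
   for the weight [r] is at most [N]. *)
Definition reprc c (r N : R) phi : Prop :=
  (forall D, pnorm r c D <= N) /\
  forall h, `|h| <= r -> (fun D => psum c D h) @ \oo --> phi h.

Definition srepr (r N : R) phi : Prop := exists c, reprc c r N phi.

Lemma reprc_ge0 c r N phi : reprc c r N phi -> 0 <= N.
Proof. by move=> [/(_ 0%N) + _]; rewrite /pnorm big_ord0. Qed.

Lemma reprc_le c r N N' phi : N <= N' -> reprc c r N phi -> reprc c r N' phi.
Proof. by move=> NN [H1 H2]; split=> // D; exact: le_trans NN. Qed.

Lemma repr_le r N N' phi : N <= N' -> srepr r N phi -> srepr r N' phi.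
Proof. by move=> NN [c /(reprc_le NN) H]; exists c. Qed.

Lemma reprc_ext c r N phi psi : (forall h, `|h| <= r -> phi h = psi h) ->
  reprc c r N phi -> reprc c r N psi.
Proof. by move=> E [H1 H2]; split=> // h hr; rewrite -E//; exact: H2. Qed.

Lemma repr_ext r N phi psi : (forall h, `|h| <= r -> phi h = psi h) ->
  srepr r N phi -> srepr r N psi.
Proof. by move=> E [c /(reprc_ext E) H]; exists c. Qed.

Lemma reprc_rad c r r' N phi : 0 <= r' -> r' <= r -> reprc c r N phi -> reprc c r' N phi.
Proof.
move=> r0 rr [H1 H2]; split=> [D|h hr]; first exact: le_trans (pnorm_le_rad _ _ r0 rr) _.
by apply: H2; exact: le_trans rr.
Qed.

Lemma repr_rad r r' N phi : 0 <= r' -> r' <= r -> srepr r N phi -> srepr r' N phi.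
Proof. by move=> r0 rr [c /(reprc_rad r0 rr) H]; exists c. Qed.

Lemma repr_bound r N phi h : srepr r N phi -> `|h| <= r -> `|phi h| <= N.
Proof.
move=> [c [H1 H2]] hr; have /cvg_norm H := H2 h hr.
by apply: (cvg_upper_bound (K := 0%N) H) => D _; exact: le_trans (psum_le _ _ hr) _.
Qed.

Lemma reprcD c1 c2 r N1 N2 phi psi : 0 <= r -> reprc c1 r N1 phi -> reprc c2 r N2 psi ->
  reprc (fun s => c1 s + c2 s) r (N1 + N2) (fun h => phi h + psi h).
Proof.
move=> r0 [H1 H2] [H3 H4]; split=> [D|h hr].
  by apply: (le_trans (pnormD _ _ _ r0)); exact: lerD.
rewrite (_ : (fun D => _) = (fun D => psum c1 D h + psum c2 D h)).
  by apply: cvgD; [exact: H2|exact: H4].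
by apply/funext => D; rewrite psumD.
Qed.

Lemma reprcZ a c r N phi : reprc c r N phi ->
  reprc (fun s => a * c s) r (`|a| * N) (fun h => a * phi h).
Proof.
move=> [H1 H2]; split=> [D|h hr]; first by rewrite pnormZ ler_wpM2l.
rewrite (_ : (fun D => _) = (fun D => a * psum c D h)); last by apply/funext => D; rewrite psumZ.
by apply: cvgM; [exact: cvg_cst|exact: H2].
Qed.

Lemma reprD r N1 N2 phi psi : 0 <= r -> srepr r N1 phi -> srepr r N2 psi ->
  srepr r (N1 + N2) (fun h => phi h + psi h).
Proof. by move=> r0 [c1 H1] [c2 H2]; eexists; apply: reprcD H1 H2. Qed.

Lemma reprZ a r N phi : srepr r N phi -> srepr r (`|a| * N) (fun h => a * phi h).
Proof. by move=> [c H]; eexists; apply: reprcZ H. Qed.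

Lemma reprB r N1 N2 phi psi : 0 <= r -> srepr r N1 phi -> srepr r N2 psi ->
  srepr r (N1 + N2) (fun h => phi h - psi h).
Proof.
move=> r0 H1 /(reprZ (-1)); rewrite normrN1 mul1r => /(reprD r0 H1).
by apply: repr_ext => h _; rewrite mulN1r.
Qed.

Lemma reprc_eventually c r N phi D0 : 0 <= r ->
  (forall D, (D0 <= D)%N -> pnorm r c D <= N) ->
  (forall D h, (D0 <= D)%N -> psum c D h = phi h) -> reprc c r N phi.
Proof.
move=> r0 H1 H2; split=> [D|h hr].
  apply: le_trans (H1 (D0 + D)%N (leq_addr _ _)).
  rewrite /pnorm addnC big_split_ord /= lerDl sumr_ge0// => i _.
  by rewrite mulr_ge0 ?cnorm_ge0 ?exprn_ge0.
apply/cvgrPdist_lt => e e0; exists D0 => // D /= D0D.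
by rewrite H2// subrr normr0.
Qed.

Lemma repr_cst r a : 0 <= r -> srepr r `|a| (fun=> a).
Proof.
move=> r0; exists (fun s => if s is [::] then a else 0).
have Z d : wsum d.+1 (fun s : seq 'I_m => if s is [::] then a else 0) = 0.
  by rewrite -[RHS](wsum0 (m := m) d.+1); apply: eq_wsum => -[].
apply: (@reprc_eventually _ _ _ _ 1%N) => // [[|D] // _|[|D] h // _].
  rewrite /pnorm big_ord_recl /= mulr1 big1 ?addr0// => i _.
  rewrite /cnorm (_ : wsum _ _ = 0) ?mul0r// -[RHS](wsum0 (m := m) i.+1).
  by apply: eq_wsum => -[] //= *; rewrite normr0.
rewrite /psum big_ord_recl [X in _ + X]big1 => [|i _].
  by rewrite /= /mono big_nil mulr1 addr0.
rewrite lift0 -[RHS](wsum0 (m := m) i.+1).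
by apply: eq_wsum => -[] //= *; rewrite mul0r.
Qed.

(** Multiplication by a coordinate puts the letter [i] in front of every word. The degree goes up by
    one, which is the origin of the factor [r] and of the shift in [D]. *)
Lemma repr_coordM r N i phi : 0 <= r -> srepr r N phi ->
  srepr r (r * N) (fun h => h 0 i * phi h).
Proof.
move=> r0 [c [H1 H2]].
pose c' s := if s is j :: s' then if j == i then c s' else 0 else 0.
have N0 : 0 <= N by apply: reprc_ge0 (conj H1 H2).
(* The weight [G] is left general so that one computation serves both the norm and the value of the
   shifted series. *)
have E (G : seq 'I_m -> R -> R) d : (forall s, G s 0 = 0) ->
    wsum d.+1 (fun s => G s (c' s)) = wsum d (fun s => G (i :: s) (c s)).
  move=> G0; rewrite /= (bigD1 i)//= eqxx big1 ?addr0// => j /negPf ji.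
  by rewrite -[RHS](wsum0 (m := m) d); apply: eq_wsum => s _; rewrite ji G0.
exists c'; split=> [[|D]|h hr].
- by rewrite /pnorm big_ord0 mulr_ge0.
- rewrite /pnorm big_ord_recl {1}/cnorm /= normr0 mul0r add0r.
  apply: le_trans (ler_wpM2l r0 (H1 D)); rewrite /pnorm mulr_sumr.
  apply: ler_sum => d _; rewrite /cnorm (E (fun _ x => `|x|)) ?normr0//.
  by rewrite /bump leq0n add1n exprS mulrCA.
rewrite -cvg_shiftS (_ : [sequence _]_n = (fun D => h 0 i * psum c D h)).
  by apply: cvgM; [exact: cvg_cst|exact: H2].
apply/funext => D; rewrite [LHS]/= /psum big_ord_recl [X in X + _]/= mul0r add0r mulr_sumr.
apply: eq_bigr => d _; rewrite -wsumZ lift0.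
rewrite (E (fun s x => x * mono h s)); last by move=> s; rewrite mul0r.
by apply: eq_wsum => s _; rewrite mono_cons mulrCA.
Qed.

Lemma repr_coord r i : 0 <= r -> srepr r r (fun h => h 0 i).
Proof.
move=> r0; have := repr_coordM i r0 (repr_cst 1 r0); rewrite normr1 mulr1.
by apply: repr_ext => h _; rewrite mulr1.
Qed.

Lemma repr_monoM r N s phi : 0 <= r -> srepr r N phi ->
  srepr r (r ^+ size s * N) (fun h => mono h s * phi h).
Proof.
move=> r0 H; elim: s => [|i s IH].
  by rewrite /= mul1r; apply: repr_ext H => h _; rewrite /mono big_nil mul1r.
rewrite exprS -mulrA; apply: repr_ext (repr_coordM i r0 IH) => h _.
by rewrite mono_cons mulrA.
Qed.

Lemma repr_wsum p d (c : seq 'I_p -> R) r B (F : seq 'I_p -> 'rV[R]_m -> R) : 0 <= r ->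
  (forall s : seq 'I_p, size s = d -> srepr r B (F s)) ->
  srepr r (cnorm c d * B) (fun h => wsum d (fun s : seq 'I_p => c s * F s h)).
Proof.
move=> r0; elim: d c F => [|d IH] c F H.
  by apply: reprZ; exact: H.
have IHi i := IH (fun s : seq 'I_p => c (i :: s)) (fun s : seq 'I_p => F (i :: s)) (fun (s : seq 'I_p) (ss : size s = d) => H (i :: s) (congr1 succn ss)).
rewrite /cnorm /= mulr_suml; elim: (index_enum _) => [|i l IHl].
  rewrite big_nil; apply: (@repr_le _ `|0 : R|); first by rewrite normr0.
  by apply: repr_ext (repr_cst 0 r0) => h _; rewrite big_nil.
rewrite big_cons; apply: repr_ext (reprD r0 (IHi i) IHl) => h _.
by rewrite big_cons.
Qed.

Lemma bounded_series_cvg (u N : nat -> R) B :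
  (forall k, `|u k| <= N k) -> (forall K, \sum_(k < K) N k <= B) ->
  exists l : R, (fun K => \sum_(k < K) u k) @ \oo --> l.
Proof.
move=> uN NB; have : cvgn (series u); last by move=> /cvg_ex[l]; rewrite seriesEord; exists l.
apply: normed_cvg; rewrite /normed_series_of seriesEord; apply: nondecreasing_is_cvgn.
  by apply/nondecreasing_seqP => n /=; rewrite big_ord_recr /= lerDl.
exists B => _ [n _ <-] /=; apply: le_trans (NB n).
by apply: ler_sum => k _; exact: uN.
Qed.

(** Completeness of the norm: a series of power series with summable norms converges coefficient by
    coefficient, and the limiting coefficients represent the pointwise sum. *)
Lemma repr_series (r N : R) (phi_ : nat -> 'rV[R]_m -> R) (N_ : nat -> R) phi : 0 < r ->
  (forall k, srepr r (N_ k) (phi_ k)) -> (forall K, \sum_(k < K) N_ k <= N) ->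
  (forall h, `|h| <= r -> (fun K => \sum_(k < K) phi_ k h) @ \oo --> phi h) ->
  srepr r N phi.
Proof.
move=> r0 /choice[cc ccP] NB phiE.
have r0' := ltW r0.
have N0 k : 0 <= N_ k by exact: reprc_ge0 (ccP k).
have cexist s : exists l : R, (fun K => \sum_(k < K) cc k s) @ \oo --> l.
  have rs : 0 < r ^+ size s by rewrite exprn_gt0.
  (* A single coefficient is at most the norm divided by [r ^+ size s], so its series converges
     absolutely. *)
  apply: (@bounded_series_cvg (cc ^~ s) (fun k => N_ k / r ^+ size s) (N / r ^+ size s)).
    move=> k; rewrite ler_pdivlMr//; apply: le_trans (coef_le_pnorm _ _ r0') _.
    by have [H _] := ccP k; exact: H.
  by move=> K; rewrite -mulr_suml ler_pM2r ?invr_gt0.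
have [C CP] := choice cexist.
have [T TP] : exists T : R, (fun K => \sum_(k < K) N_ k) @ \oo --> T.
  by apply: (bounded_series_cvg (N := N_) _ NB) => k; rewrite ger0_norm.
have TN : T <= N by apply: (cvg_upper_bound (K := 0%N) TP) => n _; exact: NB.
pose S K s := \sum_(k < K) cc k s.
have SK K : reprc (S K) r (\sum_(k < K) N_ k) (fun h => \sum_(k < K) phi_ k h).
  elim: K => [|K IH].
    apply: (@reprc_eventually _ _ _ _ 0%N) => // [D _|D h _].
      rewrite big_ord0 /pnorm big1// => d _; rewrite /cnorm (_ : wsum _ _ = 0) ?mul0r//.
      by rewrite -[RHS](wsum0 (m := m) d); apply: eq_wsum => s _; rewrite /S big_ord0 normr0.
    rewrite big_ord0 /psum big1// => d _.
    by rewrite -[RHS](wsum0 (m := m) d); apply: eq_wsum => s _; rewrite /S big_ord0 mul0r.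
  have := reprcD r0' IH (ccP K); rewrite big_ord_recr /= => H.
  have -> : S K.+1 = (fun s => S K s + cc K s).
    by apply/funext => s; rewrite /S big_ord_recr.
  by apply: reprc_ext H => h _; rewrite big_ord_recr.
have tail K L D : (K <= L)%N ->
    pnorm r (fun s => S L s - S K s) D <= \sum_(k < L) N_ k - \sum_(k < K) N_ k.
  move=> /subnK <-; elim: (L - K)%N => [|j IH].
    rewrite add0n subrr /pnorm big1// => d _; rewrite /cnorm (_ : wsum _ _ = 0) ?mul0r//.
    by rewrite -[RHS](wsum0 (m := m) d); apply: eq_wsum => s _; rewrite subrr normr0.
  rewrite addSn.
  have -> : (fun s => S (j + K).+1 s - S K s) = (fun s => (S (j + K)%N s - S K s) + cc (j + K)%N s).
    by apply/funext => s; rewrite /S big_ord_recr /= addrAC.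
  rewrite (le_trans (pnormD _ _ _ r0'))// big_ord_recr /= addrAC lerD//.
  by have [H _] := ccP (j + K)%N; exact: H.
(* For fixed [D] the truncated norm involves finitely many coefficients, so the tail bound survives
   the limit in [L]. *)
have tailC K D : pnorm r (fun s => C s - S K s) D <= T - \sum_(k < K) N_ k.
  have H : (fun L => pnorm r (fun s => S L s - S K s) D) @ \oo --> pnorm r (fun s => C s - S K s) D.
    apply: cvg_bigsum => d; apply: cvgM; last exact: cvg_cst.
    apply: cvg_wsum => s; apply: cvg_norm; apply: cvgB; last exact: cvg_cst.
    exact: CP.
  apply: (cvg_upper_bound (K := K) H) => L KL; apply: le_trans (tail _ _ _ KL) _.
  rewrite lerD2r; have := nondecreasing_cvgn_le (u_ := fun K => \sum_(k < K) N_ k).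
  rewrite (cvg_lim _ TP)//; apply.
    by apply/nondecreasing_seqP => n; rewrite big_ord_recr /= lerDl.
  exact: TP.
exists C; split=> [D|h hr].
  have := tailC 0%N D; rewrite big_ord0 subr0 => /le_trans -/(_ _ TN).
  apply: le_trans; apply: ler_pnorm => // s.
  by rewrite /S big_ord0 subr0.
apply/cvgrPdist_lt => e e0.
have e3 : 0 < e / 3 by rewrite divr_gt0.
have /cvgrPdist_lt/(_ _ e3)[K1 _ HK1] := phiE h hr.
(* Three errors of e / 3: between [phi] and a partial sum of the [phi_], between that partial sum
   and its own truncation, and between the truncations of [S K] and [C]. [K] is fixed before [D] is
   sent to infinity. *)
have /cvgrPdist_lt/(_ _ e3)[K2 _ HK2] := TP.
pose K := (K1 + K2)%N.
have HK1' := HK1 K (leq_addr _ _); have HK2' := HK2 K (leq_addl _ _).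
have [_ /(_ h hr)/cvgrPdist_lt/(_ _ e3)[D0 _ HD]] := SK K.
exists D0 => // D /= D0D; have HD' := HD D D0D.
rewrite /= in HK1' HK2' HD'.
have : `|psum C D h - psum (S K) D h| < e / 3.
  have -> : psum C D h - psum (S K) D h = psum (fun s => C s - S K s) D h.
    rewrite -mulN1r -psumZ -psumD; congr psum; apply/funext => s.
    by rewrite mulN1r.
  apply: le_lt_trans (psum_le _ _ hr) _; apply: le_lt_trans (tailC K D) _.
  by apply: le_lt_trans HK2'; exact: ler_norm.
move: HK1' HD'; rewrite !ltr_norml; lra.
Qed.

(** Only [phi] is expanded: each term is a monomial times [psi], and [repr_series] adds them up, so
    no formula for the coefficients of a product is required. *)
Lemma reprM r N1 N2 phi psi : 0 < r -> srepr r N1 phi -> srepr r N2 psi ->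
  srepr r (N1 * N2) (fun h => phi h * psi h).
Proof.
move=> r0 [c [H1 H2]] [c' Hpsi].
have N20 := reprc_ge0 Hpsi; have r0' := ltW r0.
have psiR : srepr r N2 psi by exists c'.
apply: (@repr_series _ _ (fun d h => wsum d (fun s => c s * (mono h s * psi h)))
   (fun d => cnorm c d * (r ^+ d * N2))) => //.
- by move=> d; apply: repr_wsum => // s ss; rewrite -ss; exact: repr_monoM.
- move=> K; rewrite (_ : \sum_(k < K) _ = pnorm r c K * N2); first by rewrite ler_wpM2r.
  by rewrite /pnorm mulr_suml; apply: eq_bigr => d _; rewrite mulrA.
move=> h hr; rewrite (_ : (fun K => _) = (fun D => psum c D h * psi h)).
  by apply: cvgM; [exact: H2|exact: cvg_cst].
apply/funext => D; rewrite /psum mulr_suml; apply: eq_bigr => d _.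
by rewrite -wsumZr; apply: eq_wsum => s _; rewrite mulrA.
Qed.

End Representation.

(** * Substitution of power series *)

Section Composition.
Context {R : realType} {m p : nat}.
Implicit Types (y : 'rV[R]_m -> 'rV[R]_p) (phi : 'rV[R]_p -> R).

Lemma repr_mono (rho r : R) y s : 0 < rho ->
  (forall j, srepr rho r (fun h => y h 0 j)) ->
  srepr rho (r ^+ size s) (fun h => mono (y h) s).
Proof.
move=> rho0 H; elim: s => [|i s IH].
  rewrite -[_ ^+ _]normr1; apply: repr_ext (repr_cst 1 (ltW rho0)) => h _.
  by rewrite /mono big_nil.
rewrite exprS; apply: repr_ext (reprM rho0 (H i) IH) => h _.
by rewrite mono_cons.
Qed.

Lemma repr_rV_bound (rho r : R) y h : 0 <= r ->
  (forall j, srepr rho r (fun h => y h 0 j)) -> `|h| <= rho -> `|y h| <= r.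
Proof.
by move=> r0 H hr; apply: rV_norm_le => // j; exact: repr_bound (H j) hr.
Qed.

(** The coordinates of [y] have norm at most [r], so a word of length [d] becomes a series of norm
    at most r^d, and these bounds sum to the norm of [phi]. *)
Lemma repr_comp (rho r N : R) y phi : 0 < rho -> 0 <= r -> srepr r N phi ->
  (forall j, srepr rho r (fun h => y h 0 j)) ->
  srepr rho N (fun h => phi (y h)).
Proof.
move=> rho0 r0 [c [H1 H2]] H.
apply: (@repr_series _ _ _ _ (fun d h => wsum d (fun s => c s * mono (y h) s))
   (fun d => cnorm c d * r ^+ d)) => //.
- by move=> d; apply: repr_wsum => [|s ss]; [exact: ltW|rewrite -ss; exact: repr_mono].
- by move=> h hr; apply: H2; exact: repr_rV_bound hr.
Qed.

(** Replacing [y] by [y'] one letter at a time gives [delta] times the derivative of r^d. For the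
    empty word the factor 0 makes the truncated exponent harmless. *)
Lemma repr_mono_diff (rho r delta : R) y y' s : 0 < rho -> 0 <= r ->
  (forall j, srepr rho r (fun h => y h 0 j)) ->
  (forall j, srepr rho r (fun h => y' h 0 j)) ->
  (forall j, srepr rho delta (fun h => y h 0 j - y' h 0 j)) ->
  srepr rho (delta * ((size s)%:R * r ^+ (size s).-1)) (fun h => mono (y h) s - mono (y' h) s).
Proof.
move=> rho0 r0 Hy Hy' Hd; elim: s => [|i s IH].
  rewrite mul0r mulr0; apply: (@repr_le _ _ _ `|0 : R|); first by rewrite normr0.
  by apply: repr_ext (repr_cst 0 (ltW rho0)) => h _; rewrite /mono !big_nil subrr.
have := reprD (ltW rho0) (reprM rho0 (Hd i) (repr_mono s rho0 Hy)) (reprM rho0 (Hy' i) IH).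
have -> : delta * r ^+ size s + r * (delta * ((size s)%:R * r ^+ (size s).-1)) =
    delta * ((size (i :: s))%:R * r ^+ (size (i :: s)).-1).
  case: s {IH} => [|j s] /=; first by rewrite !mul0r !mulr0 addr0 mul1r.
  rewrite exprS [(size s).+2%:R]mulrS; ring.
by apply: repr_ext => h _; rewrite !mono_cons; ring.
Qed.

(** [K] bounds the norm of the formal derivative of the series. The Lipschitz estimate is for the
    coefficient norm, not just for values, as needed to iterate inside the class of power series. *)
Lemma reprc_comp_diff c (rho r N delta K : R) y y' phi : 0 < rho -> 0 <= r -> 0 <= delta ->
  reprc c r N phi ->
  (forall D, \sum_(d < D) cnorm c d * (d%:R * r ^+ d.-1) <= K) ->
  (forall j, srepr rho r (fun h => y h 0 j)) ->
  (forall j, srepr rho r (fun h => y' h 0 j)) ->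
  (forall j, srepr rho delta (fun h => y h 0 j - y' h 0 j)) ->
  srepr rho (delta * K) (fun h => phi (y h) - phi (y' h)).
Proof.
move=> rho0 r0 d0 [H1 H2] HK Hy Hy' Hd.
apply: (@repr_series _ _ _ _ (fun d h => wsum d (fun s => c s * (mono (y h) s - mono (y' h) s)))
   (fun d => cnorm c d * (delta * (d%:R * r ^+ d.-1)))) => //.
- move=> d; apply: repr_wsum => [|s ss]; first exact: ltW.
  by rewrite -ss; exact: repr_mono_diff.
- move=> D; apply: le_trans (ler_wpM2l d0 (HK D)); rewrite mulr_sumr.
  by apply: ler_sum => d _; rewrite mulrCA.
move=> h hr; rewrite (_ : (fun D => _) = (fun D => psum c D (y h) - psum c D (y' h))).
  by apply: cvgB; apply: H2; exact: repr_rV_bound hr.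
apply/funext => D; rewrite /psum -sumrB; apply: eq_bigr => d _.
rewrite -[X in _ - X]mul1r -mulNr -wsumZ -wsumD; apply: eq_wsum => s _.
by rewrite mulrBr mulN1r.
Qed.

End Composition.

(** * Termwise differentiation of power series *)

Section PowerSeriesDerivative.
Context {R : realType} {m : nat}.
Implicit Types (c : seq 'I_m -> R) (s : seq 'I_m) (h : 'rV[R]_m) (d : nat) (phi psi : 'rV[R]_m -> R).

Lemma natr_le_expr (k d : nat) : (1 < k)%N -> d%:R <= (k%:R : R) ^+ d.
Proof. by move=> k1; rewrite -natrX ler_nat ltnW// ltn_expl. Qed.

Fixpoint dmono (i : 'I_m) h s : R :=
  if s is j :: s' then (i == j)%:R * mono h s' + h 0 j * dmono i h s' else 0.

Lemma repr_dmono (r : R) i s : 0 < r ->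
  srepr r ((size s)%:R * r ^+ (size s).-1) (fun h => dmono i h s).
Proof.
move=> r0; elim: s => [|j s IH] /=.
  rewrite mul0r; apply: (@repr_le _ _ _ `|0 : R|); first by rewrite normr0.
  exact: repr_cst (ltW r0).
have monoR : srepr r (r ^+ size s) (fun h => mono h s).
  apply: (repr_mono (y := id)) => // j'; exact: repr_coord (ltW r0).
have H := reprD (ltW r0) (reprZ (i == j)%:R monoR) (repr_coordM j (ltW r0) IH).
apply: repr_le H.
apply: (@le_trans _ _ (r ^+ size s + r * ((size s)%:R * r ^+ (size s).-1))).
  by rewrite lerD2r ler_piMl ?exprn_ge0 ?(ltW r0)//; case: (i == j); rewrite ?normr1 ?normr0.
by case: (s) => [|j' s'] /=; rewrite ?mul0r ?mulr0 ?addr0 ?mul1r// exprS [(size s').+2%:R]mulrS; lra.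
Qed.

Lemma dmono_bound (r : R) i h s : 0 < r -> `|h| <= r ->
  `|dmono i h s| * r <= (size s)%:R * r ^+ size s.
Proof.
move=> r0 hr; have := repr_bound (repr_dmono i s r0) hr.
rewrite -(ler_pM2r r0) => /le_trans; apply.
by case: (s) => [|j s'] /=; [rewrite !mul0r|rewrite exprSr mulrA].
Qed.

(** Second-order Taylor remainder of a monomial, by induction on the word. The factor [r ^+ 2]
    stands on the left to avoid an exponent d - 2, which would be truncated for short words. *)
Lemma mono_second_order (r t : R) i h s : 0 < r -> `|h| <= r ->
  `|h + t *: delta_mx 0 i| <= r ->
  `|mono (h + t *: delta_mx 0 i) s - mono h s - t * dmono i h s| * r ^+ 2 <=
  t ^+ 2 * ((size s)%:R ^+ 2 * r ^+ size s).
Proof.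
move=> r0 hr htr; elim: s => [|j s IH].
  by rewrite /mono !big_nil subrr sub0r mulr0 oppr0 normr0 mul0r expr0n mul0r mulr0.
set E := mono (h + _) s - _ - _ in IH *.
have -> : mono (h + t *: delta_mx 0 i) (j :: s) - mono h (j :: s) - t * dmono i h (j :: s) =
   t ^+ 2 * ((i == j)%:R * dmono i h s) + (h + t *: delta_mx 0 i) 0 j * E.
  rewrite /E !mono_cons /= !mxE eqxx /= [j == i]eq_sym.
  by move: (mono (_ + _) s) (mono h s) (dmono i h s) => A B C; ring.
rewrite (le_trans (ler_wpM2r (sqr_ge0 r) (ler_normD _ _)))// mulrDl.
have s0 : (0 : R) <= (size s)%:R by rewrite ler0n.
apply: (@le_trans _ _ (t ^+ 2 * (r * ((size s)%:R * r ^+ size s)) + r * (t ^+ 2 * ((size s)%:R ^+ 2 * r ^+ size s)))); last first.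
  rewrite /= mulrS [r ^+ (size s).+1]exprS.
  have -> : t ^+ 2 * (r * ((size s)%:R * r ^+ size s)) + r * (t ^+ 2 * ((size s)%:R ^+ 2 * r ^+ size s)) =
     (t ^+ 2 * (r * r ^+ size s)) * ((size s)%:R + (size s)%:R ^+ 2) by ring.
  rewrite [leRHS](_ : _ = (t ^+ 2 * (r * r ^+ size s)) * ((1 + (size s)%:R) ^+ 2)); last by ring.
  have X0 : 0 <= t ^+ 2 * (r * r ^+ size s).
    by apply: mulr_ge0; [exact: sqr_ge0|rewrite mulr_ge0 ?exprn_ge0 ?(ltW r0)].
  by rewrite ler_wpM2l//; move: s0; move: ((size s)%:R : R) => a a0; nra.
apply: lerD.
  rewrite normrM ger0_norm ?sqr_ge0// -mulrA ler_wpM2l ?sqr_ge0// normrM.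
  have -> : `|(i == j)%:R| * `|dmono i h s| * r ^+ 2 = r * (`|(i == j)%:R| * (`|dmono i h s| * r)).
    by rewrite expr2; ring.
  rewrite ler_wpM2l ?(ltW r0)// (le_trans _ (dmono_bound i s r0 hr))//.
  by rewrite ler_piMl ?mulr_ge0 ?(ltW r0)//; case: (i == j); rewrite ?normr1 ?normr0.
rewrite normrM -mulrA; apply: ler_pM => //; first by rewrite mulr_ge0 ?sqr_ge0.
exact: le_trans (rV_coord_le _ _) htr.
Qed.

Lemma reprc_at0 c r N phi : 0 <= r -> reprc c r N phi -> phi 0 = c [::].
Proof.
move=> r0 [_ /(_ 0)]; rewrite normr0 => /(_ r0) H.
rewrite -(cvg_lim _ H)//; apply: lim_near_cst => //.
exists 1%N => // -[|D] //= _; rewrite /psum big_ord_recl [X in _ + X]big1 => [|i _].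
  by rewrite /= /mono big_nil mulr1 addr0.
rewrite lift0 -[RHS](wsum0 (m := m) i.+1); apply: eq_wsum => -[] //= j s _.
by rewrite mono_cons mxE mul0r mulr0.
Qed.

(** Schwarz-type scaling: without a constant term every degree satisfies t^d <= t, so the norm
    shrinks at least as fast as the radius. *)
Lemma repr_shrink r N phi t : 0 <= r -> srepr r N phi -> phi 0 = 0 -> 0 <= t <= 1 ->
  srepr (t * r) (t * N) phi.
Proof.
move=> r0 [c H] p0 /andP[t0 t1]; exists c.
have c0 : c [::] = 0 by rewrite -(reprc_at0 r0 H).
have [H1 H2] := H; split=> [D|h hr].
  apply: le_trans (ler_wpM2l t0 (H1 D)); rewrite /pnorm mulr_sumr.
  apply: ler_sum => -[[|d] dD] _ /=; first by rewrite /cnorm /= c0 normr0 !mul0r mulr0.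
  rewrite mulrCA ler_wpM2l ?cnorm_ge0// exprMn ler_wpM2r ?exprn_ge0//.
  by rewrite exprS ler_piMr// exprn_ile1.
by apply: H2; rewrite (le_trans hr)// ler_piMl.
Qed.

Lemma norm_delta_le (i : 'I_m) : `|delta_mx 0 i : 'rV[R]_m| <= 1.
Proof.
apply: rV_norm_le => // j; rewrite mxE eqxx /=; case: eqP => _; first by rewrite normr1.
by rewrite normr0.
Qed.

(** The value [g 0 = c [::i]] identifies the degree-one coefficients with the partial derivatives at
    the centre; the inverse function argument depends on it. *)
Lemma reprc_derive c (r0 N : R) phi i : 0 < r0 -> reprc c r0 N phi ->
  exists g, [/\ srepr (r0 / 4) (N / (r0 / 4)) g,
    forall h, `|h| < r0 / 4 -> is_derive h (delta_mx 0 i) phi (g h) &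
    g 0 = c [::i]].
Proof.
move=> r00 H; have [H1 H2] := H; have N0 := reprc_ge0 H.
(* A quarter of the radius absorbs the polynomial factors of the first and second derivative, since
   both d and d^2 are at most 4^d. *)
pose r := r0 / 4; have rr : r0 = 4 * r by rewrite /r mulrCA mulfV ?mulr1// pnatr_eq0.
have r_gt0 : 0 < r by rewrite divr_gt0.
have rle : r <= r0 by rewrite rr; lra.
have powE d : r0 ^+ d = 4%:R ^+ d * r ^+ d by rewrite rr exprMn.
have bnd1 d : d%:R * r ^+ d.-1 <= r0 ^+ d / r.
  case: d => [|d]; first by rewrite mul0r divr_ge0 ?(ltW r_gt0).
  rewrite ler_pdivlMr// -mulrA -exprSr powE ler_wpM2r ?exprn_ge0 ?(ltW r_gt0)//.
  exact: natr_le_expr.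
pose phi_ d h := wsum d (fun s => c s * dmono i h s).
pose N_ d := cnorm c d * (d%:R * r ^+ d.-1).
have NB K : \sum_(k < K) N_ k <= N / r.
  apply: (@le_trans _ _ (pnorm r0 c K / r)); last by rewrite ler_pM2r ?invr_gt0.
  rewrite /pnorm mulr_suml; apply: ler_sum => d _.
  by rewrite /N_ -mulrA ler_wpM2l ?cnorm_ge0.
have phiR d : srepr r (N_ d) (phi_ d).
  by apply: repr_wsum => [|s ss]; [exact: ltW|rewrite -ss; exact: repr_dmono].
have gex h : exists l : R, `|h| <= r -> (fun K => \sum_(k < K) phi_ k h) @ \oo --> l.
  case: (leP (`|h|) r) => hr; last by exists 0.
  have [l lP] := bounded_series_cvg (fun k => repr_bound (phiR k) hr) NB.
  by exists l.
have [g gP] := choice gex.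
exists g; split; first exact: (repr_series r_gt0 phiR NB gP).
- move=> h hr; apply: dir_derive => e e0.
  pose d1 := r - `|h|; have d10 : 0 < d1 by rewrite subr_gt0.
  exists (Num.min d1 (e * r ^+ 2 / (N + 1))) => [|t].
    by rewrite lt_min d10 divr_gt0 ?mulr_gt0 ?exprn_gt0// ltr_wpDl.
  rewrite lt_min => /andP[td1]; rewrite ltr_pdivlMr ?ltr_wpDl// => te.
  have htr : `|h + t *: delta_mx 0 i| <= r.
    rewrite (le_trans (ler_normD _ _))// normrZ -lerBrDl.
    by rewrite (le_trans _ (ltW td1))// ler_piMr// norm_delta_le.
  have hr' := ltW hr.
  rewrite [t *: _ + h]addrC.
  (* A quadratic remainder, uniform over the truncations, passes to the limit and yields the
     derivative without interchanging limits. *)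
  suff : `|phi (h + t *: delta_mx 0 i) - phi h - t * g h| <= t ^+ 2 * (N / r ^+ 2).
    move=> /le_trans; apply; rewrite mulrA ler_pdivrMr ?exprn_gt0//.
    have -> : t ^+ 2 = `|t| * `|t| by rewrite -normrM -expr2 ger0_norm ?sqr_ge0.
    rewrite -mulrA [leRHS]mulrAC [leRHS]mulrC ler_wpM2l//.
    by apply: le_trans (ltW te); rewrite ler_wpM2l// lerDl.
  have C : (fun D => psum c D (h + t *: delta_mx 0 i) - psum c D h - t * (\sum_(k < D) phi_ k h)) @ \oo
     --> phi (h + t *: delta_mx 0 i) - phi h - t * g h.
    apply: cvgB; last by apply: cvgM; [exact: cvg_cst|exact: gP].
    by apply: cvgB; apply: H2; apply: le_trans rle.
  apply: (cvg_upper_bound (K := 0%N) (cvg_norm C)) => D _.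
  rewrite mulrA ler_pdivlMr ?exprn_gt0//.
  apply: le_trans (ler_wpM2l (sqr_ge0 t) (H1 D)).
  rewrite /psum mulr_sumr -!sumrB.
  apply: le_trans (ler_wpM2r (sqr_ge0 r) (ler_norm_sum _ _ _)) _.
  rewrite mulr_suml /pnorm mulr_sumr; apply: ler_sum => d _.
  have -> : wsum d (fun s => c s * mono (h + t *: delta_mx 0 i) s) -
     wsum d (fun s => c s * mono h s) - t * phi_ d h =
     wsum d (fun s => c s * (mono (h + t *: delta_mx 0 i) s - mono h s - t * dmono i h s)).
    rewrite -[X in _ - X - _]mul1r -!mulNr -!wsumZ -!wsumD; apply: eq_wsum => s _.
    by rewrite /=; ring.
  apply: le_trans (ler_wpM2r (sqr_ge0 r) (norm_wsum_le _ _)) _.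
  rewrite -wsumZr mulrCA /cnorm -wsumZr; apply: ler_wsum => s ss.
  rewrite normrM -mulrA ler_wpM2l// (le_trans (mono_second_order s r_gt0 hr' htr))//.
  rewrite ler_wpM2l ?sqr_ge0// ss powE ler_wpM2r ?exprn_ge0 ?(ltW r_gt0)//.
  have h2 := natr_le_expr d (isT : (1 < 2)%N).
  apply: (@le_trans _ _ ((2%:R ^+ d) ^+ 2)).
    by rewrite lerXn2r ?nnegrE ?ler0n ?exprn_ge0.
  by rewrite -exprM mulnC exprM -natrX.
- have G0 := gP 0; rewrite normr0 in G0; have {}G0 := G0 (ltW r_gt0).
  rewrite -(cvg_lim _ G0)//; apply: lim_near_cst => //.
  (* At the centre only the word [[:: i]] contributes, so the partial sums are constant from two
     terms on. *)
  exists 2%N => // -[|[|D]] //= _.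
  rewrite 2!big_ord_recl /= [X in _ + (_ + X)]big1 => [|j _]; last first.
    rewrite /phi_ /bump !leq0n !add1n -[RHS](wsum0 (m := m) j.+2); apply: eq_wsum => -[|a [|b s]] //= _.
    by rewrite mono_cons !mxE !mul0r !(mulr0, addr0).
  rewrite /phi_ /= !mulr0 add0r addr0 (bigD1 i)//= eqxx /mono big_nil mul1r mulr0 addr0 mulr1.
  by rewrite big1 ?addr0// => j ji; rewrite eq_sym (negPf ji) mul0r mulr0 addr0 mulr0.
Qed.

End PowerSeriesDerivative.

(** * Analytic functions at a point *)

Section Analytic.
Context {R : realType}.
Implicit Types (m p : nat).

Definition analytic_at m (f : 'rV[R]_m -> R) (x : 'rV[R]_m) : Prop :=
  exists r N : R, 0 < r /\ srepr r N (fun h => f (x + h)).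

Lemma is_derive_translate m (f : 'rV[R]_m -> R) x h v (l : R) :
  is_derive h v (fun h => f (x + h)) l <-> is_derive (x + h) v f l.
Proof.
have E : (fun t : R => t^-1 *: (f (x + (t *: v + h)) - f (x + h))) =
         (fun t : R => t^-1 *: (f (t *: v + (x + h)) - f (x + h))).
  by apply/funext => t; rewrite addrCA.
split=> -[D1 D2].
  by apply: DeriveDef; [rewrite /derivable -E|rewrite /derive -E].
by apply: DeriveDef; [rewrite /derivable E|rewrite /derive E].
Qed.

Lemma an_near m (f g : 'rV[R]_m -> R) x : (\near x, f x = g x) -> analytic_at f x -> analytic_at g x.
Proof.
move=> /near_ballP[d d0 fg] [r [N [r0 H]]].
exists (Num.min r (d / 2)), N; split; first by rewrite lt_min r0 divr_gt0.
have m0 : 0 <= Num.min r (d / 2) by rewrite le_min (ltW r0) divr_ge0// ltW.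
have : srepr (Num.min r (d / 2)) N (fun h => f (x + h)).
  by apply: repr_rad H => //; rewrite ge_min lexx.
apply: repr_ext => h hr; apply: fg; rewrite addrC addKr.
apply: (le_lt_trans hr); rewrite gt_min; apply/orP; right.
by rewrite ltr_pdivrMr// ltr_pMr// ltr1n.
Qed.

Lemma an_cst m (a : R) (x : 'rV[R]_m) : analytic_at (fun=> a) x.
Proof. by exists 1, `|a|; split=> //; exact: repr_cst. Qed.

Lemma anD m (f g : 'rV[R]_m -> R) x : analytic_at f x -> analytic_at g x -> analytic_at (fun y => f y + g y) x.
Proof.
move=> [r [N [r0 H]]] [r' [N' [r'0 H']]].
have m0 : 0 <= Num.min r r' by rewrite le_min !ltW.
exists (Num.min r r'), (N + N'); split; first by rewrite lt_min r0.
apply: reprD => //; [apply: repr_rad H|apply: repr_rad H'] => //; rewrite ge_min lexx ?orbT//.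
Qed.

Lemma anZ m (a : R) (f : 'rV[R]_m -> R) x : analytic_at f x -> analytic_at (fun y => a * f y) x.
Proof. by move=> [r [N [r0 H]]]; exists r, (`|a| * N); split=> //; exact: reprZ. Qed.

Lemma an_coord m j (x : 'rV[R]_m) : analytic_at (fun y => y 0 j) x.
Proof.
exists 1, (`|x 0 j| + 1); split=> //.
apply: repr_ext (reprD ler01 (repr_cst (x 0 j) ler01) (repr_coord j ler01)) => h _.
by rewrite mxE.
Qed.

(** Subtracting the value at [x] makes [repr_shrink] applicable: the norm can then be made as small
    as desired by shrinking the ball, as substitution requires. *)
Lemma an_centered m (f : 'rV[R]_m -> R) x : analytic_at f x ->
  exists r N : R, [/\ 0 < r, 0 <= N & forall t, 0 <= t <= 1 ->
     srepr (t * r) (t * N) (fun h => f (x + h) - f x)].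
Proof.
move=> [r [N [r0 H]]]; have H' := reprB (ltW r0) H (repr_cst (f x) (ltW r0)).
exists r, (N + `|f x|); split=> //.
  by have [c /reprc_ge0] := H'.
by move=> t t01; apply: repr_shrink => //; [exact: ltW|rewrite addr0 subrr].
Qed.

Lemma an_cont m (f : 'rV[R]_m -> R) x : analytic_at f x -> {for x, continuous f}.
Proof.
move=> /an_centered[r [N [r0 N0 H]]]; apply/cont_ballP => e e0.
have N1 : 0 < N + 1 by rewrite ltr_wpDl.
exists (Num.min r (e * r / (N + 1))) => [|y]; first by rewrite lt_min r0 divr_gt0 ?mulr_gt0.
rewrite lt_min => /andP[yr ye].
have t01 : 0 <= `|y - x| / r <= 1.
  by rewrite divr_ge0 ?(ltW r0)//= ler_pdivrMr// mul1r ltW.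
have := repr_bound (h := y - x) (H _ t01); rewrite divfK ?gt_eqF// addrCA subrr addr0.
move=> /(_ (lexx _))/le_lt_trans; apply.
rewrite mulrAC ltr_pdivrMr//; rewrite ltr_pdivlMr// in ye.
by apply: le_lt_trans ye; rewrite ler_wpM2l// lerDl.
Qed.

Lemma an_derive m (f : 'rV[R]_m -> R) x i : analytic_at f x ->
  (\forall y \near x, derivable f y (delta_mx 0 i)) /\ analytic_at ('D_(delta_mx 0 i) f) x.
Proof.
move=> [r [N [r0 [c H]]]]; have [g [gR gD _]] := reprc_derive i r0 H.
have r4 : 0 < r / 4 by rewrite divr_gt0.
have D y : `|y - x| < r / 4 -> is_derive y (delta_mx 0 i) f (g (y - x)).
  move=> /gD/is_derive_translate; by rewrite addrCA subrr addr0.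
split; first by apply/near_ballP; exists (r / 4) => // y /D[].
have r8 : 0 < r / 8 by rewrite divr_gt0.
exists (r / 8), (N / (r / 4)); split=> //.
have rr : r / 8 < r / 4 by move: (r) r0 => a a0; lra.
apply: repr_ext (repr_rad (ltW r8) (ltW rr) gR) => h hr.
have [|_ ->] := D (x + h); last by rewrite addrAC subrr add0r.
by rewrite addrAC subrr add0r (le_lt_trans hr).
Qed.

Lemma an_comp m p (f : 'rV[R]_p -> R) (g : 'rV[R]_m -> 'rV[R]_p) x :
  analytic_at f (g x) -> (forall j, analytic_at (fun y => g y 0 j) x) -> analytic_at (fun y => f (g y)) x.
Proof.
move=> [r [N [r0 H]]] Hg.
have [j|j d d' d'0 dd'|rho rho0 Hrho] := @common_radius R _
    (fun j d => srepr d r (fun h => (g (x + h) - g x) 0 j)).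
- have [r' [N' [r'0 N'0 H']]] := an_centered (Hg j).
  have N1 : 0 < N' + 1 by rewrite ltr_wpDl.
  (* With this scale t N' <= r, so the centred inner map fits into the ball where the outer series
     converges. *)
  pose t := Num.min 1 (r / (N' + 1)).
  have t0 : 0 < t by rewrite lt_min ltr01 divr_gt0.
  exists (t * r'); first by rewrite mulr_gt0.
  have := H' t; rewrite (ltW t0) ge_min lexx => /(_ isT) Ht.
  apply: (@repr_le _ _ _ (t * N')).
    apply: (@le_trans _ _ (r / (N' + 1) * N')).
      by rewrite ler_wpM2r// ge_min lexx orbT.
    by rewrite mulrAC ler_pdivrMr// ler_wpM2l ?(ltW r0)// lerDl.
  by apply: repr_ext Ht => h _; rewrite mxBE.
- exact: repr_rad (ltW d'0) dd'.
exists rho, N; split=> //.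
apply: repr_ext (repr_comp (y := fun h => g (x + h) - g x) rho0 (ltW r0) H Hrho) => h _.
by rewrite addrCA subrr addr0.
Qed.

(* As [c] starts in degree 2, such a [phi] contracts small balls. *)
Definition flatrepr m (r N : R) (phi : 'rV[R]_m -> R) : Prop :=
  exists2 c, (forall s, (size s <= 1)%N -> c s = 0) & reprc c r N phi.

Lemma flatrepr_remainder m c (r N : R) (phi : 'rV[R]_m -> R) : 0 <= r -> reprc c r N phi ->
  flatrepr r N (fun h => phi h - c [::] - \sum_i h 0 i * c [:: i]).
Proof.
move=> r0 [H1 H2]; pose c' s := if (size s <= 1)%N then 0 else c s.
exists c' => [s ss|]; first by rewrite /c' ss.
split=> [D|h hr].
  by apply: le_trans (H1 D); apply: ler_pnorm => // s; rewrite /c'; case: ifP; rewrite ?normr0.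
(* Two terms more, so that the truncation certainly contains degrees 0 and 1. *)
have E D : psum c D.+2 h - c [::] - \sum_i h 0 i * c [:: i] = psum c' D.+2 h.
  rewrite /psum !(big_ord_recl D.+1) !(big_ord_recl D) /= /mono big_nil mulr1.
  rewrite /c' /= mul0r add0r [in RHS]big1 ?add0r => [|i _]; last by rewrite mul0r.
  set A := \sum_(i < m) c [:: i] * _; set B := \sum_(i < m) h 0 i * _.
  have -> : A = B by apply: eq_bigr => i _; rewrite big_seq1 mulrC.
  by move: B => B'; ring.
rewrite -(cvg_shiftn 2) (_ : [sequence _]_n = (fun D => psum c (D + 2)%N h - c [::] - \sum_i h 0 i * c [:: i])).
  apply: cvgB; last exact: cvg_cst.
  apply: cvgB; last exact: cvg_cst.
  by rewrite (cvg_shiftn 2 (fun D => psum c D h)); exact: H2.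
by apply/funext => D; rewrite /= addn2 E.
Qed.

Lemma flatrepr_sum m (I : Type) (l : seq I) (a N : I -> R) (F : I -> 'rV[R]_m -> R) r :
  0 <= r -> (forall j, flatrepr r (N j) (F j)) ->
  flatrepr r (\sum_(j <- l) `|a j| * N j) (fun h => \sum_(j <- l) a j * F j h).
Proof.
move=> r0 H; elim: l => [|j l [c c0 IH]].
  exists (fun=> 0) => //; rewrite big_nil; apply: (@reprc_eventually _ _ _ _ _ _ 0%N) => //.
    move=> D _; rewrite /pnorm big1// => d _; rewrite /cnorm (_ : wsum _ _ = 0) ?mul0r//.
    by rewrite -[RHS](wsum0 (m := m) d); apply: eq_wsum => s _; rewrite normr0.
  move=> D h _; rewrite big_nil /psum big1// => d _.
  by rewrite -[RHS](wsum0 (m := m) d); apply: eq_wsum => s _; rewrite mul0r.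
have [cj cj0 Hj] := H j; exists (fun s => a j * cj s + c s).
  by move=> s ss; rewrite cj0// c0// mulr0 addr0.
rewrite big_cons; apply: reprc_ext (reprcD r0 (reprcZ (a j) Hj) IH) => h _.
by rewrite big_cons.
Qed.

Lemma flatrepr_at0 m (r N : R) (phi : 'rV[R]_m -> R) : 0 <= r -> flatrepr r N phi -> phi 0 = 0.
Proof. by move=> r0 [c c0 H]; rewrite (reprc_at0 r0 H) c0. Qed.

(** Since the series starts in degree 2, its formal derivative has size O(t) on the ball scaled by
    [t]. The constant 4 bounds (d + 2) / 2^d, from d + 2 <= 2^(d + 2) and t <= 1/2. *)
Lemma flatrepr_comp_diff m p (rho r0 N t delta : R) (y y' : 'rV[R]_m -> 'rV[R]_p) (phi : 'rV[R]_p -> R) :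
  0 < rho -> 0 < r0 -> 0 <= t <= 2^-1 -> 0 <= delta -> flatrepr r0 N phi ->
  (forall j, srepr rho (t * r0) (fun h => y h 0 j)) ->
  (forall j, srepr rho (t * r0) (fun h => y' h 0 j)) ->
  (forall j, srepr rho delta (fun h => y h 0 j - y' h 0 j)) ->
  srepr rho (delta * (4 * t * N / r0)) (fun h => phi (y h) - phi (y' h)).
Proof.
move=> rho0 r00 /andP[t0 t2] d0 [c c0 H] Hy Hy' Hd.
have tr0 : 0 <= t * r0 by rewrite mulr_ge0// ltW.
have trr : t * r0 <= r0 by rewrite ler_piMl ?(ltW r00)// (le_trans t2)// invf_le1// ler1n.
have H' := reprc_rad tr0 trr H.
apply: (reprc_comp_diff rho0 tr0 d0 H' _ Hy Hy' Hd) => D.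
have [H1 _] := H.
apply: (@le_trans _ _ (pnorm r0 c D * (4 * t / r0))); last first.
  rewrite mulrC [leRHS](_ : _ = 4 * t / r0 * N); last by ring.
  by rewrite ler_wpM2l// divr_ge0 ?mulr_ge0 ?(ltW r00).
rewrite /pnorm mulr_suml; apply: ler_sum => -[d dD] _ /=.
rewrite -mulrA; case: d {dD} => [|[|d]].
- by rewrite /cnorm /= c0// normr0 !mul0r.
- rewrite {1 2}/cnorm (_ : wsum 1 _ = 0) ?mul0r// -[RHS](wsum0 (m := p) 1).
  by apply: eq_wsum => s ss; rewrite c0 ?ss// normr0.
rewrite ler_wpM2l ?cnorm_ge0//= exprMn.
have -> : r0 ^+ d.+2 * (4 * t / r0) = r0 ^+ d.+1 * (4 * t).
  by rewrite exprSr -!mulrA; congr (_ * _); rewrite mulrC -!mulrA mulVf ?mulr1// gt_eqF.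
have -> : d.+2%:R * (t ^+ d.+1 * r0 ^+ d.+1) = r0 ^+ d.+1 * (t * (d.+2%:R * t ^+ d)).
  by rewrite (exprS t); ring.
rewrite (mulrC 4) ler_wpM2l ?exprn_ge0 ?(ltW r00)// ler_wpM2l//.
apply: (@le_trans _ _ (d.+2%:R * 2^-1 ^+ d)).
  by rewrite ler_wpM2l// lerXn2r ?nnegrE ?invr_ge0.
rewrite exprVn ler_pdivrMr ?exprn_gt0//.
by have := @natr_le_expr R 2 d.+2 isT; rewrite !exprS !mulrA -natrM.
Qed.

Lemma repr_linear m (I : Type) (l : seq I) (a : I -> R) (e : I -> 'I_m) (r : R) : 0 <= r ->
  srepr r ((\sum_(j <- l) `|a j|) * r) (fun h => \sum_(j <- l) h 0 (e j) * a j).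
Proof.
move=> r0; elim: l => [|j l IH].
  rewrite big_nil mul0r; apply: (@repr_le _ _ _ `|0 : R|); first by rewrite normr0.
  by apply: repr_ext (repr_cst 0 r0) => h _; rewrite big_nil.
rewrite big_cons mulrDl.
apply: repr_ext (reprD r0 (reprZ (a j) (repr_coord (e j) r0)) IH) => h _.
by rewrite big_cons mulrC.
Qed.

(** The equation psi x = z0 + h reads k = h J^-1 + E k for k = x - x0, with [E] flat. The iterates
    must not only converge as power series: their limit has to be the given [g], which is known to
    be continuous only. *)
Lemma an_inverse m (psi g : 'rV[R]_m -> 'rV[R]_m) z0 :
  (forall j, analytic_at (fun x => psi x 0 j) (g z0)) -> {for z0, continuous g} ->
  (\forall z \near z0, psi (g z) = z) -> jac psi (g z0) \in unitmx ->
  forall i, analytic_at (fun z => g z 0 i) z0.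
Proof.
move=> Hpsi /cont_ballP cg nearpsi; set x0 := g z0; set J := jac psi x0 => uJ.
have psi0 : psi x0 = z0 by exact: nbhs_singleton nearpsi.
have [d0 d00 psig] := (near_ballP _ _).1 nearpsi.
have [j|j d d' d'0 dd' [N [c H]]|r0 r00 Hr0] := @common_radius R _
   (fun j d => exists N c, reprc c d N (fun h => psi (x0 + h) 0 j)).
- by have [r [N [r0 [c H]]]] := Hpsi j; exists r => //; exists N, c.
- by exists N, c; exact: reprc_rad (ltW d'0) dd' H.
have [N_ /choice[c_ cP]] := choice Hr0.
have c0E j : c_ j [::] = z0 0 j by rewrite -(reprc_at0 (ltW r00) (cP j)) addr0 psi0.
have c1E j i : c_ j [:: i] = J i j.
  have [gg [_ gD <-]] := reprc_derive i r00 (cP j).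
  have := gD 0; rewrite normr0 divr_gt0// => /(_ isT) D0.
  have := (is_derive_translate (fun y => psi y 0 j) x0 0 _ _).1 D0.
  by rewrite addr0 => -[_ <-]; rewrite mxE.
pose Ji := invmx J.
pose nn j h := psi (x0 + h) 0 j - z0 0 j - (h *m J) 0 j.
have nnR j : flatrepr r0 (N_ j) (nn j).
  have [c cflat cR] := flatrepr_remainder (ltW r00) (cP j).
  exists c => //; apply: reprc_ext cR => h _; rewrite /nn c0E mxE; congr (_ - _).
  by apply: eq_bigr => i _; rewrite c1E.
pose ee i h := \sum_j - Ji j i * nn j h.
pose M_ i := \sum_j `|- Ji j i| * N_ j.
have eeR i : flatrepr r0 (M_ i) (ee i) by exact: flatrepr_sum (ltW r00) nnR.
have M0 i : 0 <= M_ i by have [c _ /reprc_ge0] := eeR i.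
pose M := \sum_i M_ i.
have MM i : M_ i <= M by rewrite /M (bigD1 i)//= lerDl sumr_ge0.
have M1 : 0 < 8 * (M + 1) by rewrite mulr_gt0// ltr_wpDl// sumr_ge0.
pose E h : 'rV[R]_m := \row_i ee i h.
have EE h : E h = - ((psi (x0 + h) - z0 - h *m J) *m Ji).
  apply/rowP => i; rewrite !mxE -sumrN; apply: eq_bigr => j _.
  by rewrite /nn mulNr mulrC !mxE.
have E0 : E 0 = 0 by apply/rowP => i; rewrite !mxE; exact: flatrepr_at0 (ltW r00) (eeR i).
(* Chosen so that the Lipschitz factor 4 t M / r0 of each component of [E] is at most 1/2. *)
pose t := Num.min 2^-1 (r0 / (8 * (M + 1))).
have t0 : 0 < t by rewrite lt_min invr_gt0 ltr0n divr_gt0.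
have t2 : 0 <= t <= 2^-1 by rewrite (ltW t0)/= ge_min lexx.
have tM i : 4 * t * M_ i / r0 <= 2^-1.
  rewrite ler_pdivrMr//.
  have tle : t <= r0 / (8 * (M + 1)) by rewrite ge_min lexx orbT.
  rewrite ler_pdivlMr// in tle.
  have : t * M_ i <= t * M by rewrite ler_wpM2l// ltW.
  rewrite mulrCA mulrDr mulr1 in tle; move: tle (ltW t0).
  by rewrite -mulrA; move: (t * M_ i) (t * M) => a b; lra.
pose r := t * r0; have r_gt0 : 0 < r by rewrite mulr_gt0.
have diffR rho delta (y y' : 'rV[R]_m -> 'rV[R]_m) i : 0 < rho -> 0 <= delta ->
    (forall j, srepr rho r (fun h => y h 0 j)) ->
    (forall j, srepr rho r (fun h => y' h 0 j)) ->
    (forall j, srepr rho delta (fun h => y h 0 j - y' h 0 j)) ->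
    srepr rho (delta / 2) (fun h => ee i (y h) - ee i (y' h)).
  move=> rho0 del0 Hy Hy' Hd.
  have := flatrepr_comp_diff rho0 r00 t2 del0 (eeR i) Hy Hy' Hd.
  by apply: repr_le; rewrite ler_wpM2l.
(* The pointwise contraction is the coefficient estimate applied to constant maps. *)
have lipE u v : `|u| <= r -> `|v| <= r -> `|E u - E v| <= `|u - v| / 2.
  move=> ur vr; apply: rV_norm_le => [|i]; first by rewrite divr_ge0.
  have cR (w : 'rV[R]_m) j B : `|w| <= B -> srepr 1 B (fun h : 'rV[R]_m => w 0 j).
    by move=> wB; apply: repr_le (repr_cst _ ler01); exact: le_trans (rV_coord_le _ _) wB.
  have := @diffR 1 `|u - v| (fun=> u) (fun=> v) i ltr01 (normr_ge0 _) (fun j => cR u j r ur) (fun j => cR v j r vr).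
  move=> /(_ _)/wrap[j|]; first by have := cR (u - v) j _ (lexx _); apply: repr_ext => h _; rewrite mxBE.
  by move=> /(repr_bound (h := 0)); rewrite normr0 !mxE; apply.
pose CC := \sum_i \sum_j `|Ji j i|.
have CC0 : 0 <= CC by apply: sumr_ge0 => i _; exact: sumr_ge0.
have CCi k : \sum_j `|Ji j k| <= CC.
  by rewrite /CC [leRHS](bigD1 k)//= lerDl sumr_ge0// => *; exact: sumr_ge0.
have [d1 d10 cgP] := cg _ r_gt0.
(* The three bounds keep psi (g z) = z valid, keep [g] within [r] of [x0], and give the linear part
   norm at most r / 2, which leaves r / 2 for [E]. *)
pose rho := Num.min (Num.min (d0 / 2) (d1 / 2)) (r / (2 * (CC + 1))).
have rho0 : 0 < rho.
  by rewrite !lt_min !divr_gt0// mulr_gt0// ltr_wpDl.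
have linR i : srepr rho (r / 2) (fun h => (h *m Ji) 0 i).
  have := @repr_linear m _ (index_enum 'I_m) (fun j => Ji j i) id rho (ltW rho0).
  move=> H; have {}H : srepr rho (r / 2) (fun h => \sum_(j <- index_enum 'I_m) h 0 j * Ji j i).
    apply: repr_le H; apply: (@le_trans _ _ (CC * rho)).
      by rewrite ler_wpM2r ?(ltW rho0).
    have : rho <= r / (2 * (CC + 1)) by rewrite ge_min lexx orbT.
    rewrite ler_pdivlMr ?mulr_gt0 ?ltr_wpDl// => H'.
    rewrite ler_pdivlMr//; apply: le_trans H'.
    by move: (ltW rho0); move: (rho) CC0 => a ?; nra.
  by apply: repr_ext H => h _; rewrite mxE.
pose Y k (h : 'rV[R]_m) : 'rV[R]_m := iter k (fun x => h *m Ji + E x) 0.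
have Y0 h : Y 0%N h = 0 by [].
have YS k h : Y k.+1 h = h *m Ji + E (Y k h) by [].
clearbody Y.
have YR k : (forall j, srepr rho r (fun h => Y k h 0 j)) /\
    (forall j, srepr rho (r / 2 ^+ k.+1) (fun h => Y k.+1 h 0 j - Y k h 0 j)).
  elim: k => [|k [IH1 IH2]].
    split=> j.
      apply: (@repr_le _ _ _ `|0 : R|); first by rewrite normr0 ltW.
      by apply: repr_ext (repr_cst 0 (ltW rho0)) => h _; rewrite Y0 mxE.
    by rewrite expr1; apply: repr_ext (linR j) => h _; rewrite YS Y0 E0 addr0 [X in _ = _ - X]mxE subr0.
  have Y1 j : srepr rho r (fun h => Y k.+1 h 0 j).
    have H : srepr rho (r / 2) (fun h => ee j (Y k h) - ee j 0).
      apply: (diffR rho r (Y k) (fun=> 0)) => //; first exact: ltW.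
        move=> j'; apply: (@repr_le _ _ _ `|0 : R|); first by rewrite normr0 ltW.
        by apply: repr_ext (repr_cst 0 (ltW rho0)) => h _; rewrite mxE.
      by move=> j'; apply: repr_ext (IH1 j') => h _; rewrite mxE subr0.
    rewrite [r]splitr; apply: repr_ext (reprD (ltW rho0) (linR j) H) => h _.
    have E0j : ee j 0 = 0 by move/rowP: E0 => /(_ j); rewrite !mxE.
    by rewrite E0j subr0 YS [RHS]mxE [E _ 0 j]mxE.
  split=> // j.
  have := diffR rho (r / 2 ^+ k.+1) (Y k.+1) (Y k) j rho0 _ Y1 IH1 IH2.
  move=> /(_ _)/wrap[|]; first by rewrite divr_ge0 ?exprn_ge0 ?(ltW r_gt0).
  rewrite -mulrA -invfM -exprSr; apply: repr_ext => h _.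
  rewrite (YS k.+1 h) [in X in _ = _ - X](YS k h) ![(_ + E _) 0 j]mxE opprD addrACA subrr add0r.
  by rewrite ![E _ 0 j]mxE.
move=> i.
have near_w h : `|h| <= rho -> psi (g (z0 + h)) = z0 + h /\ `|g (z0 + h) - x0| <= r.
  move=> hr; have zh : z0 + h - z0 = h by rewrite addrAC subrr add0r.
  have hd0 : `|h| < d0.
    by apply: (le_lt_trans hr); rewrite !gt_min ltr_pdivrMr// ltr_pMr// ltr1n.
  have hd1 : `|h| < d1.
    have half : d1 / 2 < d1 by rewrite ltr_pdivrMr// ltr_pMr// ltr1n.
    by apply: (le_lt_trans hr); rewrite !gt_min half orbT.
  by split; [apply: psig; rewrite zh|apply/ltW/cgP; rewrite zh].
have xE h : `|h| <= rho -> g (z0 + h) - x0 = h *m Ji + E (g (z0 + h) - x0).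
  move=> /near_w[pE _].
  have E1 : x0 + (g (z0 + h) - x0) = g (z0 + h) by rewrite addrC subrK.
  have E2 : z0 + h - z0 = h by rewrite addrAC subrr add0r.
  rewrite EE E1 pE E2; move: (g (z0 + h) - x0) => X.
  by rewrite mulmxBl mulmxK// opprB addrCA subrr addr0.
(* The given inverse solves the same fixed point equation, so the iterates approach it
   geometrically; this identifies the limit with [g]. *)
have approx k h : `|h| <= rho -> `|g (z0 + h) - x0 - Y k h| <= r / 2 ^+ k.
  move=> hr; have [_ gr] := near_w h hr; elim: k => [|k IH].
    by rewrite Y0 subr0 divr1.
  rewrite {1}(xE h hr) YS opprD addrACA subrr add0r.
  have [/(repr_rV_bound (ltW r_gt0))/(_ hr) Yr _] := YR k.
  rewrite (le_trans (lipE _ _ gr Yr))// exprSr invfM mulrA ler_pM2r ?invr_gt0//.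
(* The telescoping series of successive differences has norms r / 2^(k+1), of total at most [r], so
   completeness applies. *)
have H : srepr rho r (fun h => (g (z0 + h) - x0) 0 i).
  apply: (@repr_series _ _ _ _ (fun k h => Y k.+1 h 0 i - Y k h 0 i) (fun k => r / 2 ^+ k.+1)) => //.
  - by move=> k; have [_] := YR k.
  - move=> K; suff -> : \sum_(k < K) r / 2 ^+ k.+1 = r * (1 - 2^-1 ^+ K).
      by rewrite ler_piMr ?(ltW r_gt0)// gerBl exprn_ge0.
    elim: K => [|K IH]; first by rewrite big_ord0 expr0 subrr mulr0.
    by rewrite big_ord_recr /= IH -exprVn exprSr; field.
  - move=> h hr; rewrite (_ : (fun K => _) = (fun K => Y K h 0 i)); last first.
      apply/funext => K; rewrite -(big_mkord xpredT (fun k => Y k.+1 h 0 i - Y k h 0 i)).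
      by rewrite telescope_sumr// Y0 mxE subr0.
    apply/cvgrPdist_le => e e0.
    have : (fun k : nat => r * 2^-1 ^+ k) @ \oo --> r * 0.
      apply: cvgM; first exact: cvg_cst.
      by apply: cvg_expr; rewrite ger0_norm// invf_lt1// ltr1n.
    rewrite mulr0 => /cvgrPdist_le/(_ e e0); apply: filterS => k.
    rewrite sub0r normrN ger0_norm; last first.
      by apply: mulr_ge0; [exact: ltW|rewrite exprn_ge0// invr_ge0].
    move=> re; apply: le_trans re.
    have H' := rV_coord_le (g (z0 + h) - x0 - Y k h) i.
    rewrite (mxBE (g (z0 + h) - x0)) in H'; apply: le_trans H' _.
    by rewrite exprVn approx.
have H' := reprD (ltW rho0) H (repr_cst (x0 0 i) (ltW rho0)).
exists rho, (r + `|x0 0 i|); apply: (conj rho0).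
by apply: repr_ext H' => h _; rewrite mxBE subrK.
Qed.

End Analytic.

(** * Regularity of graphs *)

Section RegularityClasses.
Context {R : realType}.
Implicit Types (m k : nat) (r : regularity).

Definition creg m r (al : R) (V : set 'rV[R]_m) (f : 'rV[R]_m -> R) : Prop :=
  match r with
  | Ck k => Creg k al V f
  | Cinf => forall k, Creg k 0 V f
  | Comega => forall x, V x -> analytic_at f x
  end.

Definition at_least_C1 r : Prop := if r is Ck 0 then False else True.

(** Class of the gradient. The condition [at_least_C1 (predr r)] thus says that gradients are C^1,
    so that they can be composed and inverted within their class. *)
Definition predr r := if r is Ck k then Ck k.-1 else r.

Lemma creg_ext m r al (V : set 'rV[R]_m) f g : open V ->
  (forall x, V x -> f x = g x) -> creg r al V f -> creg r al V g.
Proof.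
move=> oV fg; case: r => [k||] /=; first exact: Creg_ext.
  by move=> H k; exact: Creg_ext (H k).
by move=> H x Vx; apply: an_near (H x Vx); exact: open_near fg.
Qed.

Lemma creg_sub m r al (V W : set 'rV[R]_m) f : W `<=` V -> creg r al V f -> creg r al W f.
Proof.
move=> WV; case: r => [k||] /=; first exact: Creg_sub.
  by move=> H k; exact: Creg_sub (H k).
by move=> H x /WV/H.
Qed.

Lemma creg_cst m r al (V : set 'rV[R]_m) c : open V -> creg r al V (fun=> c).
Proof.
move=> oV; case: r => [k||] /=; first exact: Creg_cst.
  by move=> k; exact: Creg_cst.
by move=> x _; exact: an_cst.
Qed.

Lemma creg_coord m r al (V : set 'rV[R]_m) j : open V -> al <= 1 -> creg r al V (fun x => x 0 j).
Proof.
move=> oV al1; case: r => [k||] /=; first exact: Creg_coord.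
  by move=> k; exact: Creg_coord.
by move=> x _; exact: an_coord.
Qed.

Lemma cregD m r al (V : set 'rV[R]_m) f g : open V -> creg r al V f -> creg r al V g ->
  creg r al V (fun x => f x + g x).
Proof.
move=> oV; case: r => [k||] /=; first exact: CregD.
  by move=> Hf Hg k; exact: CregD.
by move=> Hf Hg x Vx; apply: anD; [exact: Hf|exact: Hg].
Qed.

Lemma cregZ m r al (V : set 'rV[R]_m) a f : open V -> al <= 1 -> creg r al V f ->
  creg r al V (fun x => a * f x).
Proof.
move=> oV al1; case: r => [k||] /=.
- by move=> H; apply: CregM => //; exact: Creg_cst.
- by move=> H k; apply: CregM => //; exact: Creg_cst.
- by move=> H x Vx; apply: anZ; exact: H.
Qed.

Lemma cregB m r al (V : set 'rV[R]_m) f g : open V -> al <= 1 -> creg r al V f -> creg r al V g ->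
  creg r al V (fun x => f x - g x).
Proof.
move=> oV al1 Hf Hg.
have H := cregD oV Hf (cregZ (-1) oV al1 Hg).
by apply: creg_ext H => // x _; rewrite mulN1r.
Qed.

Lemma creg_sum m r al (V : set 'rV[R]_m) (I : Type) (l : seq I) (F : I -> 'rV[R]_m -> R) :
  open V -> (forall i, creg r al V (F i)) ->
  creg r al V (fun x => \sum_(i <- l) F i x).
Proof.
move=> oV H; elim: l => [|i l IH].
  by apply: creg_ext (creg_cst _ _ 0 oV) => // x _; rewrite big_nil.
by apply: creg_ext (cregD oV (H i) IH) => // x _; rewrite big_cons.
Qed.

Lemma creg_mulmx m p q r al (V : set 'rV[R]_m) (g : 'rV[R]_m -> 'rV[R]_p) (M : 'M[R]_(p, q)) j :
  open V -> al <= 1 -> (forall i, creg r al V (fun x => g x 0 i)) ->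
  creg r al V (fun x => (g x *m M) 0 j).
Proof.
move=> oV al1 H.
have H' : creg r al V (fun x => \sum_(i <- index_enum 'I_p) M i j * g x 0 i).
  by apply: creg_sum => // i; exact: cregZ.
by apply: creg_ext H' => // x _; rewrite mxE; apply: eq_bigr => i _; rewrite mulrC.
Qed.

Lemma creg_C1 m r al (V : set 'rV[R]_m) f : open V -> al <= 1 -> at_least_C1 r -> creg r al V f ->
  Creg 1 0 V f.
Proof.
move=> oV al1; case: r => [[//|k]||] /= _ H.
- have H1 := @Creg_le _ m k.+1 1 al V f oV al1 isT H.
  exact: (@Creg_al0 _ _ 1%N _ _ _ H1).
- exact: (H 1%N).
split=> [x /H/an_cont//|i]; split=> [x /H/(an_derive i)[D _]|].
  exact: nbhs_singleton D.
by move=> x /H/(an_derive i)[_ /an_cont C]; split=> //; rewrite ltxx.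
Qed.

Lemma creg_cont m r al (V : set 'rV[R]_m) f x : creg r al V f -> V x -> {for x, continuous f}.
Proof.
case: r => [k||] /= H Vx; first exact: Creg_cont H Vx.
  exact: Creg_cont (H 0%N) Vx.
exact: an_cont (H _ Vx).
Qed.

Lemma creg_derive m r al (V : set 'rV[R]_m) f i : at_least_C1 r -> creg r al V f ->
  creg (predr r) al V ('D_(delta_mx 0 i) f).
Proof.
case: r => [[//|k]||] /= _ H; first by have [_ /(_ i)[]] := H.
  by move=> k; have [_ /(_ i)[]] := H k.+1.
by move=> x /H/(an_derive i)[].
Qed.

Lemma creg_comp m p r al (V : set 'rV[R]_m) (W : set 'rV[R]_p) f (g : 'rV[R]_m -> 'rV[R]_p) :
  open V -> open W -> al <= 1 -> at_least_C1 r -> (forall x, V x -> W (g x)) -> creg r al W f ->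
  (forall j, creg r al V (fun x => g x 0 j)) ->
  creg r al V (fun x => f (g x)).
Proof.
move=> oV oW al1 gr VW Hf Hg.
have g1 j := creg_C1 oV al1 gr (Hg j).
case: r gr Hf Hg => [k||] /= _ Hf Hg; first exact: (Creg_comp oV oW).
  by move=> k; apply: (Creg_comp oV oW).
by move=> x Vx; apply: an_comp => [|j]; [apply: Hf; exact: VW|exact: Hg].
Qed.

Lemma creg_inverse m r al (V W : set 'rV[R]_m) (psi g : 'rV[R]_m -> 'rV[R]_m) :
  open V -> open W -> al <= 1 -> at_least_C1 r -> (forall x, V x -> W (g x)) ->
  (forall x, V x -> {for x, continuous g}) -> (forall x, V x -> psi (g x) = x) ->
  (forall x, V x -> jac psi (g x) \in unitmx) ->
  (forall j, creg r al W (fun x => psi x 0 j)) ->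
  forall j, creg r al V (fun x => g x 0 j).
Proof.
move=> oV oW al1 gr VW cg psig uJ H j.
case: r gr H => [[//|k]||] /= _ H.
- exact: (Creg_inverse oV oW al1 VW cg psig uJ H).
- move=> k; apply: (@Creg_down _ _ _ 0) => //.
  by apply: (Creg_inverse oV oW _ VW cg psig uJ).
- move=> x Vx; apply: (@an_inverse _ _ psi); [|exact: cg| |exact: uJ].
    by move=> j'; apply: H; exact: VW.
  exact: open_near psig.
Qed.

End RegularityClasses.

(** * Comparison with the regularity of graphs in the statement *)

Section GraphRegularity.
Context {R : realType}.
Implicit Types (m k : nat) (r : regularity).

(** [pderiv] applies the last index first, while [Creg] differentiates and then recurses; words must
    therefore be peeled from the right. *)
Lemma pderiv_rcons m (s : seq 'I_m) i (f : 'rV[R]_m -> R) :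
  pderiv (rcons s i) f = pderiv s ('D_(delta_mx 0 i) f).
Proof. by elim: s => //= j s ->. Qed.

Lemma within_open_cont m (V : set 'rV[R]_m) (f : 'rV[R]_m -> R) : open V ->
  {within V, continuous f} <-> forall x, V x -> {for x, continuous f}.
Proof.
move=> oV; rewrite continuous_open_subspace//; split=> H x.
  by move=> Vx; apply: H; rewrite inE.
by rewrite inE => /H.
Qed.

Lemma smooth_Creg m k al (V : set 'rV[R]_m) f : open V -> smooth_k k V f ->
  (0 < al -> forall s : seq 'I_m, size s = k -> holder al V (pderiv s f)) ->
  Creg k al V f.
Proof.
move=> oV; elim: k f => [|k IH] f sf hf.
  have [/(within_open_cont _ oV) cf _] := sf [::] isT.
  move=> x Vx; split; first exact: cf.
  move=> /hf/(_ [::] erefl)[L HL]; have [d d0 dV] := open_ballP oV Vx.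
  by exists L, d; split=> // y z yd zd; apply: HL; exact: dV.
have [/(within_open_cont _ oV) cf df] := sf [::] isT.
split=> // i; split; first by move=> x Vx; exact: df.
apply: IH.
  move=> s sk; rewrite -pderiv_rcons; have := sf (rcons s i); rewrite size_rcons => /(_ sk)[cs ds].
  by split=> // sk' j x Vx; rewrite -pderiv_rcons; exact: ds.
by move=> al0 s ss; rewrite -pderiv_rcons; apply: hf; rewrite ?size_rcons ?ss.
Qed.

Lemma Creg_smooth m k al (V : set 'rV[R]_m) f : open V -> Creg k al V f -> smooth_k k V f.
Proof.
move=> oV; elim: k f => [|k IH] f H s.
  rewrite leqn0 size_eq0 => /eqP->; split=> //; apply/within_open_cont => // x Vx.
  exact: Creg_cont H Vx.
case: (lastP s) => [_|s' i].
  split; first by apply/within_open_cont => // x Vx; exact: Creg_cont H Vx.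
  by move=> _ i x Vx /=; have [_ /(_ i)[+ _]] := H; apply.
rewrite size_rcons ltnS => sk; rewrite pderiv_rcons.
by have [_ /(_ i)[_ /IH/(_ s' sk)]] := H.
Qed.

(** Near [x] the local Hölder bounds become uniform ones, on a single ball for the finitely many
    words of length [k]. *)
Lemma Creg_holder m k al (V : set 'rV[R]_m) f x : 0 < al -> V x -> Creg k al V f ->
  exists2 d : R, 0 < d & forall (s : seq 'I_m) (W : set 'rV[R]_m), size s = k ->
    W `<=` [set y | `|y - x| < d] -> holder al W (pderiv s f).
Proof.
move=> al0 Vx; elim: k f => [|k IH] f H.
  have [_ /(_ al0)[L [d [d0 HL]]]] := H x Vx.
  exists d => // s W /size0nil -> WS; exists L => y z /WS yW /WS zW.
  exact: HL.
have [i|i d d' d'0 dd' + s W ss WS|d d0 Hd] := @common_radius R _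
   (fun i d => forall (s : seq 'I_m) (W : set 'rV[R]_m), size s = k ->
    W `<=` [set y | `|y - x| < d] -> holder al W (pderiv s ('D_(delta_mx 0 i) f))).
- by have [_ /(_ i)[_ /IH]] := H.
- by apply=> // y /WS yx; apply: lt_le_trans dd'.
exists d => // s W; case: (lastP s) => // s' i; rewrite size_rcons => -[ss] WS.
by rewrite pderiv_rcons; exact: Hd.
Qed.

Lemma analytic_on_an m (V : set 'rV[R]_m) (f : 'rV[R]_m -> R) x : open V -> V x ->
  analytic_on V f -> analytic_at f x.
Proof.
move=> oV Vx /(_ x Vx)[r r0 [c cP]]; have [d d0 dV] := open_ballP oV Vx.
pose rho := Num.min (r / 2) (d / 2).
have rho0 : 0 < rho by rewrite lt_min !divr_gt0.
have half (e : R) : 0 < e -> e / 2 < e by move=> ?; rewrite ltr_pdivrMr// ltr_pMr// ltr1n.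
have rhor : rho < r by rewrite gt_min half.
have rhod : rho < d by rewrite gt_min orbC half.
pose c' (s : seq 'I_m) := c (size s) (in_tuple s).
have c'E k (t : k.-tuple 'I_m) : c' t = c k t.
  case: t => s ss; rewrite /c' /=; have /eqP E := ss; subst k.
  by congr c; apply: val_inj.
have crho : `|const_mx rho : 'rV[R]_m| <= rho.
  by apply: rV_norm_le => [|i]; rewrite ?mxE ?gtr0_norm// ltW.
(* At this corner every coordinate of the displacement equals [rho], so absolute convergence there
   is exactly boundedness of the weighted norm. *)
have [||A _] := cP (x + const_mx rho).
- by apply: dV; rewrite addrAC subrr add0r; apply: le_lt_trans rhod.
- by rewrite addrAC subrr add0r; apply: le_lt_trans rhor.
have AE : series (fun k => \sum_(t : k.-tuple 'I_m) `|c k t| * \prod_(j < k) `|(x + const_mx rho - x) 0 (tnth t j)|) =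
   pnorm rho c'.
  apply/funext => D; rewrite seriesEord /pnorm /=; apply: eq_bigr => k _.
  rewrite -wsumZr -wsum_tuple; apply: eq_bigr => t _; rewrite c'E; congr (_ * _).
  rewrite (eq_bigr (fun=> rho)) ?prodr_const ?card_ord// => j _.
  by rewrite addrAC subrr add0r mxE ger0_norm// ltW.
rewrite AE in A.
exists rho, (limn (pnorm rho c')); split=> //; exists c'; split=> [D|h hr].
  apply: (nondecreasing_cvgn_le _ A); apply/nondecreasing_seqP => n.
  by rewrite /pnorm big_ord_recr /= lerDl mulr_ge0 ?cnorm_ge0 ?exprn_ge0// ltW.
have xh : x + h - x = h by rewrite addrAC subrr add0r.
have [||_] := cP (x + h); rewrite ?xh.
- by apply: dV; rewrite xh; exact: le_lt_trans rhod.
- exact: le_lt_trans rhor.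
set S := series _; suff -> : S = (fun D => psum c' D h) by [].
apply/funext => D; rewrite /S seriesEord /psum /=.
apply: eq_bigr => k _; rewrite -wsum_tuple; apply: eq_bigr => t _.
by rewrite c'E /mono [in RHS]big_tuple.
Qed.

Lemma an_analytic_on m (V : set 'rV[R]_m) (f : 'rV[R]_m -> R) :
  (forall x, V x -> analytic_at f x) -> analytic_on V f.
Proof.
move=> H x /H[r [N [r0 [c [H1 H2]]]]]; exists r => //.
exists (fun d t => c (tval t)) => y Vy yr; split; last first.
  have := H2 (y - x) (ltW yr); rewrite addrCA subrr addr0.
  set S := series _; suff -> : S = (fun D => psum c D (y - x)) by [].
  apply/funext => D; rewrite /S seriesEord /psum /=.
  apply: eq_bigr => k _; rewrite -wsum_tuple; apply: eq_bigr => t _.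
  by rewrite /mono [in RHS]big_tuple.
have [|l Hl] := @bounded_series_cvg R (fun d => \sum_(t : d.-tuple 'I_m)
   `|c t| * \prod_(j < d) `|(y - x) 0 (tnth t j)|) (fun d => cnorm c d * r ^+ d) N _ H1.
  move=> d; rewrite ger0_norm; last by apply: sumr_ge0 => t _; rewrite mulr_ge0// prodr_ge0.
  rewrite /cnorm -wsumZr -wsum_tuple; apply: ler_sum => t _; rewrite ler_wpM2l//.
  rewrite -normr_prod -(big_tuple _ _ t xpredT (fun i => (y - x) 0 i)) -{2}(size_tuple t).
  exact: norm_mono_le (ltW yr).
by apply/cvg_ex; exists l; rewrite seriesEord.
Qed.

Lemma graph_reg_creg m r al (V : set 'rV[R]_m) f : open V -> graph_reg r al V f -> creg r al V f.
Proof.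
move=> oV; case: r => [k||] /=.
- by move=> [sf hf]; exact: smooth_Creg.
- by move=> H k; apply: smooth_Creg => //; rewrite ltxx.
- by move=> H x Vx; exact: analytic_on_an H.
Qed.

Lemma creg_graph_reg m r al (V : set 'rV[R]_m) f x : open V -> V x -> creg r al V f ->
  exists2 d : R, 0 < d & forall W : set 'rV[R]_m, open W -> W `<=` [set y | `|y - x| < d] ->
    graph_reg r al W f.
Proof.
move=> oV Vx; have [d d0 dV] := open_ballP oV Vx.
have sub (W : set 'rV[R]_m) : W `<=` [set y | `|y - x| < d] -> W `<=` V by move=> WS y /WS/dV.
case: r => [k||] /= H.
- case: (ltP 0 al) => al0; last first.
    exists d => // W oW /sub WV; split; first by apply: Creg_smooth => //; exact: Creg_sub H.
    by [].
  have [d' d'0 Hd'] := Creg_holder al0 Vx H.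
  exists (Num.min d d') => [|W oW WS]; first by rewrite lt_min d0.
  have [W1 W2] : W `<=` [set y | `|y - x| < d] /\ W `<=` [set y | `|y - x| < d'].
    by split=> y /WS /=; rewrite lt_min => /andP[].
  split; first by apply: Creg_smooth => //; apply: Creg_sub H; exact: sub.
  by move=> _ s ss; exact: Hd'.
- by exists d => // W oW /sub WV k; apply: Creg_smooth => //; exact: Creg_sub (H k).
- by exists d => // W oW /sub WV; apply: an_analytic_on => y /WV/H.
Qed.

End GraphRegularity.

(** * Sums of graphs with matched gradients *)

Section InfConvolution.
Context {R : realType} {m : nat}.
Implicit Types (F G h : 'rV[R]_m -> R) (d : R).

Definition cball d : set 'rV[R]_m := [set y | `|y| < d].

Lemma open_cball d : open (cball d).
Proof.
have -> : cball d = [set y | `|y - 0| < d] by apply/seteqP; split=> y; rewrite /cball /= subr0.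
exact: open_ball0.
Qed.

Definition hess F x : 'M[R]_m := jac (grad F) x.

Lemma gradE F x i : grad F x 0 i = 'D_(delta_mx 0 i) F x.
Proof. by rewrite mxE. Qed.

Lemma creg_grad r al V F j : at_least_C1 r -> open V -> creg r al V F ->
  creg (predr r) al V (fun x => grad F x 0 j).
Proof.
move=> gr oV H; apply: creg_ext (creg_derive j gr H) => // x _.
by rewrite gradE.
Qed.

Lemma unit_near (psi : 'rV[R]_m -> 'rV[R]_m) (V : set 'rV[R]_m) (x : 'rV[R]_m) : open V -> V x ->
  (forall j, Creg 1 0 V (fun x => psi x 0 j)) -> jac psi x \in unitmx ->
  exists2 e : R, 0 < e & forall y, `|y - x| < e -> jac psi y \in unitmx.
Proof.
move=> oV Vx H uJ.
have C : Creg 0 0 V (fun y => \det (jac psi y)).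
  apply: Creg_det => // i j.
  have C : Creg 0 0 V ('D_(delta_mx 0 i) (fun y => psi y 0 j)) by have [_ /(_ i)[_]] := H j.
  by apply: Creg_ext C => // y _; rewrite mxE.
have /cont_ballP := Creg_cont C Vx.
rewrite unitmxE unitfE in uJ.
move=> /(_ `|\det (jac psi x)|); rewrite normr_gt0 => /(_ uJ)[e e0 eP].
exists e => // y /eP; rewrite unitmxE unitfE; apply: contraTneq => ->.
by rewrite sub0r normrN ltxx.
Qed.

(** The maps are built once from the C^2 hypothesis, and their regularity is then stated for every
    class [r]. Here [phi] inverts grad F on the ball of radius [e], and [Th] inverts [Y] on the ball
    of radius [d'']. *)
Lemma sum_parametrization F G d : 0 < d -> Creg 2 0 (cball d) F -> Creg 2 0 (cball d) G ->
  grad F 0 = 0 -> grad G 0 = 0 -> hess F 0 \in unitmx -> hess F 0 + hess G 0 \in unitmx ->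
  exists (e d' d'' : R) (phi X Y Th : 'rV[R]_m -> 'rV[R]_m),
  [/\ 0 < e, 0 < d' & 0 < d''] /\
  [/\ (forall z, `|z| < d' -> [/\ X z + Y z = z, `|X z| < d, `|Y z| < d & grad F (X z) = grad G (Y z)]),
     Y 0 = 0,
     (forall z, `|z| < d' -> `|grad F (X z)| < e /\ X z = phi (grad F (X z))),
     (forall r al, al <= 1 -> at_least_C1 r -> at_least_C1 (predr r) -> creg r al (cball d) F ->
        forall j, creg (predr r) al (cball e) (fun x => phi x 0 j)) &
     (forall y, `|y| < d'' -> [/\ `|Th y| < d', Y (Th y) = y & {for y, continuous Th}])] /\
  ((forall r al, al <= 1 -> at_least_C1 r -> at_least_C1 (predr r) -> creg r al (cball d) F ->
        creg r al (cball d) G ->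
        forall j, creg (predr r) al (cball d') (fun x => Y x 0 j)) /\
     (forall z, `|z| < d' -> jac Y z \in unitmx)).
Proof.
move=> d0 F2 G2 gF0 gG0 uF uFG.
have oB := open_cball.
have B0 e : 0 < e -> cball e 0 by rewrite /cball /= normr0.
have F1 j : Creg 1 0 (cball d) (fun x => grad F x 0 j).
  exact: (@creg_grad (Ck 2) 0 _ _ j I (oB d) F2).
have G1 j : Creg 1 0 (cball d) (fun x => grad G x 0 j).
  exact: (@creg_grad (Ck 2) 0 _ _ j I (oB d) G2).
have [eta eta0 uFn] := unit_near (oB d) (B0 _ d0) F1 uF.
have sF := Creg_sdiff_rV (oB d) (B0 _ d0) F1.
(* The radius bound keeps [phi] inside the ball where the Hessian of [F] remains invertible, so
   [phi] is regular on its whole domain. *)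
have [|r1 [e [phi [[r10 r1le e0] [phiP phiK phiC]]]]] :=
  @inverse_function _ _ (grad F) 0 (hess F 0) (Num.min d eta) uF sF.
  by rewrite lt_min d0.
rewrite le_min in r1le; have /andP[r1d r1eta] := r1le.
rewrite gF0 in phiP phiK phiC.
have {}phiP w : `|w| < e -> `|phi w| < r1 /\ grad F (phi w) = w.
  by move=> we; have := phiP w; rewrite !subr0; apply.
have {}phiK x : `|x| < r1 -> `|grad F x| < e -> phi (grad F x) = x.
  by move=> xr xe; apply: phiK; rewrite subr0.
have {}phiC w : `|w| < e -> {for w, continuous phi} by move=> we; apply: phiC; rewrite subr0.
have phid w : `|w| < e -> `|phi w| < d.
  by move=> /phiP[pr _]; exact: lt_le_trans r1d.
have uphi w : `|w| < e -> hess F (phi w) \in unitmx.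
  by move=> /phiP[pr _]; apply: uFn; rewrite subr0; exact: lt_le_trans r1eta.
have phi_reg r al : al <= 1 -> at_least_C1 r -> at_least_C1 (predr r) -> creg r al (cball d) F ->
        forall j, creg (predr r) al (cball e) (fun x => phi x 0 j).
  move=> al1 gr gr' FC; apply: (@creg_inverse _ _ _ _ (cball e) (cball d) (grad F)) => //.
  - by move=> w we; have [] := phiP w we.
  - by move=> j; exact: creg_grad.
have gGc : {for 0, continuous (grad G)}.
  by apply/cont_rVP => j; exact: Creg_cont (G1 j) (B0 _ d0).
have [d2' d2'0 gGs] : exists2 d2 : R, 0 < d2 & forall y, `|y| < d2 -> `|grad G y| < e.
  have /cont_ballP/(_ e e0)[d2 d20 H] := gGc; exists d2 => // y yd.
  by have := H y; rewrite gG0 !subr0; apply.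
pose d2 := Num.min d d2'; have d20 : 0 < d2 by rewrite lt_min d0.
have gGe y : `|y| < d2 -> `|grad G y| < e by rewrite lt_min => /andP[_]; exact: gGs.
have d2d y : `|y| < d2 -> `|y| < d by rewrite lt_min => /andP[].
pose Th y := y + phi (grad G y).
have Th_reg r al : al <= 1 -> at_least_C1 r -> at_least_C1 (predr r) -> creg r al (cball d) F ->
    creg r al (cball d) G -> forall j, creg (predr r) al (cball d2) (fun x => Th x 0 j).
  move=> al1 gr gr' FC GC j.
  have H : creg (predr r) al (cball d2) (fun x => x 0 j + phi (grad G x) 0 j).
    apply: cregD => //; first exact: creg_coord.
    apply: (@creg_comp _ _ _ _ _ _ (cball e) (fun x => phi x 0 j)) => //; first exact: phi_reg.
    by move=> j'; apply: creg_sub (creg_grad j' gr (oB d) GC) => y; exact: d2d.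
  by apply: creg_ext H => // x _; rewrite mxE.
have Th1 j : Creg 1 0 (cball d2) (fun x => Th x 0 j).
  exact: (Th_reg (Ck 2) 0 ler01 I I F2 G2 j).
have phi0 : phi 0 = 0 by rewrite -[in LHS]gF0 phiK// ?gF0 ?normr0.
have Th0 : Th 0 = 0 by rewrite /Th gG0 phi0 addr0.
have uTh : jac Th 0 \in unitmx.
  have D1 : fdiff phi (grad G 0) (fun v => v *m invmx (hess F 0)).
    rewrite gG0; apply: (@fdiff_inv _ _ (grad F)) => //.
    - by rewrite phi0; exact: sdiff_fdiff.
    - by apply: phiC; rewrite normr0.
    - apply/near_ballP; exists e => // w; rewrite subr0 => we.
      by have [] := phiP w we.
  have D2 : fdiff (grad G) 0 (fun v => v *m hess G 0).
    exact/sdiff_fdiff/(Creg_sdiff_rV (oB d) (B0 _ d0) G1).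
  have [C C0 HC] := mulmx_bound (invmx (hess F 0)).
  have D3 := fdiff_mx_comp HC (fun u v => mulmxBl u v _) D2 D1.
  (* In row convention 1 + Hess G (Hess F)^-1 = (Hess F + Hess G) (Hess F)^-1; this is where
     invertibility of the sum enters. *)
  have D4 : fdiff Th 0 (fun v => v *m (1%:M + hess G 0 *m invmx (hess F 0))).
    move=> ep ep0; have [dd dd0 H] := D3 ep ep0; exists dd => // y yd.
    have := H y yd; rewrite /Th mulmxDr mulmx1 mulmxA.
    suff -> : y + phi (grad G y) - (0 + phi (grad G 0)) - (y - 0 + (y - 0) *m hess G 0 *m invmx (hess F 0)) =
       phi (grad G y) - phi (grad G 0) - (y - 0) *m hess G 0 *m invmx (hess F 0) by [].
    by move: (_ *m invmx _) => A; vring.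
  have [_ ->] := fdiff_jac D4.
  rewrite -(mulmxV uF) -mulmxDl unitmx_mul uFG unitmx_inv//.
have [eta' eta'0 uThn] := unit_near (oB d2) (B0 _ d20) Th1 uTh.
have sTh := Creg_sdiff_rV (oB d2) (B0 _ d20) Th1.
have [|r2 [d3 [Y [[r20 r2le d30] [YP YK YC]]]]] :=
  @inverse_function _ _ Th 0 (jac Th 0) (Num.min d2 eta') uTh sTh.
  by rewrite lt_min d20.
rewrite le_min in r2le; have /andP[r2d r2eta] := r2le.
rewrite Th0 in YP YK YC.
have {}YP w : `|w| < d3 -> `|Y w| < r2 /\ Th (Y w) = w.
  by move=> we; have := YP w; rewrite !subr0; apply.
have {}YK x : `|x| < r2 -> `|Th x| < d3 -> Y (Th x) = x.
  by move=> xr xe; apply: YK; rewrite subr0.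
have {}YC w : `|w| < d3 -> {for w, continuous Y} by move=> we; apply: YC; rewrite subr0.
have Yd w : `|w| < d3 -> `|Y w| < d2 by move=> /YP[pr _]; exact: lt_le_trans r2d.
pose X z := phi (grad G (Y z)).
have /cont_ballP/(_ d3 d30)[d4 d40 Thn] : {for 0, continuous Th}.
  by apply/cont_rVP => j; exact: Creg_cont (Th1 j) (B0 _ d20).
exists e, d3, (Num.min r2 d4), phi, X, Y, Th; split; first by split=> //; rewrite lt_min r20.
split; first split.
- move=> z zd; have [Yr YE] := YP z zd; have gs := gGe _ (Yd _ zd); split.
  + by rewrite addrC.
  + exact: phid.
  + exact/d2d/Yd.
  + by have [] := phiP _ gs.
- by rewrite -[in LHS]Th0 YK// ?Th0 ?normr0.
- move=> z zd; have gs := gGe _ (Yd _ zd); have [_ E] := phiP _ gs.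
  by rewrite /X E.
- exact: phi_reg.
- move=> y; rewrite lt_min => /andP[yr y4].
  have Ty : `|Th y| < d3 by have := Thn y; rewrite Th0 !subr0; apply.
  split; [exact: Ty|exact: YK|].
  apply/cont_rVP => j; apply: Creg_cont (Th1 j) _.
  exact: lt_le_trans r2d.
split.
- move=> r al al1 gr gr' FC GC.
  have uTY z : cball d3 z -> jac Th (Y z) \in unitmx.
    by move=> /YP[Yr _]; apply: uThn; rewrite subr0; exact: lt_le_trans r2eta.
  have ThY z : cball d3 z -> Th (Y z) = z by move=> /YP[].
  exact: (creg_inverse (oB d3) (oB d2) al1 gr' Yd YC ThY uTY (Th_reg r al al1 gr gr' FC GC)).
- move=> z zd; have [Yr YE] := YP z zd.
  have uz : jac Th (Y z) \in unitmx by apply: uThn; rewrite subr0; exact: lt_le_trans r2eta.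
  have DY : fdiff Y z (fun v => v *m invmx (jac Th (Y z))).
    apply: (@fdiff_inv _ _ Th) => //; last first.
      by apply: (open_near (oB d3)) => // w /YP[].
    - exact: YC.
    - exact/sdiff_fdiff/(Creg_sdiff_rV (oB d2) (Yd _ zd) Th1).
  by have [_ ->] := fdiff_jac DY; rewrite unitmx_inv.
Qed.

Lemma sum_regular F G h X Y d d' : Creg 2 0 (cball d) F -> Creg 2 0 (cball d) G ->
  (forall z, `|z| < d' -> [/\ X z + Y z = z, `|X z| < d, `|Y z| < d & grad F (X z) = grad G (Y z)]) ->
  (forall r al, al <= 1 -> at_least_C1 r -> at_least_C1 (predr r) -> creg r al (cball d) F ->
        creg r al (cball d) G ->
        forall j, creg (predr r) al (cball d') (fun x => Y x 0 j)) ->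
  (forall z, `|z| < d' -> h z = F (X z) + G (Y z)) ->
  (forall z, `|z| < d' -> grad h z = grad G (Y z)) /\
  (forall r al, al <= 1 -> at_least_C1 r -> at_least_C1 (predr r) -> creg r al (cball d) F ->
        creg r al (cball d) G -> creg r al (cball d') h).
Proof.
move=> F2 G2 XYP Yreg hE.
have oB := open_cball.
have Y1 j : Creg 1 0 (cball d') (fun x => Y x 0 j).
  exact: (Yreg (Ck 2) 0 ler01 I I F2 G2 j).
have gradh z : `|z| < d' -> (forall i, derivable h z (delta_mx 0 i)) /\ grad h z = grad G (Y z).
  move=> zd; have [XYz Xd Yd gE] := XYP z zd.
  have DY := sdiff_fdiff (Creg_sdiff_rV (oB d') zd Y1).
  have DX : fdiff X z (fun v => v *m (1%:M - jac Y z)).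
    move=> ep ep0; have [dd dd0 H] := DY ep ep0.
    exists (Num.min dd (d' - `|z|)) => [|y]; first by rewrite lt_min dd0 subr_gt0.
    rewrite lt_min => /andP[/H{}H yd].
    have yd' : `|y| < d'.
      rewrite -[y](subrK z) (le_lt_trans (ler_normD _ _))// -ltrBrDr//.
    have [XYy _ _ _] := XYP y yd'.
    have -> : X y = y - Y y by rewrite -{2}XYy addrK.
    have -> : X z = z - Y z by rewrite -{2}XYz addrK.
    rewrite mulmxBr mulmx1 -normrN.
    suff -> : - (y - Y y - (z - Y z) - (y - z - (y - z) *m jac Y z)) = Y y - Y z - (y - z) *m jac Y z by [].
    by move: (_ *m jac Y z) => A; vring.
  have F1 : Creg 1 0 (cball d) F by exact: Creg_down (oB d) ler01 F2.
  have G1 : Creg 1 0 (cball d) G by exact: Creg_down (oB d) ler01 G2.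
  have DF := fdiff_comp_scalar DX (sdiff_fdiff (Creg_sdiff (oB d) Xd F1)).
  have DG := fdiff_comp_scalar DY (sdiff_fdiff (Creg_sdiff (oB d) Yd G1)).
  apply: fdiff_grad; apply: (@fdiff_eq _ _ _ (fun y => F (X y) + G (Y y))).
    by apply: (open_near (oB d')) => // y yd; rewrite hE.
  move=> ep ep0; have ep2 : 0 < ep / 2 by rewrite divr_gt0.
  have [e1 e10 H1] := DF _ ep2; have [e2 e20 H2] := DG _ ep2.
  exists (Num.min e1 e2) => [|y]; first by rewrite lt_min e10.
  rewrite lt_min => /andP[/H1{}H1 /H2{}H2].
  (* The two gradients agree and the Jacobians of [X] and [Y] add up to the identity, so the
     Jacobian of [Y] drops out. *)
  have -> : dotp (y - z) (grad G (Y z)) =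
     dotp (y - z) (grad F (X z) *m (1%:M - jac Y z)^T) + dotp (y - z) (grad G (Y z) *m (jac Y z)^T).
    by rewrite gE -dotpDr -mulmxDr -linearD subrK /= trmx1 mulmx1.
  rewrite [X in `|X|](_ : _ = (F (X y) - F (X z) - dotp (y - z) (grad F (X z) *m (1%:M - jac Y z)^T)) +
     (G (Y y) - G (Y z) - dotp (y - z) (grad G (Y z) *m (jac Y z)^T))); last by ring.
  by rewrite (le_trans (ler_normD _ _))// [ep]splitr mulrDl lerD.
split; first by move=> z /gradh[].
move=> r al al1 gr gr' FC GC.
have YC := Yreg r al al1 gr gr' FC GC.
have XC j : creg (predr r) al (cball d') (fun x => X x 0 j).
  have H := cregB (oB d') al1 (creg_coord (predr r) j (oB d') al1) (YC j).
  apply: creg_ext H => // z zd; have [XYz _ _ _] := XYP z zd.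
  by rewrite -{1}XYz mxE addrK.
(* At finite order the composition F o X has only the class of [X], one too low, so the gradient is
   composed instead. [predr] fixes the other two classes, where composing directly loses nothing. *)
case: r gr gr' FC GC YC XC => [[//|[//|k]]||] gr gr' FC GC YC XC.
- apply: (@CregS_intro _ _ _ _ _ _ (fun i z => grad G (Y z) 0 i)) => //.
  + move=> z zd; have [_ Xd Yd _] := XYP z zd.
    apply: (@cont_near _ _ _ (fun y => F (X y) + G (Y y))).
      by apply: (open_near (oB d')) => // y yd; rewrite hE.
    have cX : {for z, continuous X} by apply/cont_rVP => j; exact: creg_cont (XC j) zd.
    have cY : {for z, continuous Y} by apply/cont_rVP => j; exact: creg_cont (YC j) zd.
    by apply: continuousD; apply: continuous_comp => //; [exact: Creg_cont F2 Xd|exact: Creg_cont G2 Yd].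
  + by move=> i z zd; have [D <-] := gradh z zd; apply: DeriveDef => //; rewrite gradE.
  + move=> i; apply: (@creg_comp _ _ _ (Ck k.+1) al (cball d') (cball d) (fun y => grad G y 0 i) Y) => //.
      by move=> z /XYP[].
    exact: (@creg_grad (Ck k.+2) al _ _ i I (oB d) GC).
- have H : creg Cinf al (cball d') (fun z => F (X z) + G (Y z)).
    by apply: cregD => //; apply: (@creg_comp _ _ _ Cinf al (cball d') (cball d)) => // z /XYP[].
  by apply: creg_ext H => // z zd; rewrite hE.
- have H : creg Comega al (cball d') (fun z => F (X z) + G (Y z)).
    by apply: cregD => //; apply: (@creg_comp _ _ _ Comega al (cball d') (cball d)) => // z /XYP[].
  by apply: creg_ext H => // z zd; rewrite hE.
Qed.

Lemma summand_regular F G h phi X Y Th d d' d'' e r al :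
  Creg 2 0 (cball d) F -> Creg 2 0 (cball d) G -> Creg 2 0 (cball d') h ->
  (forall z, `|z| < d' -> [/\ X z + Y z = z, `|X z| < d, `|Y z| < d & grad F (X z) = grad G (Y z)]) ->
  (forall z, `|z| < d' -> `|grad F (X z)| < e /\ X z = phi (grad F (X z))) ->
  (forall j, creg (predr r) al (cball e) (fun x => phi x 0 j)) ->
  (forall y, `|y| < d'' -> [/\ `|Th y| < d', Y (Th y) = y & {for y, continuous Th}]) ->
  (forall z, `|z| < d' -> jac Y z \in unitmx) ->
  (forall z, `|z| < d' -> h z = F (X z) + G (Y z)) ->
  (forall z, `|z| < d' -> grad h z = grad G (Y z)) -> d'' <= d ->
  al <= 1 -> at_least_C1 r -> at_least_C1 (predr r) -> creg r al (cball d) F ->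
  creg r al (cball d') h -> creg r al (cball d'') G.
Proof.
move=> F2 G2 h2 XYP phiP phiC ThP uY hE gh dd al1 gr gr' FC hC.
have oB := open_cball.
have ghF z : `|z| < d' -> grad h z = grad F (X z).
  by move=> zd; rewrite gh//; have [_ _ _ ->] := XYP z zd.
have XC j : creg (predr r) al (cball d') (fun x => X x 0 j).
  have H : creg (predr r) al (cball d') (fun z => phi (grad h z) 0 j).
    apply: (@creg_comp _ _ _ _ _ _ (cball e) (fun x => phi x 0 j)) => //.
    - by move=> z zd; rewrite /cball /= ghF//; have [] := phiP z zd.
    - by move=> j'; exact: creg_grad.
  apply: creg_ext H => // z zd; rewrite ghF//; have [_ <-] := phiP z zd.
  by [].
have YC j : creg (predr r) al (cball d') (fun x => Y x 0 j).
  have H := cregB (oB d') al1 (creg_coord (predr r) j (oB d') al1) (XC j).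
  apply: creg_ext H => // z zd; have [XYz _ _ _] := XYP z zd.
  by rewrite -{1}XYz mxE addrAC subrr add0r.
have ThC j : creg (predr r) al (cball d'') (fun x => Th x 0 j).
  apply: (@creg_inverse _ _ _ _ (cball d'') (cball d') Y) => //.
  - by move=> y /ThP[].
  - by move=> y /ThP[].
  - by move=> y /ThP[].
  - by move=> y /ThP[Td _ _]; exact: uY.
have GE y : `|y| < d'' -> G y = h (Th y) - F (X (Th y)).
  by move=> yd; have [Td YT _] := ThP y yd; rewrite hE// YT addrAC subrr add0r.
have dsub : cball d'' `<=` cball d by move=> y yd; exact: lt_le_trans dd.
(* At finite order G = h o Th - F o X o Th would again be one derivative short; grad G = grad h o Th
   has the right class. *)
case: r gr gr' FC hC phiC XC YC ThC => [[//|[//|k]]||] gr gr' FC hC phiC XC YC ThC.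
- apply: (@CregS_intro _ _ _ _ _ _ (fun i y => grad h (Th y) 0 i)) => //.
  + by move=> y yd; apply: Creg_cont G2 _; exact: dsub.
  + move=> i y yd; have [Td YT _] := ThP y yd; rewrite gh// YT gradE.
    by apply: derivableP; have [_ /(_ i)[+ _]] := G2; apply; exact: dsub.
  + move=> i; apply: (@creg_comp _ _ _ (Ck k.+1) al (cball d'') (cball d') (fun y => grad h y 0 i) Th) => //.
      by move=> y /ThP[].
    exact: (@creg_grad (Ck k.+2) al _ _ i I (oB d') hC).
- have H : creg Cinf al (cball d'') (fun y => h (Th y) - F (X (Th y))).
    apply: cregB => //.
      by apply: (@creg_comp _ _ _ Cinf al (cball d'') (cball d')) => // y /ThP[].
    apply: (@creg_comp _ _ _ Cinf al (cball d'') (cball d') (fun z => F (X z))) => //.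
      by move=> y /ThP[].
    by apply: (@creg_comp _ _ _ Cinf al (cball d') (cball d)) => // z /XYP[].
  by apply: creg_ext H => // y yd; rewrite GE.
- have H : creg Comega al (cball d'') (fun y => h (Th y) - F (X (Th y))).
    apply: cregB => //.
      by apply: (@creg_comp _ _ _ Comega al (cball d'') (cball d')) => // y /ThP[].
    apply: (@creg_comp _ _ _ Comega al (cball d'') (cball d') (fun z => F (X z))) => //.
      by move=> y /ThP[].
    by apply: (@creg_comp _ _ _ Comega al (cball d') (cball d)) => // z /XYP[].
  by apply: creg_ext H => // y yd; rewrite GE.
Qed.

Lemma sum_hessian G h (Y : 'rV[R]_m -> 'rV[R]_m) d d' : 0 < d -> 0 < d' -> Creg 2 0 (cball d) G ->
  (forall j, Creg 1 0 (cball d') (fun x => Y x 0 j)) -> Y 0 = 0 ->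
  (forall z, `|z| < d' -> grad h z = grad G (Y z)) ->
  hess h 0 = jac Y 0 *m hess G 0.
Proof.
move=> d0 d'0 G2 Y1 Y0 gh; have oB := open_cball.
have B0 e : 0 < e -> cball e 0 by rewrite /cball /= normr0.
have G1 j : Creg 1 0 (cball d) (fun x => grad G x 0 j).
  exact: (@creg_grad (Ck 2) 0 _ _ j I (oB d) G2).
have DY := sdiff_fdiff (Creg_sdiff_rV (oB d') (B0 _ d'0) Y1).
have DG : fdiff (grad G) (Y 0) (fun v => v *m hess G 0).
  by rewrite Y0; exact/sdiff_fdiff/(Creg_sdiff_rV (oB d) (B0 _ d0) G1).
have [C C0 HC] := mulmx_bound (hess G 0).
have D := fdiff_mx_comp HC (fun u v => mulmxBl u v _) DY DG.
have D' : fdiff (grad h) 0 (fun v => v *m (jac Y 0 *m hess G 0)).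
  apply: (@fdiff_eq _ _ _ (fun y => grad G (Y y))).
    by apply: (open_near (oB d')); [exact: B0|move=> z zd; rewrite gh].
  by move: D; congr fdiff; apply/funext => v; rewrite mulmxA.
by have [_] := fdiff_jac D'.
Qed.

End InfConvolution.

(** * Convex bodies and supporting hyperplanes *)

Section ConvexGeometry.
Context {R : realType} {n : nat}.
Implicit Types (C : set 'rV[R]_n) (x y u v w nu p q c : 'rV[R]_n).

Definition body C : Prop :=
  [/\ compact C,
      (forall x y (t : R), 0 <= t <= 1 -> C x -> C y -> C (t *: x + (1 - t) *: y)) &
      exists q, C^° q].

Lemma convex_body_body C : convex_body C -> body C.
Proof.
move=> [cC vC [q iq]]; split=> //; last by exists q.
move=> x y t /andP[t0 t1] Cx Cy.
have := vC x y (Itv01 t0 t1); rewrite !inE => /(_ Cx Cy).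
by [].
Qed.

Lemma interiorP C x : C^° x <-> exists2 d : R, 0 < d & forall y, `|y - x| < d -> C y.
Proof. exact: (near_ballP (fun y => C y) x). Qed.

Lemma body_closed C : body C -> closed C.
Proof. by move=> [cC _ _]; apply: compact_closed => //; exact: norm_hausdorff. Qed.

Lemma body_boundary C x : body C -> boundary C x <-> C x /\ ~ C^° x.
Proof.
move=> bC; have cl := body_closed bC; rewrite /boundary /setD /=.
by rewrite -(closure_id C).1.
Qed.

Lemma body_notin C x : body C -> ~ C x ->
  exists2 d : R, 0 < d & forall y, `|y - x| < d -> ~ C y.
Proof.
move=> bC nCx; have cl := body_closed bC; rewrite -openC in cl.
exact: (open_ballP cl nCx).
Qed.

Lemma body_limit C x : body C -> (forall e : R, 0 < e -> exists2 y, `|y - x| < e & C y) -> C x.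
Proof.
move=> bC H; apply: contrapT => /(body_notin bC)[d d0 dP].
by have [y /dP + Cy] := H d d0; apply.
Qed.

Lemma interior_convex C p c (t : R) : body C -> C^° p -> C c -> 0 < t <= 1 ->
  C^° (t *: p + (1 - t) *: c).
Proof.
move=> [_ vC _] /interiorP[d d0 dP] Cc /andP[t0 t1]; apply/interiorP.
exists (t * d) => [|y yd]; first by rewrite mulr_gt0.
have -> : y = t *: (p + t^-1 *: (y - (t *: p + (1 - t) *: c))) + (1 - t) *: c.
  rewrite scalerDr scalerA mulfV ?gt_eqF// scale1r.
  by move: (t *: p) ((1 - t) *: c) => a b; vring.
apply: vC => //; first by rewrite (ltW t0).
apply: dP; rewrite addrAC subrr add0r normrZ normfV gtr0_norm//.
by rewrite ltr_pdivrMl.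
Qed.

Lemma interior_sub C x : C^° x -> C x.
Proof. exact: interior_subset. Qed.

Lemma dotp_cont v : continuous (fun x => dotp v x).
Proof.
move=> x; have H : fdiff (fun y : 'rV[R]_n => dotp v y) x (fun h => dotp h v).
  move=> e e0; exists 1 => // y _; rewrite -dotpBr (dotpC _ v) subrr normr0.
  by rewrite mulr_ge0// ltW.
exact: fdiff_cont_rV H.
Qed.

(** First-order condition at t = 0, tested at one explicit [t] small enough for the linear term to
    dominate. *)
Lemma quad_ge0 (a b : R) : 0 <= b -> (forall t : R, 0 < t <= 1 -> 0 <= 2 * a * t + b * t ^+ 2) -> 0 <= a.
Proof.
move=> b0 H; rewrite leNgt; apply/negP => a0.
have b1 : 0 < b - a + 1 by lra.
pose t := - a / (b - a + 1).
have t0 : 0 < t by rewrite divr_gt0// oppr_gt0.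
have tE : t * (b - a + 1) = - a by rewrite /t divfK// gt_eqF.
have t1 : t <= 1 by rewrite ler_pdivrMr// mul1r; lra.
have := H t; rewrite t0 t1 => /(_ isT).
have -> : 2 * a * t + b * t ^+ 2 = t * (2 * a + b * t) by ring.
rewrite pmulr_rge0// => H2.
have := mulr_ge0 (ltW t0) b0; nra.
Qed.

(** The normal points from the nearest point of [C] to [x]; minimality of the distance along
    segments gives the inequality. *)
Lemma separation C x : body C -> ~ C x ->
  exists2 nu, dotp nu nu = 1 & forall y, C y -> dotp nu (y - x) <= 0.
Proof.
move=> bC nCx; have [cC vC [q /interior_sub Cq]] := bC.
have qcont : continuous (fun y => dotp (y - x) (y - x)).
  have E : (fun y => dotp (y - x) (y - x)) = (fun y => \sum_i (y 0 i - x 0 i) * (y 0 i - x 0 i)).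
    by apply/funext => y; rewrite dotpE; apply: eq_bigr => i _; rewrite mxBE.
  have H : Creg 0 0 setT (fun y => \sum_i (y 0 i - x 0 i) * (y 0 i - x 0 i)).
    apply: Creg_sum => [|i]; first exact: openT.
    by apply: CregM => //; try exact: openT;
      (apply: CregB => //; [exact: openT|exact: Creg_coord openT ler01|exact: Creg_cst openT]).
  by rewrite E => y; have [] := H y I.
have [|y0 /set_mem Cy0 ymin] := compact_EVT_min (f := fun y => dotp (y - x) (y - x)) _ cC (continuous_subspaceT qcont).
  by exists q.
pose w := x - y0.
have w0 : 0 < dotp w w.
  rewrite lt_neqAle dotp_ge0 andbT; apply/eqP => /esym/dotp_eq0/eqP.
  by rewrite subr_eq0 => /eqP E; apply: nCx; rewrite E.
have wle y : C y -> dotp w (y - y0) <= 0.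
  move=> Cy; rewrite -oppr_ge0 -dotpNl.
  apply: (@quad_ge0 _ (dotp (y - y0) (y - y0))); first exact: dotp_ge0.
  move=> t /andP[t0 t1].
  have /ymin : t *: y + (1 - t) *: y0 \in C by rewrite inE; apply: vC => //; rewrite (ltW t0).
  have -> : t *: y + (1 - t) *: y0 - x = t *: (y - y0) - w by rewrite /w; vring.
  have -> : y0 - x = - w by rewrite opprB.
  clear w0; move: (y - y0) (w) => v w'; rewrite !dotpNl dotpNr opprK dotpBl !dotpBr !dotpZl !dotpZr (dotpC v w').
  by rewrite -subr_ge0; congr (is_true (_ <= _)); ring.
pose s := Num.sqrt (dotp w w).
have s0 : 0 < s by rewrite sqrtr_gt0.
exists (s^-1 *: w).
  rewrite dotpZl dotpZr mulrA -invfM -expr2 sqr_sqrtr ?(ltW w0)// mulVf// gt_eqF//.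
move=> y /wle wy; rewrite dotpZl pmulr_rle0 ?invr_gt0//.
have -> : y - x = (y - y0) - w by rewrite /w; vring.
by rewrite dotpBr; have := ltW w0; lra.
Qed.

Lemma unit_norm_le1 nu : dotp nu nu = 1 -> `|nu| <= 1.
Proof.
move=> nu1; apply: rV_norm_le => // i.
have : nu 0 i * nu 0 i <= 1.
  by rewrite -nu1 dotpE (bigD1 i)//= lerDl sumr_ge0// => j _; rewrite -expr2 sqr_ge0.
rewrite ler_norml; move: (nu 0 i) => a; nra.
Qed.

Lemma norm_dotp_unit nu v : dotp nu nu = 1 -> `|dotp nu v| <= n%:R * `|v|.
Proof.
move=> nu1; apply: (le_trans (norm_dotp_le _ _)); rewrite ler_wpM2l//.
by rewrite ler_piMl// unit_norm_le1.
Qed.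

(** Compactness of the unit vectors. [D] is an arbitrary set so that further directions can be
    constrained together with the points of a body. *)
Lemma unit_limit (D : set 'rV[R]_n) :
  (forall e : R, 0 < e -> exists2 nu, dotp nu nu = 1 & forall v, D v -> dotp nu v <= e) ->
  exists2 nu, dotp nu nu = 1 & forall v, D v -> dotp nu v <= 0.
Proof.
move=> H.
have Hk (k : nat) : exists nu : 'rV[R]_n, dotp nu nu = 1 /\ forall v, D v -> dotp nu v <= k.+1%:R^-1.
  by have [|nu nu1 nuD] := H k.+1%:R^-1; [rewrite invr_gt0|exists nu].
have [nu_ nuP] := choice Hk.
have cB : compact [set x : 'rV[R]_n | `|x| <= 1].
  have -> : [set x : 'rV[R]_n | `|x| <= 1] = closed_ball (0 : 'rV[R]_n) 1.
    rewrite closed_ballE//; apply/seteqP; split=> x; rewrite /closed_ball_ /= sub0r normrN//.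
  apply: bounded_closed_compact; last exact: closed_ball_closed.
  rewrite closed_ballE//; exists 1; split; first exact: num_real.
  by move=> M M1 x; rewrite /closed_ball_ /= sub0r normrN => /le_trans; apply; exact: ltW.
have [|nu [_ nucl]] := cB (nu_ @ \oo) _.
  by exists 0%N => // k _ /=; apply: unit_norm_le1; have [] := nuP k.
have app (e : R) (K : nat) : 0 < e -> exists2 k, (K <= k)%N & `|nu_ k - nu| < e.
  move=> e0; have [||y [[k /= Kk <-] By]] := nucl (nu_ @` [set k | (K <= k)%N]) (ball nu e).
  - by exists K => // k /= Kk; exists k.
  - exact: nbhsx_ballx.
  - by exists k => //; move: By; rewrite -ball_normE /= distrC.
have small (a B : R) : 0 <= B -> (forall e, 0 < e -> a <= B * e) -> a <= 0.
  move=> B0 Ha; rewrite leNgt; apply/negP => a0.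
  have B1 : 0 < B + 1 by rewrite ltr_wpDl.
  pose X := a / (B + 1); have X0 : 0 < X by rewrite divr_gt0.
  have XE : X * (B + 1) = a by rewrite divfK// gt_eqF.
  have X2 : 0 < X / 2 by rewrite divr_gt0.
  by have := Ha _ X2; have := mulr_ge0 (ltW X0) B0; lra.
exists nu.
  suff : `|dotp nu nu - 1| <= 0 by rewrite normr_le0 subr_eq0 => /eqP.
  apply: (@small _ (n%:R * (1 + 2 * `|nu|) + n%:R)).
    by rewrite !addr_ge0 ?mulr_ge0 ?addr_ge0 ?mulr_ge0.
  move=> e e0; have [k _ ke] := app e 0%N e0; have [k1 _] := nuP k.
  have -> : dotp nu nu - 1 = - (dotp (nu_ k) (nu_ k - nu) + dotp (nu_ k - nu) nu).
    by rewrite dotpBl dotpBr k1; ring.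
  rewrite normrN (le_trans (ler_normD _ _))//.
  have A1 := norm_dotp_unit (nu_ k - nu) k1.
  have A2 := norm_dotp_le (nu_ k - nu) nu.
  have A3 : `|nu_ k - nu| * `|nu| <= e * `|nu| by rewrite ler_wpM2r// ltW.
  have n0 : (0 : R) <= n%:R by rewrite ler0n.
  have A4 : n%:R * `|nu_ k - nu| <= n%:R * e by rewrite ler_wpM2l// ltW.
  have A5 := ler_wpM2l n0 A3.
  have A6 : 0 <= n%:R * (e * `|nu|) by rewrite !mulr_ge0// ltW.
  have A7 : 0 <= n%:R * e by rewrite mulr_ge0// ltW.
  rewrite (le_trans (lerD A1 A2))// (le_trans (lerD A4 A5))//.
  have -> : (n%:R * (1 + 2 * `|nu|) + n%:R) * e = n%:R * e + n%:R * (e * `|nu|) + (n%:R * e + n%:R * (e * `|nu|)) by ring.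
  by rewrite lerDl addr_ge0.
move=> v Dv; apply: (@small _ (1 + n%:R * `|v|)); first by rewrite addr_ge0// mulr_ge0.
move=> e e0; have [K _ HK] : \forall k \near \oo, k.+1%:R^-1 < e.
  exact: near_infty_natSinv_lt (PosNum e0).
have [k Kk ke] := app e K e0; have [k1 kD] := nuP k.
have -> : dotp nu v = dotp (nu_ k) v - dotp (nu_ k - nu) v by rewrite dotpBl; ring.
have A1 := norm_dotp_le (nu_ k - nu) v.
have A2 : n%:R * (`|nu_ k - nu| * `|v|) <= n%:R * `|v| * e.
  by rewrite -mulrA ler_wpM2l// mulrC ler_wpM2l// ltW.
have A3 := le_trans A1 A2.
have A4 := le_trans (kD v Dv) (ltW (HK k Kk)).
rewrite mulrDl mul1r; move: A3; rewrite ler_norml => /andP[A5 _].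
by rewrite lerD// lerNl.
Qed.

(** Points outside [C] accumulate at [x]; their separating normals have a limit that supports at
    [x]. *)
Lemma support_exists C x : body C -> ~ C^° x ->
  exists2 nu, dotp nu nu = 1 & forall y, C y -> dotp nu (y - x) <= 0.
Proof.
move=> bC nx.
have app (e : R) : 0 < e -> exists2 x', `|x' - x| < e & ~ C x'.
  move=> e0; apply: contrapT => H; apply: nx; apply/interiorP; exists e => // y yx.
  by apply: contrapT => nCy; apply: H; exists y.
have [|nu nu1 nuD] := @unit_limit [set v | exists2 y, C y & v = y - x].
  move=> e e0; have en : 0 < e / n.+1%:R by rewrite divr_gt0.
  have [x' xx nCx] := app _ en; have [nu nu1 H] := separation bC nCx.
  exists nu => // v [y Cy ->].
  have -> : y - x = (y - x') + (x' - x) by vring.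
  have A := norm_dotp_unit (x' - x) nu1.
  rewrite dotpDr -[e]add0r lerD ?H// (le_trans (ler_norm _))// (le_trans A)//.
  apply: (@le_trans _ _ (n%:R * (e / n.+1%:R))); first by rewrite ler_wpM2l// ltW.
  by rewrite mulrCA ler_piMr ?(ltW e0)// ler_pdivrMr// mul1r ler_nat.
by exists nu => // y Cy; apply: nuD; exists y.
Qed.

(** Limit of supporting normals at the points x + e w, each of which has nonnegative product with
    [w] because [x] lies in [C]. With unique normals this shows that the inward normal enters the
    interior. *)
Lemma ray_support C x w : body C -> C x -> (forall e : R, 0 < e -> ~ C^° (x + e *: w)) ->
  exists nu, [/\ dotp nu nu = 1, forall y, C y -> dotp nu (y - x) <= 0 & 0 <= dotp nu w].
Proof.
move=> bC Cx H.
have [|nu nu1 nuD] := @unit_limit [set v | v = - w \/ exists2 y, C y & v = y - x].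
  move=> e e0; have w1 : 0 < n.+1%:R * (1 + `|w|) by rewrite mulr_gt0// ltr_pwDl.
  have ew : 0 < e / (n.+1%:R * (1 + `|w|)) by rewrite divr_gt0.
  have [nu nu1 nuC] := support_exists bC (H _ ew).
  move: ew nuC; set e' := e / _ => ew nuC.
  exists nu => // v [->|[y Cy ->]].
    have A := nuC x Cx; have E : x - (x + e' *: w) = - (e' *: w) by vring.
    rewrite E dotpNr dotpZr oppr_le0 pmulr_rge0// in A; rewrite dotpNr.
    by rewrite (le_trans _ (ltW e0))// oppr_le0.
  have -> : y - x = (y - (x + e' *: w)) + e' *: w by vring.
  rewrite dotpDr -[e]add0r lerD ?nuC// dotpZr.
  have A := norm_dotp_unit w nu1.
  have A2 : dotp nu w <= n.+1%:R * (1 + `|w|).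
    rewrite (le_trans (ler_norm _))// (le_trans A)// ler_pM// ?ler_nat// lerDr//.
  rewrite (le_trans (ler_wpM2l (ltW ew) A2))// /e' divfK// gt_eqF//.
exists nu; split=> //; last by rewrite -oppr_le0 -dotpNr; apply: nuD; left.
by move=> y Cy; apply: nuD; right; exists y.
Qed.

(** Otherwise [C] would lie in a hyperplane and have no interior. This fixes the sign of a
    normal. *)
Lemma unit_normal_neq C nu x : body C -> dotp nu nu = 1 ->
  (forall y, C y -> dotp nu (y - x) <= 0) -> ~ (forall y, C y -> dotp (- nu) (y - x) <= 0).
Proof.
move=> [_ _ [q /interiorP[d d0 dP]]] nu1 H1 H2.
have E y : C y -> dotp nu (y - x) = 0.
  by move=> Cy; apply/eqP; rewrite eq_le H1// -oppr_le0 -dotpNl H2.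
have dq : C (q + (d / 2) *: nu).
  apply: dP; rewrite addrAC subrr add0r normrZ gtr0_norm ?divr_gt0//.
  apply: (@le_lt_trans _ _ (d / 2)); last by rewrite ltr_pdivrMr// ltr_pMr// ltr1n.
  by rewrite ler_piMr ?divr_ge0 ?(ltW d0)// unit_norm_le1.
have Cq : C q by apply: dP; rewrite subrr normr0.
have := E _ dq; have -> : q + (d / 2) *: nu - x = (q - x) + (d / 2) *: nu by vring.
rewrite dotpDr E// add0r dotpZr nu1 mulr1 => /eqP; apply/negP.
by rewrite gt_eqF// divr_gt0.
Qed.

End ConvexGeometry.

Section Minkowski.
Context {R : realType} {n : nat}.
Implicit Types (A B : set 'rV[R]_n).

Lemma minkowski_body A B : body A -> body B -> body (minkowski_sum A B).
Proof.
move=> [cA vA [p ip]] [cB vB [q iq]]; split.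
- have -> : minkowski_sum A B = (fun z : 'rV[R]_n * 'rV[R]_n => z.1 + z.2) @` (A `*` B).
    apply/seteqP; split=> x /=.
      by move=> [a [Aa [b [Bb ->]]]]; exists (a, b).
    by move=> [[a b] [/= Aa Bb] <-]; exists a; split=> //; exists b.
  apply: continuous_compact; last exact: compact_setX.
  by apply: continuous_subspaceT => z; exact: add_continuous.
- move=> x y t t01 [a [Aa [b [Bb ->]]]] [a' [Aa' [b' [Bb' ->]]]].
  exists (t *: a + (1 - t) *: a'); split; first exact: vA.
  exists (t *: b + (1 - t) *: b'); split; first exact: vB.
  by vring.
- exists (p + q); have /interiorP[d d0 dP] := ip; apply/interiorP; exists d => // y yd.
  exists (y - q); split; last by exists q; split; [exact: interior_sub|rewrite subrK].
  by apply: dP; have -> : y - q - p = y - (p + q) by vring.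
Qed.

End Minkowski.

(** * Orthonormal frames *)

Section Frames.
Context {R : realType} {m : nat}.
Implicit Types (u c nu : 'rV[R]_m.+1) (Q : 'M[R]_(m, m.+1)) (z w : 'rV[R]_m).

Definition frame u Q : Prop := [/\ dotp u u = 1, Q *m Q^T = 1%:M & Q *m u^T = 0].

Lemma frame_uQ u Q : frame u Q -> u *m Q^T = 0.
Proof. by move=> [_ _ Qu]; apply: trmx_inj; rewrite trmx_mul trmxK Qu trmx0. Qed.

(** Stacking [Q] and [u] gives a square matrix with orthonormal rows, whose right inverse, its
    transpose, is also a left inverse. *)
Lemma frame_id u Q : frame u Q -> Q^T *m Q + u^T *m u = 1%:M.
Proof.
move=> fr; have uQ := frame_uQ fr; have [u1 QQ Qu] := fr.
have uu : u *m u^T = 1%:M.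
  by apply/matrixP => i j; rewrite !ord1 -/(dotp u u) u1 mxE.
have PP : col_mx Q u *m (col_mx Q u)^T = 1%:M.
  by rewrite tr_col_mx mul_col_row QQ Qu uQ uu -scalar_mx_block.
have /eqP rP : row_free (col_mx Q u) by apply/row_freeP; exists (col_mx Q u)^T.
have /row_fullP[B BP] : row_full (col_mx Q u) by rewrite /row_full rP addn1.
have BE : B = (col_mx Q u)^T by rewrite -[B]mulmx1 -PP mulmxA BP mul1mx.
by rewrite -BP BE tr_col_mx mul_row_col.
Qed.

Lemma frame_decomp u Q c : frame u Q -> c = (c *m Q^T) *m Q + dotp c u *: u.
Proof.
move=> fr; rewrite -{1}[c]mulmx1 -(frame_id fr) mulmxDr !mulmxA; congr (_ + _).
by rewrite [c *m u^T]mx11_scalar mul_scalar_mx.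
Qed.

Lemma frame_dotQ u Q z : frame u Q -> dotp (z *m Q) u = 0.
Proof. by move=> fr; rewrite dotp_mulr (frame_uQ fr) dotp0r. Qed.

Lemma frame_QQ u Q z w : frame u Q -> dotp (z *m Q) (w *m Q) = dotp z w.
Proof. by move=> [_ QQ _]; rewrite dotp_mulr -mulmxA QQ mulmx1. Qed.

Lemma frame_coord u Q z s : frame u Q -> (z *m Q + s *: u) *m Q^T = z.
Proof.
move=> fr; have [_ QQ _] := fr.
by rewrite mulmxDl -mulmxA QQ mulmx1 -scalemxAl (frame_uQ fr) scaler0 addr0.
Qed.

Lemma frame_height u Q z s : frame u Q -> dotp u (z *m Q + s *: u) = s.
Proof.
move=> fr; have [u1 _ _] := fr.
by rewrite dotpC dotpDl dotpZl u1 mulr1 (frame_dotQ _ fr) add0r.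
Qed.

(* The remaining rows of a Householder reflection exchanging [u] and the first basis vector. *)
Lemma frame_exists u : dotp u u = 1 -> exists Q, frame u Q.
Proof.
move=> u1; pose e0 : 'rV[R]_m.+1 := delta_mx 0 0.
have e01 : dotp e0 e0 = 1.
  rewrite dotpE (bigD1 0)//= big1 ?addr0; first by rewrite mxE !eqxx mulr1.
  by move=> i i0; rewrite !mxE (negPf i0) andbF mul0r.
pose v := u - e0; pose k := 2 / dotp v v.
(* If [u] is already the basis vector then [v] = 0 and [k] is 2 / 0 = 0, so [H] is the identity; no
   separate construction is made for this case. *)
have kv : k * dotp v v = if v == 0 then 0 else 2.
  case: eqP => [->|/eqP v0]; first by rewrite dotp0l mulr0.
  by rewrite divfK//; apply: contra v0 => /eqP/dotp_eq0->.
pose H : 'M[R]_m.+1 := 1%:M - k *: (v^T *m v).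
have HT : H^T = H by rewrite linearB /= trmx1 linearZ /= trmx_mul trmxK.
have vvv : v^T *m v *m (v^T *m v) = dotp v v *: (v^T *m v).
  rewrite mulmxA -(mulmxA v^T) [v *m v^T]mx11_scalar -/(dotp v v).
  by rewrite mul_mx_scalar -scalemxAl.
have HH : H *m H = 1%:M.
  have kk : k * k * dotp v v = k + k.
    rewrite -mulrA kv; case: eqP => [v0|_]; last by ring.
    by rewrite /k v0 dotp0l invr0 !mulr0 addr0.
  rewrite /H; move: (v^T *m v) vvv => M MM.
  rewrite mulmxBr mulmx1 mulmxBl mul1mx -scalemxAl -scalemxAr MM !scalerA kk.
  by apply/matrixP => i j; rewrite !mxE; ring.
have eH : e0 *m H = u.
  rewrite mulmxBr mulmx1 -scalemxAr mulmxA [e0 *m v^T]mx11_scalar -/(dotp e0 v) mul_scalar_mx.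
  rewrite scalerA.
  have [v0|v0] := eqVneq v 0.
    by rewrite v0 scaler0 subr0; apply/esym/eqP; rewrite -subr_eq0; apply/eqP.
  have vv : dotp v v = - (2 * dotp e0 v).
    by rewrite /v dotpBl !dotpBr u1 e01 (dotpC u e0); ring.
  have : k * dotp v v = 2 by rewrite kv (negPf v0).
  rewrite vv => E; have -> : k * dotp e0 v = -1 by move: (k) (dotp e0 v) E => a b E; lra.
  by rewrite scaleN1r opprK /v addrC subrK.
have rH : row 0 H = u by rewrite rowE.
clearbody H; have HC i j : H i j = H j i by rewrite -{1}HT mxE.
exists (row' 0 H); split=> //.
- apply/matrixP => i j; rewrite -[1%:M in RHS]/(1%:M) mxE.
  have := congr1 (fun M : 'M[R]_m.+1 => M (lift 0 i) (lift 0 j)) HH.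
  rewrite !mxE (inj_eq (@lift_inj _ 0)) => <-.
  by apply: eq_bigr => l _; rewrite !mxE (HC l).
- apply/matrixP => i j; rewrite !mxE.
  have := congr1 (fun M : 'M[R]_m.+1 => M (lift 0 i) 0) HH.
  rewrite !mxE /= mulr0n => E; rewrite -[RHS]E.
  by apply: eq_bigr => l _; rewrite -rH !mxE (HC l).
Qed.

End Frames.

(** * Normals at graph points *)

Section Normals.
Context {R : realType}.

Lemma fdiff_max m (k : 'rV[R]_m -> R) x g : fdiff k x (fun h => dotp h g) ->
  (exists2 d : R, 0 < d & forall y, `|y - x| < d -> k y <= k x) -> g = 0.
Proof.
move=> kg [d d0 kd]; apply/dotp_eq0/eqP; rewrite eq_le dotp_ge0 andbT.
rewrite leNgt; apply/negP => gg.
have g1 : 0 < 1 + `|g| by rewrite ltr_pwDl.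
have e0 : 0 < dotp g g / (2 * (1 + `|g|)) by rewrite divr_gt0// mulr_gt0.
have [d' d'0 H] := kg _ e0; move: e0 H; set e := _ / _ => e0 H.
pose t := Num.min d d' / (2 * (1 + `|g|)).
have md : 0 < Num.min d d' by rewrite lt_min d0.
have t0 : 0 < t by rewrite divr_gt0// mulr_gt0.
have tg : `|x + t *: g - x| < Num.min d d'.
  rewrite addrAC subrr add0r normrZ gtr0_norm// /t mulrAC ltr_pdivrMr ?mulr_gt0//.
  by rewrite ltr_pM2l//; have := normr_ge0 g; lra.
move: tg; rewrite lt_min => /andP[td td'].
have A := kd _ td; have := H _ td'.
have -> : x + t *: g - x = t *: g by rewrite addrAC subrr add0r.
rewrite dotpZl normrZ gtr0_norm// ler_norml => /andP[B _].
have eE : e * (2 * (1 + `|g|)) = dotp g g by rewrite /e divfK// gt_eqF// mulr_gt0.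
have C : t * dotp g g <= e * (t * `|g|) by lra.
have : dotp g g <= e * `|g| by rewrite -(ler_pM2l t0) mulrCA.
by rewrite -eE; have := normr_ge0 g; nra.
Qed.

Context {m : nat}.
Implicit Types (u c nu p q : 'rV[R]_m.+1) (Q : 'M[R]_(m, m.+1)) (z w : 'rV[R]_m).

(** The function y -> <nu, graph point over y> is maximal at [x], so its gradient vanishes there;
    this determines the tangential part of [nu]. *)
Lemma graph_normal (C : set 'rV[R]_m.+1) u Q nu p f x g : body C -> frame u Q ->
  p = x *m Q + f x *: u -> fdiff f x (fun h => dotp h g) ->
  (exists2 d : R, 0 < d & forall y, `|y - x| < d -> C (y *m Q + f y *: u)) ->
  (forall c, C c -> dotp nu (c - p) <= 0) ->
  nu = dotp nu u *: (u - g *m Q).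
Proof.
move=> bC fr pE fg [d d0 Cd] nuC.
have D : fdiff (fun y => dotp nu (y *m Q + f y *: u)) x (fun h => dotp h (nu *m Q^T + dotp nu u *: g)).
  move=> e e0; have u1 : 0 < 1 + `|dotp nu u| by rewrite ltr_pwDl.
  have [d' d'0 H] := fg _ (divr_gt0 e0 u1); exists d' => // y yd.
  have -> : dotp nu (y *m Q + f y *: u) - dotp nu (x *m Q + f x *: u) -
     dotp (y - x) (nu *m Q^T + dotp nu u *: g) = dotp nu u * (f y - f x - dotp (y - x) g).
    rewrite !dotpDr !dotpZr -dotp_mulr mulmxBl dotpBl !(dotpC _ nu); ring.
  rewrite normrM; apply: (le_trans (ler_wpM2l (normr_ge0 _) (H y yd))).
  rewrite mulrA ler_wpM2r// mulrCA ler_piMr ?(ltW e0)// ler_pdivrMr// mul1r.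
  by rewrite lerDr.
have E : nu *m Q^T + dotp nu u *: g = 0.
  apply: (fdiff_max D).
  exists d => // y /Cd/nuC; rewrite dotpBr pE subr_le0//.
rewrite {1}(frame_decomp nu fr) (_ : nu *m Q^T = - (dotp nu u *: g)); last first.
  by apply/eqP; rewrite -addr_eq0 E.
by rewrite mulNmx -scalemxAl scalerBr addrC.
Qed.

(** Both normals are multiples of u - g Q with equal length, and [unit_normal_neq] excludes opposite
    signs. *)
Lemma normal_unique (C : set 'rV[R]_m.+1) u Q nu nu' p f x g : body C -> frame u Q ->
  p = x *m Q + f x *: u -> fdiff f x (fun h => dotp h g) ->
  (exists2 d : R, 0 < d & forall y, `|y - x| < d -> C (y *m Q + f y *: u)) ->
  dotp nu nu = 1 -> (forall c, C c -> dotp nu (c - p) <= 0) ->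
  dotp nu' nu' = 1 -> (forall c, C c -> dotp nu' (c - p) <= 0) ->
  nu = nu'.
Proof.
move=> bC fr pE fg Cd n1 nC n'1 n'C.
have E := graph_normal bC fr pE fg Cd nC; have E' := graph_normal bC fr pE fg Cd n'C.
move: (dotp nu u) (dotp nu' u) E E' => a b; set w := u - _ => E E'.
have /eqP : a ^+ 2 * dotp w w = b ^+ 2 * dotp w w.
  by move: n1 n'1; rewrite E E' !dotpZl !dotpZr => A B; rewrite !expr2 -!mulrA A B.
have w0 : dotp w w != 0.
  by apply/eqP => w0; move: n1; rewrite E dotpZl dotpZr w0 !mulr0 => /eqP; rewrite eq_sym oner_eq0.
rewrite (inj_eq (mulIf w0)) eqf_sqr => /orP[/eqP ab|/eqP ab]; first by rewrite E E' ab.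
case: (unit_normal_neq bC n1 nC) => c Cc.
by rewrite (_ : - nu = nu') ?n'C// E E' ab scaleNr opprK.
Qed.

Definition normal_at (C : set 'rV[R]_m.+1) p nu : Prop :=
  dotp nu nu = 1 /\ forall c, C c -> dotp nu (c - p) <= 0.

Lemma graph_point (C : set 'rV[R]_m.+1) r al p : regular_near r al C p -> boundary C p ->
  exists u Q (V : set 'rV[R]_m) (W : set 'rV[R]_m.+1) f x,
  [/\ frame u Q, open V, open W, V x & W p] /\
  [/\ p = x *m Q + f x *: u, creg r al V f,
     (forall y, V y -> W (y *m Q + f y *: u) -> boundary C (y *m Q + f y *: u)) &
     (forall c, boundary C c -> W c -> V (c *m Q^T) /\ c = c *m Q^T *m Q + f (c *m Q^T) *: u)].
Proof.
move=> [u [Q [V [W [f [[u1 QQ Qu] [oV oW Wp E gf]]]]]]] bp.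
have fr : frame u Q by split=> //; exact: enormE.
have [[x Vx xE] _] : ([set x *m Q + f x *: u | x in V] `&` W) p by rewrite -E.
exists u, Q, V, W, f, x; split=> //; split=> //.
- exact: graph_reg_creg.
- move=> y Vy Wy; have [] // : (boundary C `&` W) (y *m Q + f y *: u).
  by rewrite E; split=> //; exists y.
- move=> c bc Wc; have [[y Vy <-] _] : ([set x *m Q + f x *: u | x in V] `&` W) c by rewrite -E.
  by rewrite (frame_coord y (f y) fr).
Qed.

Lemma graph_cont u Q (f : 'rV[R]_m -> R) x : {for x, continuous f} ->
  {for x, continuous (fun y : 'rV[R]_m => y *m Q + f y *: u)}.
Proof.
move=> cf; apply/cont_rVP => j.
have -> : (fun y => (y *m Q + f y *: u) 0 j) = (fun y => (y *m Q) 0 j + f y * u 0 j).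
  by apply/funext => y; rewrite !mxE.
apply: continuousD; last by apply: continuousM => //; exact: cst_continuous.
have H := @creg_mulmx _ m m m.+1 (Ck 0) 0 setT id Q j openT ler01 (fun i => creg_coord (Ck 0) i openT ler01).
exact: creg_cont H I.
Qed.

Lemma normal_at_unique (C : set 'rV[R]_m.+1) p nu nu' : body C -> regular_near (Ck 2) 0 C p ->
  boundary C p -> normal_at C p nu -> normal_at C p nu' -> nu = nu'.
Proof.
move=> bC rC bp [n1 nC] [n'1 n'C].
have [u [Q [V [W [f [x [[fr oV oW Vx Wp] [pE cf gb bg]]]]]]]] := graph_point rC bp.
have C1 : Creg 1 0 V f by exact: (@creg_C1 _ _ (Ck 2) 0 V f oV ler01 I cf).
have [d1 d10 Vd] := open_ballP oV Vx.
have [d2 d20 Wd] := open_ballP oW Wp.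
have /cont_ballP/(_ _ d20)[d3 d30 cont] := @graph_cont u Q _ _ (Creg_cont C1 Vx).
apply: (normal_unique bC fr pE (sdiff_fdiff (Creg_sdiff oV Vx C1))) => //.
exists (Num.min d1 d3) => [|y]; first by rewrite lt_min d10.
rewrite lt_min => /andP[/Vd Vy /cont cy].
by have /(body_boundary _ bC)[] : boundary C (y *m Q + f y *: u) by apply: gb => //; apply: Wd; rewrite pE.
Qed.

End Normals.

(** * The boundary as a graph over a supporting hyperplane *)

Section LowerFunction.
Context {R : realType} {m : nat}.
Implicit Types (C : set 'rV[R]_m.+1) (u c nu p q : 'rV[R]_m.+1) (Q : 'M[R]_(m, m.+1)) (z w g : 'rV[R]_m).

Definition pt p u Q z (s : R) : 'rV[R]_m.+1 := p + (z *m Q + s *: u).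

(** An infimum of heights makes sense before any regularity is known, so the same formula describes
    both summands and their sum. *)
Definition lower C p u Q z : R := inf [set s | C (pt p u Q z s)].

(* Over the ball of radius [del] in the hyperplane orthogonal to [u], the lower boundary of [C] is a graph
   lying below height [eps]. *)
Definition chart C p u Q (eps del : R) : Prop :=
  [/\ body C, C p, frame u Q & forall c, C c -> 0 <= dotp u (c - p)] /\
  [/\ 0 < eps, 0 < del & forall z, `|z| < del -> C^° (pt p u Q z eps)].

Lemma chart_exists C p u Q (e : R) : body C -> C p -> frame u Q ->
  (forall c, C c -> 0 <= dotp u (c - p)) -> 0 < e -> C^° (p + e *: u) ->
  exists del, chart C p u Q e del.
Proof.
move=> bC Cp fr sup e0 /interiorP[d d0 dC].
have [K K0 KQ] := mulmx_bound Q.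
have d2 : 0 < d / 2 by rewrite divr_gt0.
exists (d / 2 / K); split=> //; split=> // [|z zd]; first by rewrite divr_gt0.
apply/interiorP; exists (d / 2) => // y yd; apply: dC.
have -> : y - (p + e *: u) = (y - pt p u Q z e) + z *m Q.
  by rewrite /pt; move: (z *m Q) => a; vring.
rewrite (le_lt_trans (ler_normD _ _))// [d]splitr ltrD//.
by rewrite (le_lt_trans (KQ z))// mulrC -ltr_pdivlMr.
Qed.

Lemma pt_coord p u Q c : frame u Q -> c = pt p u Q ((c - p) *m Q^T) (dotp u (c - p)).
Proof. by move=> fr; rewrite /pt (dotpC u) -(frame_decomp (c - p) fr) addrC subrK. Qed.

Lemma pt_horiz p u Q z s : frame u Q -> (pt p u Q z s - p) *m Q^T = z.
Proof. by move=> fr; rewrite /pt addrAC subrr add0r (frame_coord z s fr). Qed.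

Lemma pt_height p u Q z s : frame u Q -> dotp u (pt p u Q z s - p) = s.
Proof. by move=> fr; rewrite /pt addrAC subrr add0r (frame_height z s fr). Qed.

Lemma pt_convex p u Q z w s s' (t : R) :
  pt p u Q (t *: z + (1 - t) *: w) (t * s + (1 - t) * s') =
  t *: pt p u Q z s + (1 - t) *: pt p u Q w s'.
Proof.
rewrite /pt mulmxDl -!scalemxAl; move: (z *m Q) (w *m Q) => a b; vring.
Qed.

Context (C : set 'rV[R]_m.+1) (p u : 'rV[R]_m.+1) (Q : 'M[R]_(m, m.+1)) (eps del : R).
Context (H : chart C p u Q eps del).
Local Notation P := (pt p u Q).
Local Notation lw := (lower C p u Q).

Let bC : body C. Proof. by have [[]] := H. Qed.
Let Cp : C p. Proof. by have [[]] := H. Qed.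
Let fr : frame u Q. Proof. by have [[]] := H. Qed.
Let sup c : C c -> 0 <= dotp u (c - p). Proof. by have [[_ _ _ S] _] := H; exact: S. Qed.
Let eps0 : 0 < eps. Proof. by have [_ []] := H. Qed.
Let del0 : 0 < del. Proof. by have [_ []] := H. Qed.
Let inte z : `|z| < del -> C^° (P z eps). Proof. by have [_ [_ _]] := H; apply. Qed.
Let u1 : dotp u u = 1. Proof. by have [] := fr. Qed.

Lemma pt_dist z s s' : `|P z s - P z s'| <= `|s - s'|.
Proof.
have -> : P z s - P z s' = (s - s') *: u by rewrite /pt; move: (z *m Q) => a; vring.
by rewrite normrZ ler_piMr// unit_norm_le1.
Qed.

Lemma lower_lb z : lbound [set s | C (P z s)] 0.
Proof. by move=> s /= /sup; rewrite pt_height. Qed.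

Lemma lower_le z s : C (P z s) -> lw z <= s.
Proof. by move=> Cs; apply: ge_inf => //; exists 0; exact: lower_lb. Qed.

Lemma lower_mem z : `|z| < del -> C (P z (lw z)).
Proof.
move=> zd; apply: (body_limit bC) => e e0.
have hi : has_inf [set s | C (P z s)].
  split; last by exists 0; exact: lower_lb.
  by exists eps; apply: interior_sub; exact: inte.
have [s Cs sl] := inf_adherent e0 hi.
exists (P z s) => //; rewrite (le_lt_trans (pt_dist _ _ _))// ger0_norm ?subr_ge0 ?lower_le//.
by rewrite ltrBlDl.
Qed.

Lemma lower_lt_eps z : `|z| < del -> lw z < eps.
Proof.
move=> zd; have /interiorP[d d0 dC] := inte zd.
have d2 : 0 < d / 2 by rewrite divr_gt0.
have : lw z <= eps - d / 2.
  apply/lower_le/dC; rewrite (le_lt_trans (pt_dist _ _ _))// addrAC subrr add0r normrN gtr0_norm//.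
  by rewrite ltr_pdivrMr// ltr_pMr// ltr1n.
by move/le_lt_trans; apply; rewrite ltrBlDr ltrDl.
Qed.

Lemma above_lower_interior z s : `|z| < del -> lw z < s -> s <= eps -> C^° (P z s).
Proof.
move=> zd ls se; have le := lower_lt_eps zd.
have el : 0 < eps - lw z by rewrite subr_gt0.
pose t := (s - lw z) / (eps - lw z).
have t0 : 0 < t by rewrite divr_gt0// subr_gt0.
have t1 : t <= 1 by rewrite ler_pdivrMr// mul1r lerD2r.
have tE : t * (eps - lw z) = s - lw z by rewrite divfK// gt_eqF.
have -> : P z s = t *: P z eps + (1 - t) *: P z (lw z).
  rewrite -pt_convex -scalerDl [t + (1 - t)]addrC subrK scale1r; congr (P z _).
  by rewrite -[s](subrK (lw z)) -tE; ring.
by apply: interior_convex => //; [exact: inte|exact: lower_mem|rewrite t0].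
Qed.

Lemma lower_boundary z : `|z| < del -> boundary C (P z (lw z)).
Proof.
move=> zd; apply/(body_boundary _ bC); split; first exact: lower_mem.
move=> /interiorP[d d0 dC]; have d2 : 0 < d / 2 by rewrite divr_gt0.
have : lw z <= lw z - d / 2.
  apply/lower_le/dC; rewrite (le_lt_trans (pt_dist _ _ _))// addrAC subrr add0r normrN gtr0_norm//.
  by rewrite ltr_pdivrMr// ltr_pMr// ltr1n.
by rewrite leNgt ltrBlDr ltrDl d2.
Qed.

Lemma lower0 : lw 0 = 0.
Proof.
apply/eqP; rewrite eq_le; apply/andP; split.
  by apply: lower_le; rewrite /pt mul0mx scale0r !addr0.
by have := lower_mem (z := 0); rewrite normr0 => /(_ del0)/lower_lb.
Qed.

Lemma lower_ge0 z : `|z| < del -> 0 <= lw z.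
Proof. by move=> /lower_mem/lower_lb. Qed.

Lemma boundary_lower c : boundary C c -> `|(c - p) *m Q^T| < del -> dotp u (c - p) < eps ->
  dotp u (c - p) = lw ((c - p) *m Q^T).
Proof.
move=> /(body_boundary _ bC)[Cc nc] zd se; apply/eqP; rewrite eq_le; apply/andP; split.
  rewrite leNgt; apply/negP => ls; apply: nc; rewrite (pt_coord p c fr).
  exact: above_lower_interior (ltW se).
by apply: lower_le; rewrite -pt_coord.
Qed.

Lemma pt_near z s e : 0 < e -> exists2 d : R, 0 < d & forall w, `|w - z| < d -> `|P w s - P z s| < e.
Proof.
move=> e0; have [K K0 KQ] := mulmx_bound Q.
exists (e / K) => [|w wd]; first by rewrite divr_gt0.
have -> : P w s - P z s = (w - z) *m Q by rewrite mulmxBl /pt; move: (z *m Q) (w *m Q) => a b; vring.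
by rewrite (le_lt_trans (KQ _))// mulrC -ltr_pdivlMr.
Qed.

Lemma lower_cont z : `|z| < del -> {for z, continuous lw}.
Proof.
move=> zd; have zd' : 0 < del - `|z| by rewrite subr_gt0.
apply/cont_ballP => e e0.
have le := lower_lt_eps zd.
(* Upper bound: a point slightly above the graph is interior and stays in [C] when moved
   horizontally. *)
have [d1 d10 H1] : exists2 d1 : R, 0 < d1 & forall w, `|w - z| < d1 -> lw w < lw z + e.
  have m0 : 0 < Num.min (e / 2) (eps - lw z) by rewrite lt_min subr_gt0 le divr_gt0.
  have me : Num.min (e / 2) (eps - lw z) <= e / 2 by rewrite ge_min lexx.
  have me2 : Num.min (e / 2) (eps - lw z) <= eps - lw z by rewrite ge_min lexx orbT.
  move: m0 me me2; set s := Num.min _ _ => s0 se se2.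
  have /interiorP[d d0 dC] : C^° (P z (lw z + s)).
    by apply: above_lower_interior => //; [rewrite ltrDl|rewrite -lerBrDl].
  have [d' d'0 H1] := pt_near z (lw z + s) d0.
  exists d' => // w /H1/dC/lower_le/le_lt_trans; apply.
  by rewrite ltrD2l (le_lt_trans se)// ltr_pdivrMr// ltr_pMr// ltr1n.
(* Lower bound: a point slightly below the graph lies outside the closed set [C], and so do its
   horizontal neighbours; if the graph dropped beneath one of them, that neighbour would be
   interior. *)
have [d2 d20 H2] : exists2 d2 : R, 0 < d2 & forall w, `|w - z| < d2 -> lw z - e / 2 <= lw w.
  have nC : ~ C (P z (lw z - e / 2)).
    by move=> /lower_le; rewrite leNgt ltrBlDr ltrDl divr_gt0.
  have [d d0 dC] := body_notin bC nC.
  have [d' d'0 H2] := pt_near z (lw z - e / 2) d0.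
  exists (Num.min d' (del - `|z|)) => [|w]; first by rewrite lt_min d'0.
  rewrite lt_min => /andP[/H2/dC nCw wd]; rewrite leNgt; apply/negP => wl.
  have wdel : `|w| < del by rewrite -[w](subrK z) (le_lt_trans (ler_normD _ _))//; lra.
  apply: nCw; apply: interior_sub; apply: (above_lower_interior wdel wl).
  by rewrite (le_trans _ (ltW le))// lerBlDr lerDl divr_ge0// ltW.
exists (Num.min d1 d2) => [|w]; first by rewrite lt_min d10.
rewrite lt_min => /andP[/H1 A /H2 B]; rewrite ltr_norml; apply/andP; split; lra.
Qed.

Lemma lower_convex z c (t : R) : `|z| < del -> C c -> 0 <= t <= 1 ->
  lw (z + t *: ((c - p) *m Q^T - z)) <= lw z + t * (dotp u (c - p) - lw z).
Proof.
move=> zd Cc t01; apply: lower_le.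
rewrite (_ : _ + _ = t *: ((c - p) *m Q^T) + (1 - t) *: z); last first.
  by move: (_ *m Q^T) => a; vring.
rewrite (_ : lw z + _ = t * dotp u (c - p) + (1 - t) * lw z); last by ring.
by rewrite pt_convex -pt_coord//; have [_ vC _] := bC; apply: vC => //; exact: lower_mem.
Qed.

(** Sliding from [z] a short way towards [c] compares the tangent with the chord, so convexity turns
    the derivative at [z] into a support of the whole body. *)
Lemma lower_support z g c : `|z| < del -> fdiff lw z (fun h => dotp h g) -> C c ->
  lw z + dotp ((c - p) *m Q^T - z) g <= dotp u (c - p).
Proof.
move=> zd lg Cc; set v := _ - z; set s := dotp u _.
rewrite leNgt; apply/negP => lt0.
pose k := lw z + dotp v g - s; have k0 : 0 < k by rewrite subr_gt0.
have v1 : 0 < 1 + `|v| by rewrite ltr_pwDl.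
have e0 : 0 < k / 2 / (1 + `|v|) by rewrite divr_gt0// divr_gt0.
have eE : k / 2 / (1 + `|v|) * (1 + `|v|) = k / 2 by rewrite divfK// gt_eqF.
have [d d0 Hd] := lg _ e0; move: (k / 2 / _) e0 eE Hd => e e0 eE Hd.
pose t := Num.min 1 (d / (1 + `|v|) / 2).
have t0 : 0 < t by rewrite lt_min ltr01 !divr_gt0.
have t1 : t <= 1 by rewrite ge_min lexx.
have td : t * `|v| < d.
  have : t <= d / (1 + `|v|) / 2 by rewrite ge_min lexx orbT.
  have E : d / (1 + `|v|) / 2 * (1 + `|v|) = d / 2 by rewrite mulrAC divfK// gt_eqF.
  move=> tl; have := ler_wpM2r (ltW v1) tl; rewrite E; nra.
have A := lower_convex zd Cc (t := t); rewrite -/v -/s (ltW t0) t1 in A; move/(_ isT) : A => A.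
have := Hd (z + t *: v); have -> : z + t *: v - z = t *: v by rewrite addrAC subrr add0r.
rewrite normrZ (gtr0_norm t0) dotpZl => /(_ td); rewrite ler_norml => /andP[B _].
have D : t * k <= e * (t * `|v|) by rewrite /k; lra.
have : k <= e * `|v| by rewrite -(ler_pM2l t0) mulrCA.
move: eE; have := normr_ge0 v; nra.
Qed.

Lemma lower_grad0 g : fdiff lw 0 (fun h => dotp h g) -> g = 0.
Proof.
move=> lg; apply: oppr_inj; rewrite oppr0.
apply: (@fdiff_max _ _ (fun z => - lw z) 0).
  move=> e e0; have [d d0 Hd] := lg e e0; exists d => // y /Hd.
  rewrite dotpNr.
  suff -> : - lw y - - lw 0 - - dotp (y - 0) g = - (lw y - lw 0 - dotp (y - 0) g) by rewrite normrN.
  by ring.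
by exists del => // y; rewrite subr0 => /lower_ge0 ly; rewrite lower0 oppr0 oppr_le0.
Qed.

Lemma lower_normal z g : `|z| < del -> fdiff lw z (fun h => dotp h g) ->
  normal_at C (P z (lw z)) ((Num.sqrt (1 + dotp g g))^-1 *: (g *m Q - u)).
Proof.
move=> zd lg; have g1 : 0 < 1 + dotp g g by rewrite ltr_pwDl// dotp_ge0.
have s0 : 0 < Num.sqrt (1 + dotp g g) by rewrite sqrtr_gt0.
split.
  rewrite dotpZl dotpZr mulrA -invfM -expr2 sqr_sqrtr ?(ltW g1)//.
  rewrite dotpBl !dotpBr (frame_QQ _ _ fr) (frame_dotQ _ fr) (dotpC u) (frame_dotQ _ fr) u1.
  by rewrite subr0 sub0r opprK addrC mulVf// gt_eqF// addrC.
move=> c Cc; rewrite dotpZl pmulr_rle0 ?invr_gt0//.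
have := lower_support zd lg Cc.
have E (q : 'rV[R]_m.+1) : c - q = (c - p) - (q - p) by vring.
rewrite (E (P z (lw z))).
rewrite (dotpBr _ _ (_ - u)) !(dotpBl (g *m Q)) !dotp_mulr (pt_horiz p z _ fr) pt_height//.
by rewrite dotpBl !(dotpC g); lra.
Qed.

End LowerFunction.

(** * Passing between charts and arbitrary graph representations *)

Section Transfer.
Context {R : realType} {m : nat}.
Implicit Types (C : set 'rV[R]_m.+1) (u c nu p q : 'rV[R]_m.+1) (Q : 'M[R]_(m, m.+1)) (z w g : 'rV[R]_m).

Lemma pt0 p u Q : pt p u Q 0 0 = p.
Proof. by rewrite /pt mul0mx scale0r !addr0. Qed.

Lemma lower_pt_cont C p u Q eps del z : chart C p u Q eps del -> `|z| < del ->
  {for z, continuous (fun w => pt p u Q w (lower C p u Q w))}.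
Proof.
move=> H zd; apply: continuousD; first exact: cst_continuous.
exact: graph_cont (lower_cont H zd).
Qed.

Lemma creg_sub_cst r al d (f : 'rV[R]_m -> R) (x0 : 'rV[R]_m) : al <= 1 ->
  creg r al (cball d) f -> creg r al [set x | `|x - x0| < d] (fun x => f (x - x0)).
Proof.
move=> al1 cf; have oV := @open_ball0 _ m d x0; have oB := @open_cball R m d.
have cg r' al' : al' <= 1 -> forall j, creg r' al' [set x | `|x - x0| < d] (fun x => (x - x0) 0 j).
  move=> al'1 j.
  have K := cregB oV al'1 (creg_coord r' j oV al'1) (creg_cst r' al' (x0 0 j) oV).
  by apply: creg_ext K => // x _; rewrite !mxE.
(* [creg_comp] excludes order 0, but a translation is C^1, so [Creg_comp] covers every finite
   order. *)
case: r cf => [k||] cf; last 2 first.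
- by apply: (@creg_comp _ _ _ Cinf al _ (cball d) f (fun x => x - x0)) => //; exact: cg.
- by apply: (@creg_comp _ _ _ Comega al _ (cball d) f (fun x => x - x0)) => //; exact: cg.
apply: (@Creg_comp _ _ _ k al _ (cball d) f (fun x => x - x0)) => //.
- by move=> j; exact: (cg (Ck 1) 0 ler01 j).
- by move=> j; exact: (cg (Ck k) al al1 j).
Qed.

Lemma creg_regular C p u Q eps del d r al : chart C p u Q eps del -> 0 < d -> al <= 1 ->
  creg r al (cball d) (lower C p u Q) -> regular_near r al C p.
Proof.
move=> H d0 al1 cf; have [[bC Cp fr sup] [eps0 del0 inte]] := H.
pose x0 := p *m Q^T; pose f x := lower C p u Q (x - x0) + dotp p u.
pose V0 := [set x : 'rV[R]_m | `|x - x0| < d].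
have oV0 : open V0 by exact: open_ball0.
have Vx0 : V0 x0 by rewrite /V0 /= subrr normr0.
have cF : creg r al V0 f by apply: cregD => //; [exact: creg_sub_cst|exact: creg_cst].
have [d1 d10 gF] := creg_graph_reg oV0 Vx0 cF.
pose e := Num.min d1 del; have e0 : 0 < e by rewrite lt_min d10.
have [K K0 KQ] := mulmx_bound Q^T.
(* Bounding the height by [eps] cuts off the upper part of the boundary lying over the same ball. *)
pose W := [set c | `|(c - p) *m Q^T| < e] `&` [set c | dotp u (c - p) < eps].
have cT : continuous (fun c : 'rV[R]_m.+1 => (c - p) *m Q^T).
  move=> c; apply/cont_ballP => e' e'0; exists (e' / K) => [|y yc]; first by rewrite divr_gt0.
  have -> : (y - p) *m Q^T - (c - p) *m Q^T = (y - c) *m Q^T by rewrite !mulmxBl; vring.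
  by rewrite (le_lt_trans (KQ _))// mulrC -ltr_pdivlMr.
have cH : continuous (fun c : 'rV[R]_m.+1 => dotp u (c - p)).
  by move=> c; apply: continuous_comp; [apply: continuousB => //; exact: cst_continuous|exact: dotp_cont].
have oW : open W.
  apply: openI.
    have -> : [set c : 'rV[R]_m.+1 | `|(c - p) *m Q^T| < e] =
        (fun c : 'rV[R]_m.+1 => (c - p) *m Q^T) @^-1` cball e by [].
    by move/continuousP : cT; apply; exact: open_cball.
  have -> : [set c : 'rV[R]_m.+1 | dotp u (c - p) < eps] =
     (fun c : 'rV[R]_m.+1 => dotp u (c - p)) @^-1` [set x | x < eps] by [].
  by move/continuousP : cH; apply; exact: open_lt.
have [u1 QQ Qu] := fr.
pose V := [set x : 'rV[R]_m | `|x - x0| < e].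
have gE x : x *m Q + f x *: u = pt p u Q (x - x0) (lower C p u Q (x - x0)).
  rewrite /pt /f mulmxBl; set l := lower _ _ _ _ _.
  transitivity ((x0 *m Q + dotp p u *: u) + (x *m Q - x0 *m Q + l *: u)).
    by move: l (x *m Q) (x0 *m Q) (dotp p u) => l a b k; vring.
  by congr (_ + _); rewrite -frame_decomp.
exists u, Q, V, W, f; split; first by split=> //; exact: enorm1.
split=> //.
- exact: open_ball0.
- by split=> /=; rewrite subrr ?mul0mx ?normr0 ?dotp0r.
- apply/seteqP; split=> c [Xc Wc]; split=> //.
  + have [We Ws] := Wc; exists (c *m Q^T).
      by rewrite /V /= -mulmxBl.
    rewrite gE -mulmxBl -(boundary_lower H Xc)//; first by rewrite -pt_coord.
    by rewrite (lt_le_trans We)// ge_min lexx orbT.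
  + have [x Vx xE] := Xc; rewrite -xE gE; apply: (lower_boundary H).
    by rewrite (lt_le_trans Vx)// ge_min lexx orbT.
- apply: gF; first exact: open_ball0.
  by move=> y /= yd; rewrite (lt_le_trans yd)// ge_min lexx.
Qed.

(** Change of frame: [psi] reads the old graph in the horizontal coordinates of the new one. Its
    inverse is regular by [creg_inverse], and the new height function is the height of the old graph
    composed with that inverse. *)
Lemma lower_creg C p u Q eps del r al : chart C p u Q eps del -> al <= 1 -> at_least_C1 r ->
  regular_near r al C p -> exists2 d, 0 < d <= del & creg r al (cball d) (lower C p u Q).
Proof.
move=> H al1 gr rC; have [[bC Cp fr sup] [eps0 del0 inte]] := H.
have l0 := lower0 H.
have bp : boundary C p by have := lower_boundary H (z := 0); rewrite normr0 l0 pt0 => /(_ del0).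
have [u' [Q' [V [W [f [x0 [[fr' oV oW Vx Wp] [pE cf gb bg]]]]]]]] := graph_point rC bp.
have f1 := creg_C1 oV al1 gr cf.
have [d1 d10 Vd1] := open_ballP oV Vx; have [d2 d20 Wd2] := open_ballP oW Wp.
have normalE : u = dotp u u' *: (u' - grad f x0 *m Q').
  apply: oppr_inj; rewrite -scaleNr -dotpNl.
  apply: (graph_normal bC fr' pE (sdiff_fdiff (Creg_sdiff oV Vx f1))); last first.
    by move=> c Cc; rewrite dotpNl oppr_le0 sup.
  have /cont_ballP/(_ _ d20)[d3 d30 cont] := @graph_cont _ _ u' Q' _ _ (Creg_cont f1 Vx).
  exists (Num.min d1 d3) => [|y]; first by rewrite lt_min d10.
  rewrite lt_min => /andP[/Vd1 Vy /cont cy].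
  by have /(body_boundary _ bC)[] : boundary C (y *m Q' + f y *: u') by apply: gb => //; apply: Wd2; rewrite pE.
pose S x := x *m Q' + f x *: u' - p.
pose psi x := S x *m Q^T.
have SC j : creg r al V (fun x => S x 0 j).
  have K := cregB oV al1 (cregD oV (@creg_mulmx _ _ _ _ r al V id Q' j oV al1 (fun i => creg_coord r i oV al1))
     (cregZ (u' 0 j) oV al1 cf)) (creg_cst r al (p 0 j) oV).
  by apply: creg_ext K => // x _; rewrite /S !mxE mulrC.
have psiC j : creg r al V (fun x => psi x 0 j) by exact: creg_mulmx.
have psi1 j : Creg 1 0 V (fun x => psi x 0 j) := creg_C1 oV al1 gr (psiC j).
have g0 := sdiff_fdiff (Creg_sdiff oV Vx f1).
have DS : fdiff S x0 (fun v => v *m (Q' + (grad f x0)^T *m u')).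
  have u0 : 0 < 1 + `|u'| by rewrite ltr_pwDl.
  move=> e e0; have [d d0 Hd] := g0 _ (divr_gt0 e0 u0); exists d => // y /Hd A.
  have -> : S y - S x0 - (y - x0) *m (Q' + (grad f x0)^T *m u') = (f y - f x0 - dotp (y - x0) (grad f x0)) *: u'.
    rewrite mulmxDr mulmxA [(y - x0) *m (grad f x0)^T]mx11_scalar -/(dotp (y - x0) (grad f x0)) mul_scalar_mx.
    by rewrite /S mulmxBl; move: (y *m Q') (x0 *m Q') (dotp _ _) => a b k; vring.
  rewrite normrZ (le_trans (ler_wpM2r (normr_ge0 _) A))//.
  rewrite mulrAC ler_wpM2r// mulrAC ler_pdivrMr//.
  by rewrite ler_wpM2l ?(ltW e0)// lerDr.
have uJ : jac psi x0 \in unitmx.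
  have [K K0 KQ] := mulmx_bound Q^T.
  have DQ : fdiff (fun c => c *m Q^T) (S x0) (fun c : 'rV[R]_m.+1 => c *m Q^T).
    move: (S x0) => s e e0; exists 1 => // y _; rewrite mulmxBl subrr normr0.
    by rewrite mulr_ge0// ltW.
  have D := fdiff_mx_comp KQ (fun a b => mulmxBl a b _) DS DQ.
  have [_ ->] : (forall i j, derivable (fun y => psi y 0 j) x0 (delta_mx 0 i)) /\
     jac psi x0 = (Q' + (grad f x0)^T *m u') *m Q^T.
    apply: fdiff_jac; move: D; congr fdiff; apply/funext => v; by rewrite mulmxA.
  (* A kernel vector [v] yields a tangent vector [v *m J] without horizontal part; being orthogonal
     to the normal [u] as well, it vanishes, and then so does [v]. *)
  rewrite -row_free_unit -kermx_eq0; apply/rowV0P => v /sub_kermxP vJ.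
  set J := Q' + _ in vJ.
  have vE : v *m J = v *m Q' + dotp v (grad f x0) *: u'.
    by rewrite mulmxDr mulmxA [v *m (grad f x0)^T]mx11_scalar mul_scalar_mx.
  have vu : dotp (v *m J) u = 0.
    have [u'1 _ _] := fr'.
    rewrite vE normalE dotpZr dotpBr !dotpDl !dotpZl (frame_dotQ _ fr') u'1 (frame_QQ _ _ fr').
    by rewrite (dotpC u') (frame_dotQ _ fr'); ring.
  have vJ0 : v *m J = 0 by rewrite (frame_decomp (v *m J) fr) vu scale0r addr0 -(mulmxA v) vJ mul0mx.
  by rewrite -(frame_coord v (dotp v (grad f x0)) fr') -vE vJ0 mul0mx.
have [e e0 uP] := unit_near oV Vx psi1 uJ.
(* The inverse of [psi] is explicit: go up to the boundary over [z] and project along [u']. Only its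
   continuity has to be checked. *)
pose L z := pt p u Q z (lower C p u Q z).
pose xi z := L z *m Q'^T.
have Lc z : `|z| < del -> {for z, continuous L} by move=> zd; exact: (lower_pt_cont H zd).
have L0 : L 0 = p by rewrite /L l0 pt0.
have zero_del : `|0 : 'rV[R]_m| < del by rewrite normr0.
have [d3 d30 LW] : exists2 d : R, 0 < d & forall z, `|z| < d -> W (L z).
  have /cont_ballP/(_ _ d20)[d d0 Hd] := Lc 0 zero_del.
  by exists d => // z zd; have := Hd z; rewrite subr0 L0 => /(_ zd)/Wd2.
have [K' K'0 KQ'] := mulmx_bound Q'^T.
have xic z : `|z| < del -> {for z, continuous xi}.
  move=> /Lc/cont_ballP Lz; apply/cont_ballP => e' e'0.
  have [d d0 Hd] := Lz _ (divr_gt0 e'0 K'0).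
  exists d => // y /Hd A; rewrite /xi -mulmxBl (le_lt_trans (KQ' _))//.
  by rewrite mulrC -ltr_pdivlMr.
have xi0 : xi 0 = x0 by rewrite /xi L0 pE (frame_coord x0 _ fr').
have /cont_ballP/(_ e e0)[d4 d40 xie] := xic 0 zero_del.
pose d := Num.min del (Num.min d3 d4).
have dP z : cball d z -> [/\ `|z| < del, W (L z) & `|xi z - x0| < e].
  rewrite /cball /= !lt_min => /and3P[zd z3 z4]; split=> //; first exact: LW.
  by have := xie z; rewrite subr0 xi0; apply.
have xiP z : cball d z -> V (xi z) /\ L z = xi z *m Q' + f (xi z) *: u'.
  by move=> /dP[zd Wz _]; exact: (bg _ (lower_boundary H zd) Wz).
have Sxi z : cball d z -> S (xi z) = L z - p by move=> /xiP[_ E]; rewrite /S -E.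
have od := @open_cball R m d.
have xiV z : cball d z -> V (xi z) by case/xiP.
have xid z : cball d z -> {for z, continuous xi} by case/dP => zd _ _; exact: xic.
have psi_xi z : cball d z -> psi (xi z) = z by move=> zd; rewrite /psi Sxi// /L pt_horiz.
have uxi z : cball d z -> jac psi (xi z) \in unitmx by case/dP => _ _; exact: uP.
have xiC := creg_inverse od oV al1 gr xiV xid psi_xi uxi psiC.
exists d; first by rewrite !lt_min del0 d30 d40 /= ge_min lexx.
have SxiC j : creg r al (cball d) (fun z => S (xi z) 0 j) := creg_comp od oV al1 gr xiV (SC j) xiC.
have K := @creg_mulmx _ _ _ 1 r al (cball d) (fun z => S (xi z)) u^T 0 od al1 SxiC.
apply: creg_ext K => // z zd.
by rewrite -/(dotp (S (xi z)) u) dotpC Sxi// /L pt_height.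
Qed.

End Transfer.

(** * Curvature *)

Section Curvature.
Context {R : realType} {m : nat}.
Implicit Types (C : set 'rV[R]_m.+1) (u c nu p q : 'rV[R]_m.+1) (Q : 'M[R]_(m, m.+1)) (z w g : 'rV[R]_m).

Lemma gauss_mapE C p nu : normal_at C p nu -> (forall nu', normal_at C p nu' -> nu' = nu) ->
  gauss_map C p = nu.
Proof.
move=> [n1 nC] U; rewrite /gauss_map; case: xgetP => [nu' -> [/enormE n'1 n'C]|N].
  by apply: U.
by case: (N nu); split=> //; exact: enorm1.
Qed.

Definition graph_normal_of u Q g : 'rV[R]_m.+1 := (Num.sqrt (1 + dotp g g))^-1 *: (g *m Q - u).

Lemma graph_normal_of0 u Q : graph_normal_of u Q 0 = - u.
Proof. by rewrite /graph_normal_of dotp0l addr0 sqrtr1 invr1 scale1r mul0mx sub0r. Qed.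

Lemma inv_sqrt_bound (t : R) : 0 <= t -> `|(Num.sqrt (1 + t))^-1 - 1| <= t.
Proof.
move=> t0; have s1 : 1 <= Num.sqrt (1 + t).
  by rewrite -[leLHS]sqrtr1 ler_wsqrtr// lerDl.
have ss : Num.sqrt (1 + t) ^+ 2 = 1 + t by rewrite sqr_sqrtr// addr_ge0.
move: (Num.sqrt _) s1 ss => s s1 ss; have s0 : 0 < s by lra.
have i0 : 0 < s^-1 by rewrite invr_gt0.
have sv : s * s^-1 = 1 by rewrite divff// gt_eqF.
move: (s^-1) i0 sv => v v0 sv; rewrite ler_norml; nra.
Qed.

(** The normalising factor is 1 + O(|g|^2) and does not affect the first order. *)
Lemma graph_normal_of_fdiff u Q : fdiff (graph_normal_of u Q) 0 (fun v => v *m Q).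
Proof.
have [K K0 KQ] := mulmx_bound Q.
move=> e e0; pose M := m%:R * (`|u| + K) + 1.
have M0 : 0 < M by rewrite ltr_wpDl// mulr_ge0// addr_ge0// ltW.
exists (Num.min 1 (e / M)) => [|g]; first by rewrite lt_min ltr01 divr_gt0.
rewrite subr0 graph_normal_of0 lt_min ltr_pdivlMr// => /andP[g1 gM].
have -> : graph_normal_of u Q g - - u - g *m Q = ((Num.sqrt (1 + dotp g g))^-1 - 1) *: (g *m Q - u).
  by rewrite /graph_normal_of; move: (g *m Q) (_^-1) => a s; vring.
rewrite normrZ.
have A1 := inv_sqrt_bound (dotp_ge0 g).
have A2 : dotp g g <= m%:R * (`|g| * `|g|) by rewrite (le_trans (ler_norm _))// norm_dotp_le.
have A3 : `|g *m Q - u| <= `|u| + K.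
  rewrite (le_trans (ler_normB _ _))// addrC lerD2l (le_trans (KQ g))// ler_piMr ?(ltW K0)//.
  exact: ltW.
apply: (le_trans (ler_pM (normr_ge0 _) (normr_ge0 _) (le_trans A1 A2) A3)).
have -> : m%:R * (`|g| * `|g|) * (`|u| + K) = (`|g| * (m%:R * (`|u| + K))) * `|g| by ring.
rewrite ler_wpM2r// (le_trans _ (ltW gM))// ler_wpM2l// /M lerDl//.
Qed.

Section Chart.
Context (C : set 'rV[R]_m.+1) (p u : 'rV[R]_m.+1) (Q : 'M[R]_(m, m.+1)) (eps del d : R).
Context (H : chart C p u Q eps del).
Context (uniq : forall q nu nu', boundary C q -> normal_at C q nu -> normal_at C q nu' -> nu = nu').
Context (d0 : 0 < d).
Context (dd : d <= del).
Local Notation P := (pt p u Q).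
Local Notation lw := (lower C p u Q).
Context (l2 : Creg 2 0 (cball d) lw).

Let fr : frame u Q. Proof. by have [[]] := H. Qed.
Let eps0 : 0 < eps. Proof. by have [_ []] := H. Qed.

Lemma gauss_map_unique q nu : boundary C q -> normal_at C q nu -> gauss_map C q = nu.
Proof.
by move=> bq nq; apply: gauss_mapE => // nu' n'q; exact: (uniq bq).
Qed.

Lemma lower_fdiff z : `|z| < d -> fdiff lw z (fun h => dotp h (grad lw z)).
Proof.
move=> zd; have l1 : Creg 1 0 (cball d) lw by exact: (Creg_down (@open_cball R m d) ler01 l2).
exact: sdiff_fdiff (Creg_sdiff (@open_cball R m d) zd l1).
Qed.

Let zero_d : `|0 : 'rV[R]_m| < d. Proof. by rewrite normr0. Qed.

Lemma lower_grad_at0 : grad lw 0 = 0.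
Proof. exact: (lower_grad0 H (lower_fdiff zero_d)). Qed.

Lemma gauss_map_chart z : `|z| < d -> gauss_map C (P z (lw z)) = graph_normal_of u Q (grad lw z).
Proof.
move=> zd; have zdel := lt_le_trans zd dd.
exact: (gauss_map_unique (lower_boundary H zdel) (lower_normal H zdel (lower_fdiff zd))).
Qed.

Lemma gauss_map_base : gauss_map C p = - u.
Proof.
have := gauss_map_chart zero_d.
by rewrite (lower0 H) pt0 lower_grad_at0 graph_normal_of0.
Qed.

Lemma boundary_near : exists2 r : R, 0 < r & forall q, boundary C q -> `|q - p| < r ->
  `|(q - p) *m Q^T| < d /\ q = P ((q - p) *m Q^T) (lw ((q - p) *m Q^T)).
Proof.
have [K K0 KQ] := mulmx_bound Q^T.
exists (Num.min (d / K) (eps / m.+1%:R)) => [|q bq]; first by rewrite lt_min !divr_gt0.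
rewrite lt_min !ltr_pdivlMr// => /andP[qd qe]; have [u1 _ _] := fr.
have A : `|(q - p) *m Q^T| < d by rewrite (le_lt_trans (KQ _))// mulrC.
split=> //; rewrite -(boundary_lower H bq (lt_le_trans A dd)); first exact: pt_coord.
by rewrite (le_lt_trans (ler_norm _))// (le_lt_trans (norm_dotp_unit _ u1))// mulrC.
Qed.

Lemma chart_gauss_differential : gauss_differential C p (Q^T *m hess lw 0 *m Q).
Proof.
split; first by rewrite gauss_map_base mulNmx !mulmxA (frame_uQ fr) !mul0mx oppr0.
have oB := @open_cball R m d.
have g1 j : Creg 1 0 (cball d) (fun x => grad lw x 0 j).
  exact: (@creg_grad _ _ (Ck 2) 0 _ _ j I oB l2).
have D1 := sdiff_fdiff (Creg_sdiff_rV oB zero_d g1).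
have [KQ KQ0 KQP] := mulmx_bound Q.
have D : fdiff (fun z => graph_normal_of u Q (grad lw z)) 0 (fun v => v *m hess lw 0 *m Q).
  apply: (fdiff_mx_comp KQP (fun a b => mulmxBl a b _) D1).
  by rewrite lower_grad_at0; exact: graph_normal_of_fdiff.
have [K K0 KT] := mulmx_bound Q^T.
move=> e e0; have [d1 d10 HD] := D _ (divr_gt0 e0 K0).
have [r r0 Hr] := boundary_near.
exists (Num.min r (d1 / K)) => [|q bq]; first by rewrite lt_min r0 divr_gt0.
rewrite lt_min ltr_pdivlMr// => /andP[/(Hr q bq)[zd qE] qd].
rewrite {1}qE gauss_map_chart// gauss_map_base !mulmxA.
move: zd; set z := (q - p) *m Q^T => zd.
have zK : `|z| <= K * `|q - p| by exact: KT.
have := HD z; rewrite subr0 lower_grad_at0 graph_normal_of0.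
move=> /(_ _)/le_trans; apply; first by rewrite (le_lt_trans zK)// mulrC.
by rewrite mulrAC ler_pdivrMr// -mulrA ler_wpM2l ?(ltW e0)// mulrC.
Qed.

(** On the normal line both maps vanish by definition; tangent directions are tested along boundary
    points over [t *: z], whose height component is killed for the same reason. *)
Lemma gauss_differential_unique L L' : gauss_differential C p L -> gauss_differential C p L' -> L = L'.
Proof.
rewrite /gauss_differential gauss_map_base => -[uL HL] [uL' HL'].
pose D := L - L'.
have uD : u *m D = 0.
  by apply: oppr_inj; rewrite oppr0 -mulNmx /D mulmxBr uL uL' subr0.
have [K K0 KQ] := mulmx_bound Q.
have QD z : z *m Q *m D = 0.
  apply/eqP; rewrite -normr_le0 leNgt; apply/negP => n0.
  pose t0 := `|z *m Q *m D|; have z1 : 0 < 1 + `|z| by rewrite ltr_pwDl.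
  have K1 : 0 < K + 1 by rewrite ltr_pwDr// ltW.
  (* Small enough that the bound t0 <= 2 e (K + 1) |z| obtained below contradicts the value of
     [t0]. *)
  have e0 : 0 < t0 / (4 * (K + 1) * (1 + `|z|)) by rewrite divr_gt0// !mulr_gt0.
  have eE : t0 / (4 * (K + 1) * (1 + `|z|)) * (4 * (K + 1) * (1 + `|z|)) = t0.
    by rewrite divfK// gt_eqF// !mulr_gt0.
  move: e0 eE; set e := _ / _ => e0 eE.
  have [d1 d10 H1] := HL e e0; have [d2 d20 H2] := HL' e e0.
  have := lower_fdiff zero_d; rewrite lower_grad_at0 => /(_ 1 ltr01)[d3 d30 H3].
  have m0 : 0 < Num.min (Num.min d1 d2) (Num.min d d3) by rewrite !lt_min d10 d20 d0 d30.
  move: m0; set r := Num.min _ _ => r0.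
  pose t := r / ((K + 1) * (1 + `|z|) + 1 + `|z|).
  have den0 : 0 < (K + 1) * (1 + `|z|) + 1 + `|z| by rewrite -addrA addr_gt0// mulr_gt0.
  have tp : 0 < t by rewrite divr_gt0.
  have tE : t * ((K + 1) * (1 + `|z|) + 1 + `|z|) = r by rewrite divfK// gt_eqF.
  have nz := normr_ge0 z.
  have tz : `|t *: z| < r.
    by rewrite normrZ gtr0_norm// -tE ltr_pM2l//; have := mulr_ge0 (ltW K1) (ltW z1); lra.
  have := tz; rewrite /r !lt_min => /andP[_ /andP[tzd tz3]].
  have := H3 (t *: z); rewrite subr0 (lower0 H) dotp0r !subr0 mul1r => /(_ tz3) l3.
  (* [K] accounts for the horizontal part, and 1 for the height, which is at most |t z| since the
     gradient vanishes at 0. *)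
  have q_le : `|P (t *: z) (lw (t *: z)) - p| <= (K + 1) * `|t *: z|.
    rewrite /pt addrAC subrr add0r (le_trans (ler_normD _ _))// mulrDl lerD// normrZ.
    have [u1 _ _] := fr; rewrite mul1r (le_trans _ l3)// ler_piMr// unit_norm_le1//.
  have qr : `|P (t *: z) (lw (t *: z)) - p| < r.
    apply: (le_lt_trans q_le); rewrite normrZ gtr0_norm// mulrCA -tE ltr_pM2l//.
    by nra.
  have := qr; rewrite {1}/r !lt_min => /andP[/andP[q1 q2] _].
  have bq := lower_boundary H (lt_le_trans tzd dd).
  have A1 := H1 _ bq q1; have A2 := H2 _ bq q2.
  move: A1 A2 q_le; set q := P _ _ => A1 A2 q_le.
  have A3 : `|(q - p) *m D| <= 2 * e * `|q - p|.
    have -> : (q - p) *m D = (gauss_map C q - - u - (q - p) *m L') - (gauss_map C q - - u - (q - p) *m L).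
      by rewrite /D mulmxBr; move: (_ *m L) (_ *m L') => a b; vring.
    by rewrite (le_trans (ler_normB _ _))//; lra.
  have qD : (q - p) *m D = t *: (z *m Q *m D).
    rewrite /q /pt addrAC subrr add0r mulmxDl -!scalemxAl uD scaler0 addr0.
    by [].
  rewrite qD normrZ gtr0_norm// -/t0 in A3.
  have A4 : t * t0 <= 2 * e * ((K + 1) * (t * `|z|)).
    have e2 : 0 <= 2 * e by lra.
    rewrite (le_trans A3)// ler_wpM2l//.
    by move: q_le; rewrite normrZ gtr0_norm.
  have : t0 <= 2 * e * ((K + 1) * `|z|).
    rewrite -(ler_pM2l tp) (le_trans A4)//.
    by rewrite (_ : t * (_ * _) = 2 * e * ((K + 1) * (t * `|z|)))//; ring.
  have a1 : 0 <= e * (K + 1) by rewrite mulr_ge0 ?(ltW e0) ?(ltW K1).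
  have a2 := mulr_ge0 a1 nz.
  have a3 : 0 < e * (K + 1) by rewrite mulr_gt0.
  rewrite -eE; lra.
have : (Q^T *m Q + u^T *m u) *m D = 0.
  rewrite mulmxDl -!mulmxA uD mulmx0 addr0.
  suff -> : Q *m D = 0 by rewrite mulmx0.
  by apply/row_matrixP => i; rewrite row_mul row0 rowE QD.
by rewrite (frame_id fr) mul1mx /D => /eqP; rewrite subr_eq0 => /eqP.
Qed.

(** The differential is unique, and another orthonormal basis [Q'] conjugates the Hessian by the
    orthogonal matrix [Q' *m Q^T], which preserves the determinant; so [xget] has a single
    candidate. *)
Lemma gauss_curv_chart : gauss_curv C p = \det (hess lw 0).
Proof.
have [u1 QQ Qu] := fr.
have rel : gauss_curv_rel C p (\det (hess lw 0)).
  exists (Q^T *m hess lw 0 *m Q), Q; split=> //.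
  - exact: chart_gauss_differential.
  - by rewrite gauss_map_base linearN /= mulmxN Qu oppr0.
  - by rewrite !mulmxA QQ mul1mx -mulmxA QQ mulmx1.
have uni (g : R) : gauss_curv_rel C p g -> g = \det (hess lw 0).
  move=> [L [Q' [HL Q'Q' Q'n ->]]].
  have Q'u : Q' *m u^T = 0.
    by move: Q'n; rewrite gauss_map_base linearN /= mulmxN => /eqP; rewrite oppr_eq0 => /eqP.
  rewrite (gauss_differential_unique HL chart_gauss_differential).
  pose O := Q' *m Q^T.
  have OO : O *m O^T = 1%:M.
    rewrite /O trmx_mul trmxK mulmxA -(mulmxA Q').
    have -> : Q^T *m Q = 1%:M - u^T *m u by rewrite -(frame_id fr) addrK.
    by rewrite mulmxBr mulmx1 mulmxA Q'u mul0mx subr0.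
  have -> : Q' *m (Q^T *m hess lw 0 *m Q) *m Q'^T = O *m hess lw 0 *m O^T.
    by rewrite /O trmx_mul trmxK !mulmxA.
  rewrite !det_mulmx det_tr mulrAC -{2}(det_tr O) -det_mulmx OO det1 mul1r.
  by [].
by rewrite /gauss_curv; case: xgetP => [g -> /uni//|N]; case: (N _ rel).
Qed.

End Chart.
End Curvature.

(** * Minkowski sums *)

Section Hessians.
Context {R : realType} {m : nat}.
Implicit Types (F : 'rV[R]_m -> R) (x y z w : 'rV[R]_m) (M N : 'M[R]_m).

(** Positivity of the quadratic form alone would be too weak without symmetry: a quarter turn and
    its opposite have zero quadratic forms and sum to zero. The three-point inequality excludes such
    matrices. *)
Definition cyclic_monotone M : Prop :=
  forall x y, dotp (x *m M) y <= dotp (x *m M) x + dotp (y *m M) y.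

(* Summing the three supporting inequalities along the cycle [0], [t x], [t y]. *)
Lemma hess_cyclic_monotone F d : 0 < d -> Creg 2 0 (cball d) F -> grad F 0 = 0 ->
  (forall z w, `|z| < d -> `|w| < d -> F z + dotp (w - z) (grad F z) <= F w) ->
  cyclic_monotone (hess F 0).
Proof.
move=> d0 F2 gF0 sup x y; have oB := @open_cball R m d.
have B0 : cball d (0 : 'rV[R]_m) by rewrite /cball /= normr0.
have g1 j : Creg 1 0 (cball d) (fun x => grad F x 0 j).
  exact: (@creg_grad _ _ (Ck 2) 0 _ _ j I oB F2).
have D := sdiff_fdiff (Creg_sdiff_rV oB B0 g1).
rewrite -/(hess F 0) in D; move: (hess F 0) D => M D.
pose k := dotp (x *m M) (y - x) - dotp (y *m M) y.
suff : k <= 0 by rewrite /k dotpBr; lra.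
rewrite leNgt; apply/negP => k0.
pose T := m%:R * (`|x| * `|y - x| + `|y| * `|y|) + 1.
have T0 : 0 < T by rewrite ltr_wpDl// mulr_ge0// addr_ge0// mulr_ge0.
have e0 : 0 < k / (2 * T) by rewrite divr_gt0// mulr_gt0.
have eE : k / (2 * T) * (2 * T) = k by rewrite divfK// gt_eqF// mulr_gt0.
have [d1 d10 H1] := D _ e0; move: (k / (2 * T)) e0 eE H1 => e e0 eE H1.
have r0 : 0 < Num.min d d1 by rewrite lt_min d0.
pose t := Num.min d d1 / (1 + `|x| + `|y|).
have nx := normr_ge0 x; have ny := normr_ge0 y.
have s0 : 0 < 1 + `|x| + `|y| by lra.
have t0 : 0 < t by rewrite divr_gt0.
have tE : t * (1 + `|x| + `|y|) = Num.min d d1 by rewrite divfK// gt_eqF.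
have tn v : `|v| < 1 + `|x| + `|y| -> `|t *: v| < d /\ `|grad F (t *: v) - t *: (v *m M)| <= t * (e * `|v|).
  move=> vn; have : `|t *: v| < Num.min d d1 by rewrite normrZ gtr0_norm// -tE ltr_pM2l.
  rewrite lt_min => /andP[vd v1]; split=> //.
  have := H1 (t *: v); rewrite gF0 !subr0 -scalemxAl normrZ gtr0_norm// => /(_ _)/le_trans; apply.
    by move: v1; rewrite normrZ gtr0_norm.
  by rewrite mulrCA.
have [xd gx] := tn x ltac:(lra); have [yd gy] := tn y ltac:(lra).
have I1 : F 0 <= F (t *: x) by have := sup 0 (t *: x) B0 xd; rewrite gF0 dotp0r addr0.
have I2 := sup _ _ xd yd; have := sup _ _ yd B0; rewrite sub0r dotpNl dotpZl => I3.
rewrite -scalerBr dotpZl in I2.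
have I4 : t * (dotp (y - x) (grad F (t *: x)) - dotp y (grad F (t *: y))) <= 0 by lra.
rewrite pmulr_rle0// in I4.
have E1 := norm_dotp_le (y - x) (grad F (t *: x) - t *: (x *m M)).
have E2 := norm_dotp_le y (grad F (t *: y) - t *: (y *m M)).
rewrite dotpBr dotpZr (dotpC _ (x *m M)) in E1; rewrite dotpBr dotpZr (dotpC _ (y *m M)) in E2.
have m0 : (0 : R) <= m%:R by rewrite ler0n.
have E3 := ler_wpM2l m0 (ler_wpM2l (normr_ge0 (y - x)) gx).
have E4 := ler_wpM2l m0 (ler_wpM2l ny gy).
have {}E1 := le_trans E1 E3; have {}E2 := le_trans E2 E4.
move: E1 E2; rewrite !ler_norml => /andP[E1 _] /andP[_ E2].
have : t * k <= t * (e * (m%:R * (`|x| * `|y - x| + `|y| * `|y|))).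
  rewrite (_ : t * (e * _) = m%:R * (`|y - x| * (t * (e * `|x|))) + m%:R * (`|y| * (t * (e * `|y|)))).
    by rewrite /k mulrBr; lra.
  by ring.
rewrite ler_pM2l// => kT.
have : e * (m%:R * (`|x| * `|y - x| + `|y| * `|y|)) = e * T - e by rewrite /T; ring.
have : e * (2 * T) = 2 * (e * T) by ring.
have := mulr_gt0 e0 T0; rewrite -eE in kT *; lra.
Qed.

(** Testing the inequality with y = t w, where w = x M, gives t |w|^2 <= O(t^2), hence w = 0. *)
Lemma cyclic_monotone_ker M x : cyclic_monotone M -> dotp (x *m M) x = 0 -> x *m M = 0.
Proof.
move=> cM x0; apply/dotp_eq0; set w := x *m M.
have w0 : 0 <= dotp (w *m M) w.
  by have := cM w 0; rewrite dotp0r mul0mx dotp0l addr0.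
suff : 0 <= - dotp w w by have := dotp_ge0 w; lra.
apply: (@quad_ge0 _ _ (dotp (w *m M) w * 2)); first by rewrite mulr_ge0.
move=> t /andP[t0 t1]; have := cM x (t *: w).
by rewrite x0 add0r -/w -scalemxAl !dotpZl !dotpZr; lra.
Qed.

Lemma cyclic_monotone_add_unit M N : cyclic_monotone M -> cyclic_monotone N ->
  M \in unitmx -> M + N \in unitmx.
Proof.
move=> cM cN uM; rewrite -row_free_unit -kermx_eq0; apply/rowV0P => v /sub_kermxP vK.
have Mv : 0 <= dotp (v *m M) v by have := cM v 0; rewrite dotp0r mul0mx dotp0l addr0.
have Nv : 0 <= dotp (v *m N) v by have := cN v 0; rewrite dotp0r mul0mx dotp0l addr0.
have : dotp (v *m M) v + dotp (v *m N) v = 0 by rewrite -dotpDl -mulmxDr vK dotp0l.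
move=> E; have /(cyclic_monotone_ker cM) vM : dotp (v *m M) v = 0 by lra.
by rewrite -[v]mulmx1 -(mulmxV uM) mulmxA vM mul0mx.
Qed.

End Hessians.

Section MinkowskiSum.
Context {R : realType} {m : nat}.
Implicit Types (A B C : set 'rV[R]_m.+1) (a b c p q u nu : 'rV[R]_m.+1) (Q : 'M[R]_(m, m.+1)).

(** Uniqueness of normals is the form of smoothness that passes to a Minkowski sum before anything
    is known about the sum's boundary as a graph. *)
Definition smooth_body C : Prop :=
  body C /\ forall q nu nu', boundary C q -> normal_at C q nu -> normal_at C q nu' -> nu = nu'.

Lemma normal_at_boundary C q nu : body C -> C q -> normal_at C q nu -> boundary C q.
Proof.
move=> bC Cq [n1 nC]; apply/(body_boundary _ bC); split=> // /interiorP[d d0 dP].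
have d2 : 0 < d / 2 by rewrite divr_gt0.
have := nC (q + (d / 2) *: nu); rewrite addrAC subrr add0r dotpZr n1 mulr1 leNgt d2 => H.
suff : false by []. apply: H; apply: dP; rewrite addrAC subrr add0r normrZ gtr0_norm//.
apply: (@le_lt_trans _ _ (d / 2)); last by rewrite ltr_pdivrMr// ltr_pMr// ltr1n.
by rewrite ler_piMr ?(ltW d2)// unit_norm_le1.
Qed.

Lemma C2_body_smooth C : C2_body C -> smooth_body C.
Proof.
move=> [/convex_body_body bC C2]; split=> // q nu nu' bq.
exact: (normal_at_unique bC (C2 q bq) bq).
Qed.

Lemma minkowski_normal A B a b nu : A a -> B b -> normal_at (minkowski_sum A B) (a + b) nu ->
  normal_at A a nu /\ normal_at B b nu.
Proof.
move=> Aa Bb [n1 nS]; split; split=> // c Cc.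
  have := nS (c + b); rewrite (_ : c + b - (a + b) = c - a); last by vring.
  by apply; exists c; split=> //; exists b.
have := nS (a + c); rewrite (_ : a + c - (a + b) = c - b); last by vring.
by apply; exists a; split=> //; exists c.
Qed.

(** A normal of the sum at a + b is a normal of [A] at [a], so uniqueness is inherited from one
    summand. *)
Lemma minkowski_smooth A B : smooth_body A -> body B -> smooth_body (minkowski_sum A B).
Proof.
move=> [bA uA] bB; have bS := minkowski_body bA bB; split=> // q nu nu' /(body_boundary _ bS)[].
move=> [a [Aa [b [Bb ->]]]] _ nq n'q.
have [na _] := minkowski_normal Aa Bb nq; have [n'a _] := minkowski_normal Aa Bb n'q.
exact: (uA a _ _ (normal_at_boundary bA Aa na) na n'a).
Qed.

(** Otherwise [ray_support] gives a normal with nonnegative product with -nu, whereas the only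
    normal at [p] is nu. The interior point found here starts the chart. *)
Lemma smooth_inward C p nu : smooth_body C -> boundary C p -> normal_at C p nu ->
  exists2 e : R, 0 < e & C^° (p + e *: - nu).
Proof.
move=> [bC uC] bp np; have /(body_boundary _ bC)[Cp _] := bp.
apply: contrapT => N.
have [e e0 ?|nu' [n'1 n'C n'u]] := @ray_support _ _ C p (- nu) bC Cp.
  by apply: N; exists e.
have E : nu' = nu by apply: (uC p).
by move: n'u; rewrite E dotpNr np.1 lerNr oppr0 ler10.
Qed.

Lemma smooth_chart C p nu Q : smooth_body C -> boundary C p -> normal_at C p nu -> frame (- nu) Q ->
  exists eps del, chart C p (- nu) Q eps del.
Proof.
move=> sC bp np fr; have [e e0 ie] := smooth_inward sC bp np.
have [bC _] := sC; have /(body_boundary _ bC)[Cp _] := bp.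
have [|del H] := chart_exists bC Cp fr _ e0 ie; last by exists e, del.
by move=> c Cc; rewrite dotpNl oppr_ge0; apply: np.2.
Qed.

Lemma lower_sum A B a b u Q e1 e2 d1 d2 d z x y g : chart A a u Q e1 d1 -> chart B b u Q e2 d2 ->
  d <= d1 -> d <= d2 -> x + y = z -> `|x| < d -> `|y| < d ->
  fdiff (lower A a u Q) x (fun h => dotp h g) -> fdiff (lower B b u Q) y (fun h => dotp h g) ->
  lower (minkowski_sum A B) (a + b) u Q z = lower A a u Q x + lower B b u Q y.
Proof.
move=> HA HB dd1 dd2 <- xd yd gA gB.
have xd1 := lt_le_trans xd dd1; have yd2 := lt_le_trans yd dd2.
have fr : frame u Q by have [[]] := HA.
set S := minkowski_sum A B; set s := _ + lower B b u Q y.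
have Ss : S (pt (a + b) u Q (x + y) s).
  exists (pt a u Q x (lower A a u Q x)); split; first exact: (lower_mem HA).
  exists (pt b u Q y (lower B b u Q y)); split; first exact: (lower_mem HB).
  by rewrite /pt mulmxDl scalerDl; move: (_ *: u) (_ *: u) (_ *m Q) (_ *m Q) => *; vring.
(* The same slope [g] is used for both supports; their linear terms cancel because the horizontal
   parts add up to x + y. *)
have lb : lbound [set t | S (pt (a + b) u Q (x + y) t)] s.
  move=> t /= [a' [Aa' [b' [Bb' E]]]].
  have I1 := lower_support HA xd1 gA Aa'; have I2 := lower_support HB yd2 gB Bb'.
  have E' : pt (a + b) u Q (x + y) t - (a + b) = (a' - a) + (b' - b) by rewrite E; vring.
  have := pt_height (a + b) (x + y) t fr; rewrite E' dotpDr => <-.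
  have := pt_horiz (a + b) (x + y) t fr; rewrite E' mulmxDl => EQ.
  have E0 : dotp ((a' - a) *m Q^T - x) g + dotp ((b' - b) *m Q^T - y) g = 0.
    rewrite -dotpDl (_ : _ - x + _ = (a' - a) *m Q^T + (b' - b) *m Q^T - (x + y)).
      by rewrite EQ subrr dotp0l.
    by move: (_ *m Q^T) (_ *m Q^T) => *; vring.
  by rewrite /s; lra.
apply/eqP; rewrite eq_le; apply/andP; split; first by apply: ge_inf => //; exists s.
by apply: lb_le_inf => //; exists s.
Qed.

End MinkowskiSum.

(** * Regularity and curvature of the sum *)

Section SumRegularity.
Context {R : realType} {m : nat}.
Implicit Types (A B C : set 'rV[R]_m.+1) (a b c p q u nu : 'rV[R]_m.+1) (Q : 'M[R]_(m, m.+1)).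

Lemma lower_supporting C p u Q eps del d : chart C p u Q eps del -> d <= del ->
  Creg 2 0 (cball d) (lower C p u Q) -> forall z w, `|z| < d -> `|w| < d ->
  lower C p u Q z + dotp (w - z) (grad (lower C p u Q) z) <= lower C p u Q w.
Proof.
move=> H dd l2 z w zd wd; have fr : frame u Q by have [[]] := H.
have := lower_support H (lt_le_trans zd dd) (lower_fdiff l2 zd) (lower_mem H (lt_le_trans wd dd)).
by rewrite (pt_horiz p w _ fr) (pt_height p w _ fr).
Qed.

(** The inclusion in [cball (d + d)] bounds the domain of h from outside: in the converse direction
    h is regular only on a given ball, and a small [d] forces the domain into it. *)
Lemma chart_parametrization A B a b u Q e1 d1 e2 d2 d : chart A a u Q e1 d1 -> chart B b u Q e2 d2 ->
  0 < d -> d <= d1 -> d <= d2 ->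
  Creg 2 0 (cball d) (lower A a u Q) -> Creg 2 0 (cball d) (lower B b u Q) ->
  hess (lower A a u Q) 0 \in unitmx ->
  let F := lower A a u Q in let G := lower B b u Q in
  let h := lower (minkowski_sum A B) (a + b) u Q in
  exists d' d'' : R, [/\ 0 < d', @cball R m d' `<=` cball (d + d) & 0 < d''] /\
  [/\ Creg 2 0 (cball d') h,
     (exists2 J, J \in unitmx & hess h 0 = J *m hess G 0) &
     forall r al, al <= 1 -> at_least_C1 (predr r) -> creg r al (cball d) F ->
       (creg r al (cball d) G -> creg r al (cball d') h) /\
       (creg r al (cball d') h -> creg r al (cball d'') G)].
Proof.
move=> HA HB d0 dd1 dd2 F2 G2 uF F G h.
have gF0 : grad F 0 = 0 by exact: (lower_grad_at0 HA d0 F2).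
have gG0 : grad G 0 = 0 by exact: (lower_grad_at0 HB d0 G2).
have cF := hess_cyclic_monotone d0 F2 gF0 (lower_supporting HA dd1 F2).
have cG := hess_cyclic_monotone d0 G2 gG0 (lower_supporting HB dd2 G2).
have uFG := cyclic_monotone_add_unit cF cG uF.
have [e [d' [d'' [phi [X [Y [Th [[e0 d'0 d''0] [[XYP Y0 phiP phiC ThP] [YC uY]]]]]]]]]] :=
  sum_parametrization d0 F2 G2 gF0 gG0 uF uFG.
have hE z : `|z| < d' -> h z = F (X z) + G (Y z).
  move=> zd; have [XYz Xd Yd gE] := XYP z zd.
  apply: (lower_sum HA HB dd1 dd2 XYz Xd Yd (lower_fdiff F2 Xd)).
  by rewrite gE; exact: (lower_fdiff G2 Yd).
have [gh hC] := sum_regular F2 G2 XYP YC hE.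
have C1 r : at_least_C1 (predr r) -> at_least_C1 r by case: r => [[]||].
have h2 : Creg 2 0 (cball d') h := hC (Ck 2) 0 ler01 I I F2 G2.
have Y1 j : Creg 1 0 (cball d') (fun x => Y x 0 j) := YC (Ck 2) 0 ler01 I I F2 G2 j.
have dm : Num.min d'' d <= d by rewrite ge_min lexx orbT.
have dm' : Num.min d'' d <= d'' by rewrite ge_min lexx.
exists d', (Num.min d'' d); split; first split=> //.
- move=> z zd; have [XYz Xd Yd _] := XYP z zd.
  by rewrite /cball -XYz /= (le_lt_trans (ler_normD _ _))// ltrD.
- by rewrite lt_min d''0.
split=> //.
- exists (jac Y 0); first by apply: uY; rewrite normr0.
  exact: (sum_hessian d0 d'0 G2 Y1 Y0 gh).
move=> r al al1 gr' FC; split=> [GC|hCr]; first exact: (hC r al al1 (C1 r gr') gr' FC GC).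
have ThP' y : `|y| < Num.min d'' d -> [/\ `|Th y| < d', Y (Th y) = y & {for y, continuous Th}].
  by move=> yd; apply: ThP; exact: lt_le_trans dm'.
have phiCr := phiC r al al1 (C1 r gr') gr' FC.
exact: (summand_regular F2 G2 h2 XYP phiP phiCr ThP' uY hE gh dm al1 (C1 r gr') gr' FC hCr).
Qed.

Lemma minkowski_regularity A B a b r (al : R) :
  C2_body A -> C2_body B ->
  boundary A a -> boundary B b -> boundary (minkowski_sum A B) (a + b) ->
  0 <= al <= 1 ->
  regular_near r al A a -> gauss_curv A a != 0 ->
  [/\ regular_near (Ck 2) 0 (minkowski_sum A B) (a + b),
      gauss_curv B b != 0 <-> gauss_curv (minkowski_sum A B) (a + b) != 0 &
      regular_near r al B b <-> regular_near r al (minkowski_sum A B) (a + b)].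
Proof.
move=> A2 B2 ba bb bS /andP[_ al1] rA kA.
have sA := C2_body_smooth A2; have sB := C2_body_smooth B2.
have bodyA := sA.1; have bodyB := sB.1.
have sS := minkowski_smooth sA bodyB; have bodyS := sS.1.
have /(body_boundary _ bodyA)[Aa _] := ba; have /(body_boundary _ bodyB)[Bb _] := bb.
have /(body_boundary _ bodyS)[Sab nS] := bS.
have [nu n1 nuS] := support_exists bodyS nS.
have nuab : normal_at (minkowski_sum A B) (a + b) nu by [].
have [nua nub] := minkowski_normal Aa Bb nuab.
have [|Q fr] := @frame_exists _ _ (- nu); first by rewrite dotpNl dotpNr opprK.
have [e1 [d1 HA]] := smooth_chart sA ba nua fr.
have [e2 [d2 HB]] := smooth_chart sB bb nub fr.
have [e3 [d3 HS]] := smooth_chart sS bS nuab fr.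
have [dA /andP[dA0 dAl] FA2] := lower_creg (r := Ck 2) HA ler01 I (A2.2 a ba).
have [dB /andP[dB0 dBl] GB2] := lower_creg (r := Ck 2) HB ler01 I (B2.2 b bb).
set u := - nu in fr HA HB HS FA2 GB2.
have ball_sub (e e' : R) : e <= e' -> @cball R m e `<=` cball e'.
  by move=> ee x xe; exact: lt_le_trans ee.
have uF : hess (lower A a u Q) 0 \in unitmx.
  by rewrite unitmxE unitfE -(gauss_curv_chart HA sA.2 dA0 dAl FA2).
(* A chart radius below any prescribed [e]; the parametrization is rebuilt on smaller balls once the
   class [r] is known there. *)
have par (e : R) : 0 < e -> exists d, [/\ 0 < d, d <= e, d <= dA & d <= dB] /\
    [/\ d <= d1, d <= d2, Creg 2 0 (cball d) (lower A a u Q) & Creg 2 0 (cball d) (lower B b u Q)].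
  move=> e0; exists (Num.min e (Num.min dA dB)).
  have lA : Num.min e (Num.min dA dB) <= dA by rewrite !ge_min lexx orbT.
  have lB : Num.min e (Num.min dA dB) <= dB by rewrite !ge_min lexx !orbT.
  split; split.
  - by rewrite !lt_min e0 dA0.
  - by rewrite ge_min lexx.
  - exact: lA.
  - exact: lB.
  - exact: le_trans lA dAl.
  - exact: le_trans lB dBl.
  - exact: Creg_sub (ball_sub _ _ lA) FA2.
  - exact: Creg_sub (ball_sub _ _ lB) GB2.
have [d [[d0 _ _ _] [l1 l2 F2 G2]]] := par 1 ltr01.
have [d' [d'' [[d'0 _ d''0] [h2 [J uJ hJ] _]]]] := chart_parametrization HA HB d0 l1 l2 F2 G2 uF.
have S2 : regular_near (Ck 2) 0 (minkowski_sum A B) (a + b).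
  exact: (creg_regular (r := Ck 2) HS d'0 ler01 h2).
split=> //.
  pose dS := Num.min d' d3; have d30 : 0 < d3 by have [_ []] := HS.
  have dS0 : 0 < dS by rewrite lt_min d'0.
  have dSl : dS <= d3 by rewrite ge_min lexx orbT.
  have hS2 : Creg 2 0 (cball dS) (lower (minkowski_sum A B) (a + b) u Q).
    by apply: Creg_sub h2; apply: ball_sub; rewrite ge_min lexx.
  (* det Hess h = det J det Hess G with det J nonzero, so both curvatures vanish together. *)
  rewrite (gauss_curv_chart HS sS.2 dS0 dSl hS2) (gauss_curv_chart HB sB.2 d0 l2 G2) hJ det_mulmx mulf_eq0.
  by rewrite unitmxE unitfE in uJ; rewrite (negPf uJ).
(* The exceptional classes are orders 0 and 1, where both sides of the equivalence follow from
   C^2. *)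
have [gr|ngr] := pselect (at_least_C1 (predr r)); last first.
  case: r rA ngr => [k||] //= rA ngr.
  have k2 : (k < 2)%N by case: k ngr {rA} => [|[|k]] // /(_ I).
  split=> _.
  - apply: (creg_regular (r := Ck k) HS d'0 al1).
    exact: (Creg_lt (@open_cball R m d') al1 k2 h2).
  - apply: (creg_regular (r := Ck k) HB dB0 al1).
    exact: (Creg_lt (@open_cball R m dB) al1 k2 GB2).
have gr1 : at_least_C1 r by case: r gr {rA} => [[]||].
have [eA /andP[eA0 _] FAr] := lower_creg HA al1 gr1 rA.
split=> [rB|rS].
- have [eB /andP[eB0 _] GBr] := lower_creg HB al1 gr1 rB.
  have [|c [[c0 ce _ _] [c1 c2 F2' G2']]] := par (Num.min eA eB); first by rewrite lt_min eA0.
  have [c' [c'' [[c'0 _ _] [_ _ reg]]]] := chart_parametrization HA HB c0 c1 c2 F2' G2' uF.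
  move: ce; rewrite le_min => /andP[cA cB].
  have [hr _] := reg r al al1 gr (creg_sub (ball_sub _ _ cA) FAr).
  exact: (creg_regular HS c'0 al1 (hr (creg_sub (ball_sub _ _ cB) GBr))).
- have [eS /andP[eS0 _] hSr] := lower_creg HS al1 gr1 rS.
  (* Half of [eS], because the domain of h lies in the ball of radius c + c. *)
  have [|c [[c0 ce _ _] [c1 c2 F2' G2']]] := par (Num.min eA (eS / 2)); first by rewrite lt_min eA0 divr_gt0.
  have [c' [c'' [[c'0 c'c c''0] [_ _ reg]]]] := chart_parametrization HA HB c0 c1 c2 F2' G2' uF.
  move: ce; rewrite le_min => /andP[cA cS].
  have [_ Gr] := reg r al al1 gr (creg_sub (ball_sub _ _ cA) FAr).
  apply: (creg_regular HB c''0 al1); apply: Gr; apply: creg_sub hSr.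
  by apply: (subset_trans c'c); apply: ball_sub; lra.
Qed.

End SumRegularity.

Theorem theorem1p1 (R : realType) (n : nat) (A B : set 'rV[R]_n)
    (a b : 'rV[R]_n) (r : regularity) (al : R) :
  C2_body A -> C2_body B ->
  boundary A a -> boundary B b -> boundary (minkowski_sum A B) (a + b) ->
  0 <= al <= 1 ->
  regular_near r al A a -> gauss_curv A a != 0 ->
  [/\ regular_near (Ck 2) 0 (minkowski_sum A B) (a + b),
      gauss_curv B b != 0 <-> gauss_curv (minkowski_sum A B) (a + b) != 0 &
      regular_near r al B b <-> regular_near r al (minkowski_sum A B) (a + b)].
Proof.
(* In dimension 0 the space is a single point, so [a] is the interior point [q] and cannot lie on
   the boundary. *)
case: n A B a b => [|m] A B a b; last exact: minkowski_regularity.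
move=> [[_ _ [q iq]] _] _ [_ nia].
by case: nia; rewrite (_ : a = q)//; apply/rowP => -[].
Qed.
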